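(* Let $(X,d,\mathfrak m)$ be a complete and separable length metric space equipped with a finite non-negative Borel measure $\mathfrak m$ with $\operatorname{supp}\mathfrak m=X$, let $I\subset\mathbb R$ be a closed, possibly unbounded, interval, and let $w_d,w_{\mathfrak m}:I\to[0,+\infty)$ be continuous functions with $\{w_d=0\}\subset\{w_{\mathfrak m}=0\}$. Let $(X_w,d_w,\mathfrak m_w)$ be the warped product of $I$ and $X$ with respect to $w_d,w_{\mathfrak m}$. Assume that the set $\{w_{\mathfrak m}=0\}\subset I$ is discrete and that for some constant $C\in\mathbb R$ $$w_{\mathfrak m}(t)\le C\inf_{s:\,w_{\mathfrak m}(s)=0}|t-s|,\qquad\forall t\in I.$$ Then $\mathsf{BL}_0(X_w)=\mathsf{BL}(X_w)$.
   Context: The infimum over the empty set is $+\infty$ (so the second condition is void if $w_{\mathfrak m}$ has no zeros). **Sobolev functions.** Let $(Z,d,\mathfrak m)$ be a complete separable metric space with a non-negative Radon measure. A probability measure $\pi$ on $C([0,1],Z)$ is a *test plan* if there is $C>0$ with $(e_t)_\sharp\pi\le C\mathfrak m$ for all $t\in[0,1]$ (where $e_t(\gamma)=\gamma_t$), $\pi$ is concentrated on $AC^2([0,1],Z)$, and $\int_0^1\int|\dot\gamma_t|^2\,d\pi(\gamma)\,dt<\infty$, where $|\dot\gamma_t|$ is the metric speed. A Borel function $f:Z\to\mathbb R$ belongs to the Sobolev class $S^2(Z)$ if there is a non-negative $G\in L^2(Z,\mathfrak m)$ with $$\int|f(\gamma_1)-f(\gamma_0)|\,d\pi(\gamma)\le\int\int_0^1G(\gamma_s)|\dot\gamma_s|\,ds\,d\pi(\gamma)\quad\text{for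 every test plan }\pi.$$ The $\mathfrak m$-a.e. minimal such $G$ exists, is denoted $|\mathrm Df|$ or $|\mathrm D f|_Z$, and is called the minimal weak upper gradient. $W^{1,2}(Z):=S^2(Z)\cap L^2(Z,\mathfrak m)$. **Warped product.** For a curve $\gamma=(\gamma^I,\gamma^X):[0,1]\to I\times X$ with $\gamma^I,\gamma^X$ absolutely continuous, put $l_w[\gamma]:=\int_0^1\sqrt{|\dot\gamma^I_t|^2+w_d^2(\gamma^I_t)|\dot\gamma^X_t|^2}\,dt$. For $p,q\in I\times X$ let $d_w(p,q)$ be the infimum of $l_w[\gamma]$ over such curves with $\gamma_0=p$, $\gamma_1=q$. This is a pseudo-metric; identifying points at $d_w$-distance $0$ and completing gives the metric space $(X_w,d_w)$, $X_w:=I\times_wX$. With $\pi:I\times X\to X_w$ the natural map, $\mathfrak m_w:=\pi_*\big((w_{\mathfrak m}\mathcal L^1|_I)\times\mathfrak m\big)$. Functions on $X_w$ are written as functions of $(t,x)\in I\times X$ (via composition with $\pi$, whose image has $\mathfrak m_w$-negligible complement). Put $f^{(x)}(t):=f(t,x)$ and $f^{(t)}(x):=f(t,x)$. **Beppo Levi spaces.** $\mathsf{BL}(X_w)$ is the set of $f\in L^2(X_w,\mathfrak m_w)$ such that (i) for $\mathfrak m$-a.e. $x\in X$, $f^{(x)}\in W^{1,2}(I,w_{\mathfrak m}\mathcal L^1)$ (the Sobolev space of $I$ with Euclidean distance and measure $w_{\mathfrak m}\mathcal L^1|_I$); (ii) for $w_{\mathfrak m}\mathcal L^1$-a.e. $t\in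 I$, $f^{(t)}\in W^{1,2}(X)$; (iii) the function $|\mathrm Df|_w(t,x):=\sqrt{w_d^{-2}(t)|\mathrm Df^{(t)}|_X^2(x)+|\mathrm Df^{(x)}|_I^2(t)}$ belongs to $L^2(X_w,\mathfrak m_w)$, where $|\mathrm Df^{(x)}|_I$ is the minimal weak upper gradient in $(I,w_{\mathfrak m}\mathcal L^1)$. Its norm is $\|f\|_{\mathsf{BL}(X_w)}:=\sqrt{\|f\|_{L^2(X_w)}^2+\||\mathrm Df|_w\|_{L^2(X_w)}^2}$. Let $V\subset\mathsf{BL}(X_w)$ be the space of functions $f\in\mathsf{BL}(X_w)$ which are identically $0$ on $(\Omega\cap I)\times X$ for some open set $\Omega\subset\mathbb R$ containing $\{w_{\mathfrak m}=0\}$. $\mathsf{BL}_0(X_w)$ is the closure of $V$ in $\mathsf{BL}(X_w)$. *)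

(* Defs.v *)
From HB Require Import structures.
From mathcomp Require Import all_boot all_order all_algebra.
From mathcomp Require Import all_classical all_reals all_analysis.
From mathcomp Require Import measurable_realfun.

Set Implicit Arguments.
Unset Strict Implicit.
Unset Printing Implicit Defensive.
Import Order.TTheory GRing.Theory Num.Theory.
Import numFieldNormedType.Exports.
Local Open Scope classical_set_scope.
Local Open Scope ring_scope.

#[short(type="pmetricType")]
HB.structure Definition PointedMetric (R : numDomainType) :=
  {T of Pointed T & Metric R T}.

#[short(type="completeMetricType")]
HB.structure Definition CompleteMetric (R : numDomainType) :=
  {T of Complete T & Metric R T}.

Notation borel T := (g_sigma_algebraType (@open T)).

Definition separable (T : topologicalType) :=
  exists2 D : set T, countable D & dense D.

Definition full_support (R : realType) (T : ptopologicalType)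
    (m : set (borel T) -> \bar R) :=
  forall U : set T, open U -> U !=set0 -> (0 < m U)%E.

Record closed_itv (R : realType) := ClosedItv {
  citv_set : set R ;
  citv_interval : is_interval citv_set ;
  citv_closed : closed citv_set ;
  citv_nonempty : citv_set !=set0 }.

(* The interval as a space of its own, with the Euclidean distance. *)
Definition citv_type (R : realType) (I : closed_itv R) : Type :=
  set_type (citv_set I).
Coercion citv_type : closed_itv >-> Sortclass.

Section citv_type_instances.
Variables (R : realType) (I : closed_itv R).

HB.instance Definition _ := PseudoMetric.copy I (set_type (citv_set I)).
HB.instance Definition _ := SubType.copy I (set_type (citv_set I)).

Let citv_point : I :=
  SigSub (mem_set (projT2 (cid (citv_nonempty I)))).
HB.instance Definition _ := isPointed.Build I citv_point.

Let dist (s t : I) : R := `|val s - val t|.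

Let dist_ge0 s t : 0 <= dist s t. Proof. exact: normr_ge0. Qed.

Let dist_positivity s t : dist s t = 0 -> s = t.
Proof. by move/normr0_eq0/eqP; rewrite subr_eq0 => /eqP/val_inj. Qed.

Let ballEdist (s : I) d : ball s d = [set t | dist s t < d].
Proof. by []. Qed.

HB.instance Definition _ :=
  PseudoMetric_isMetric.Build R I dist_ge0 dist_positivity ballEdist.

End citv_type_instances.


Section citv_lebesgue.
Variables (R : realType) (I : closed_itv R).

Definition citv_lebesgue (B : set (borel I)) : \bar R :=
  lebesgue_measure [set val t | t in B].

Lemma measurable_citv_image (B : set (borel I)) :
  measurable B -> measurable [set val t | t in B].
Proof.
move=> mB.
have mI : measurable (citv_set I) by apply: closed_measurable; exact: citv_closed.
pose G : set (set I) := preimage_set_system setT val (@measurable _ R).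
have sG : sigma_algebra setT G.
  by apply: sigma_algebra_preimage; exact: sigma_algebra_measurable.
have : G B.
  apply: mB; split=> // U [V oV <-].
  by exists V; [exact: open_measurable|rewrite setTI].
case=> V mV <-; rewrite setTI.
rewrite (_ : [set _ | _ in _] = V `&` citv_set I); first exact: measurableI.
apply/seteqP; split=> [_ [t Vt <-]|x [Vx Ix]]; first by split=> //; exact: set_valP.
by exists (SigSub (mem_set Ix)).
Qed.

Let citv_lebesgue0 : citv_lebesgue set0 = 0%E.
Proof. by rewrite /citv_lebesgue image_set0 measure0. Qed.

Let citv_lebesgue_ge0 B : (0 <= citv_lebesgue B)%E.
Proof. exact: measure_ge0. Qed.

Let citv_lebesgue_sigma_additive : semi_sigma_additive citv_lebesgue.
Proof.
move=> F mF tF mUF; rewrite /citv_lebesgue image_bigcup.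
apply: measure_semi_sigma_additive => //.
- by move=> n; exact: measurable_citv_image.
- apply/trivIsetP => i j _ _ ij.
  move/trivIsetP : tF => /(_ i j Logic.I Logic.I ij) tij.
  rewrite -subset0 => _ [[s Fs <-] [t Ft /val_inj ts]].
  have : (F i `&` F j) s by split=> //; rewrite -ts.
  by rewrite tij.
- by rewrite -image_bigcup; exact: measurable_citv_image.
Qed.

HB.instance Definition _ := isMeasure.Build _ _ _ citv_lebesgue
  citv_lebesgue0 citv_lebesgue_ge0 citv_lebesgue_sigma_additive.

End citv_lebesgue.
Arguments citv_lebesgue {R} I.

Record weight (R : realType) (I : closed_itv R) := Weight {
  weight_fun :> I -> R ;
  weight_continuous : continuous weight_fun ;
  weight_ge0 : forall t, 0 <= weight_fun t }.

Section weighted_lebesgue.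
Variables (R : realType) (I : closed_itv R) (w : weight I).

Definition weighted_lebesgue (B : set (borel I)) : \bar R :=
  (\int[citv_lebesgue I]_(t in B) (w t)%:E)%E.

Lemma measurable_weight : measurable_fun [set: borel I] (w : borel I -> R).
Proof.
apply: (measurability _ (RGenOpens.measurableE R)) => //.
move=> _ [_ [a [b ->]] <-]; rewrite setTI; apply: sub_sigma_algebra.
by apply: open_comp; [move=> t _; exact: weight_continuous|exact: interval_open].
Qed.

Let weighted_lebesgue0 : weighted_lebesgue set0 = 0%E.
Proof. by rewrite /weighted_lebesgue integral_set0. Qed.

Let weighted_lebesgue_ge0 B : (0 <= weighted_lebesgue B)%E.
Proof. by apply: integral_ge0 => t _; rewrite lee_fin weight_ge0. Qed.

Let weighted_lebesgue_sigma_additive : semi_sigma_additive weighted_lebesgue.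
Proof.
apply: semi_sigma_additive_nng_induced.
  by apply/measurable_EFinP; exact: measurable_weight.
by move=> t; rewrite lee_fin weight_ge0.
Qed.

HB.instance Definition _ := isMeasure.Build _ _ _ weighted_lebesgue
  weighted_lebesgue0 weighted_lebesgue_ge0 weighted_lebesgue_sigma_additive.

End weighted_lebesgue.

Section unit_itv.
Variable R : realType.

Let itv01_closed : closed `[0 : R, 1]. Proof. exact: interval_closed. Qed.

Let itv01_interval : is_interval `[0 : R, 1].
Proof. exact: interval_is_interval. Qed.

Let itv01_0 : `[0 : R, 1]%classic 0.
Proof. by rewrite /= in_itv /= lexx ler01. Qed.

Let itv01_1 : `[0 : R, 1]%classic 1.
Proof. by rewrite /= in_itv /= lexx ler01. Qed.

Definition itv01 : closed_itv R :=
  ClosedItv itv01_interval itv01_closed (ex_intro _ 0 itv01_0).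

Definition start01 : itv01 := SigSub (mem_set itv01_0).
Definition end01 : itv01 := SigSub (mem_set itv01_1).

End unit_itv.
Arguments itv01 {R}.
Arguments start01 {R}.
Arguments end01 {R}.

Section curves.
Variables (R : realType) (Z : pmetricType R).
Implicit Types c : @itv01 R -> Z.

(* Absolutely continuous curves ([p = 1]) and the class AC^2 ([p = 2]). *)
Definition ac_curve (p : \bar R) c := exists g : borel itv01 -> R,
  [/\ forall r, 0 <= g r, g \in Lfun (citv_lebesgue itv01) p &
    forall s t : itv01, val s <= val t ->
      ((mdist (c s) (c t))%:E <=
       \int[citv_lebesgue itv01]_(r in [set r | (val s <= val r <= val t)%R])
          (g r)%:E)%E].

Definition mspeed c (t : itv01) : R :=
  lim (mdist (c s) (c t) / `|val s - val t| @[s --> t^']).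

Definition ac_length c : \bar R :=
  (\int[citv_lebesgue itv01]_t (mspeed c t)%:E)%E.

(* C([0,1], Z), to be given the topology of uniform convergence. *)
Definition curve : Type := continuousType (@itv01 R) Z.
Definition curve_fun (c : curve) : itv01 -> Z := c.

HB.instance Definition _ := Choice.copy curve (continuousType (@itv01 R) Z).
HB.instance Definition _ := Topological.copy curve
  (initial_topology (curve_fun : curve -> arrow_uniform_type itv01 Z)).

Let curve_point : curve := mkcts (@cst_continuous itv01 Z point).
HB.instance Definition _ := isPointed.Build curve curve_point.

Definition eval_at (t : itv01) (c : borel curve) : borel Z := curve_fun c t.

End curves.

Definition length_space (R : realType) (Z : pmetricType R) :=
  forall x y : Z, (mdist x y)%:E = ereal_inf [set ac_length c |
    c in [set c | [/\ ac_curve 1%:E c, c start01 = x & c end01 = y]]].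

Section sobolev.
Variables (R : realType) (Z : pmetricType R).
Variable m : {measure set (borel Z) -> \bar R}.
Implicit Types f G : borel Z -> R.
Local Open Scope ereal_scope.

Definition test_plan (P : probability (borel (curve Z)) R) :=
  [/\ exists2 C : R, (0 < C)%R & forall t A, measurable A ->
        pushforward P (eval_at t) A <= C%:E * m A,
    {ae P, forall c, ac_curve 2%:E (curve_fun c)} &
    \int[citv_lebesgue itv01]_t
      \int[P]_c (mspeed (curve_fun c) t ^+ 2)%:E < +oo].

Definition weak_upper_gradient f G :=
  [/\ forall z, (0 <= G z)%R, G \in Lfun m 2%:E &
    forall P, test_plan P ->
      \int[P]_c (`|f (eval_at end01 c) - f (eval_at start01 c)|)%:E <=
      \int[P]_c \int[citv_lebesgue itv01]_s
        (G (eval_at s c) * mspeed (curve_fun c) s)%:E].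

Definition minimal_weak_upper_gradient f G :=
  weak_upper_gradient f G /\
  forall G', weak_upper_gradient f G' -> {ae m, forall z, (G z <= G' z)%R}.

Definition sobolev_class : set (borel Z -> R) :=
  [set f | measurable_fun setT f /\ exists G, weak_upper_gradient f G].

Definition W12 : set (borel Z -> R) :=
  [set f | sobolev_class f /\ f \in Lfun m 2%:E].

End sobolev.

Section warped_product.
Variables (R : realType) (I : closed_itv R) (X : pmetricType R).
Implicit Types (w : weight I) (p q : borel I * borel X).

Definition warped_length w (cI : itv01 -> I) (cX : itv01 -> X) : \bar R :=
  (\int[citv_lebesgue itv01]_t
     (Num.sqrt (mspeed cI t ^+ 2 + w (cI t) ^+ 2 * mspeed cX t ^+ 2))%:E)%E.

Definition warped_dist w p q : \bar R :=
  ereal_inf [set warped_length w c.1 c.2 |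
    c in [set c : (itv01 -> I) * (itv01 -> X) |
      [/\ ac_curve 1%:E c.1, ac_curve 1%:E c.2,
        (c.1 start01, c.2 start01) = p & (c.1 end01, c.2 end01) = q]]].

(* The metric quotient of I x X for the pseudo-metric d_w, completed: a complete
   metric space with a distance-preserving map of dense range from
   (I x X, d_w), which determines it up to isometry over I x X. *)
Record warped_product (m : {measure set (borel X) -> \bar R}) (wd wm : weight I)
    := WarpedProduct {
  wp_space : completeMetricType R ;
  wp_map : borel I * borel X -> borel wp_space ;
  wp_map_dist : forall p q,
    (mdist (wp_map p : wp_space) (wp_map q))%:E = warped_dist wd p q ;
  wp_map_dense : dense (range wp_map : set wp_space) ;
  wp_measure : {measure set (borel wp_space) -> \bar R} ;
  wp_measureE : forall A, measurable A ->
    wp_measure A = pushforward (weighted_lebesgue wm \x m)%E wp_map A }.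

End warped_product.

Section beppo_levi.
Variables (R : realType) (I : closed_itv R) (X : pmetricType R).
Variables (m : {measure set (borel X) -> \bar R}) (wd wm : weight I).
Variable W : warped_product m wd wm.
Implicit Types f g H : borel (wp_space W) -> R.

Definition slice_I f (x : borel X) : borel I -> R := fun t => f (wp_map W (t, x)).
Definition slice_X f (t : borel I) : borel X -> R := fun x => f (wp_map W (t, x)).

(* [H] is a Borel representative of |Df|_w.  The functions |Df^(t)|_X and
   |Df^(x)|_I are only defined up to null sets of each slice; the condition that
   representatives be jointly measurable makes |Df|_w well defined up to
   m_w-null sets. *)
Definition warped_gradient f H := measurable_fun setT H /\
  exists GX GI : borel I * borel X -> R,
  [/\ measurable_fun setT GX /\ measurable_fun setT GI,
    {ae weighted_lebesgue wm, forall t,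
      minimal_weak_upper_gradient m (slice_X f t) (fun x => GX (t, x))},
    {ae m, forall x, minimal_weak_upper_gradient (weighted_lebesgue wm)
      (slice_I f x) (fun t => GI (t, x))} &
    {ae (weighted_lebesgue wm \x m)%E, forall p, H (wp_map W p) =
      Num.sqrt ((wd p.1) ^- 2 * GX p ^+ 2 + GI p ^+ 2)}].

Definition BL : set (borel (wp_space W) -> R) :=
  [set f | [/\ f \in Lfun (wp_measure W) 2%:E,
    {ae m, forall x, W12 (weighted_lebesgue wm) (slice_I f x)},
    {ae weighted_lebesgue wm, forall t, W12 m (slice_X f t)} &
    exists2 H, warped_gradient f H & H \in Lfun (wp_measure W) 2%:E]].

(* All representatives of |Df|_w give the same value; [+oo] if there is none. *)
Definition BL_norm f : \bar R :=
  ereal_inf [set (('N[wp_measure W]_(2%:E) [EFin \o f] ^+ 2 +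
                   'N[wp_measure W]_(2%:E) [EFin \o H] ^+ 2) `^ 2^-1)%E |
    H in warped_gradient f].

Definition BL_vanishing : set (borel (wp_space W) -> R) :=
  [set f | BL f /\ exists2 U : set R, open U &
    (forall t, wm t = 0 -> U (val t)) /\
    (forall (t : I) (x : X), U (val t) -> f (wp_map W (t, x)) = 0)].

Definition BL0 : set (borel (wp_space W) -> R) :=
  [set f | BL f /\ forall e : R, 0 < e ->
    exists2 g, BL_vanishing g & (BL_norm (f \- g)%R < e%:E)%E].

End beppo_levi.
Arguments BL_norm {R I X m wd wm} W f.
Arguments BL {R I X m wd wm} W _.
Arguments BL_vanishing {R I X m wd wm} W _.
Arguments BL0 {R I X m wd wm} W _.

(* Main.v *)
(* Given f in BL(X_w), put g_n = eta_n(t) phi_n(f) with phi_n(r) = n atan(r/n) and eta_n a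
   Lipschitz cutoff vanishing near {w_m = 0} and near infinity.  On the slices {t} x X the chain rule
   gives |D(f - g_n)| = (1 - eta_n phi_n'(f)) |Df|, and on the slices I x {x} it gives
   |D(f - g_n)| <= (1 - eta_n phi_n'(f)) |Df| + |phi_n(f)| |eta_n'|.  The first terms tend to 0 by
   dominated convergence; since |phi_n(f)| is bounded for fixed n, the last one is controlled by the
   energy of eta_n near the zeros, which can be made arbitrarily small because w_m(t) <= C |t - z|:
   a point has zero 2-capacity for the weight |t - z|.

   The norm of BL(X_w) asks for jointly measurable minimal weak upper gradients.  On X-slices the
   explicit formula is measurable; on I-slices the minimal gradient is limsup_k k |h(t + 1/k) - h(t)|,
   for every h that has some weak upper gradient.  This rests on the absolute continuity of h o gamma
   (up to a null set of times) along almost every curve of a test plan. *)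
From HB Require Import structures.
Require Import Defs.
From mathcomp Require Import all_boot all_order all_algebra.
From mathcomp Require Import all_classical all_reals all_analysis.
From mathcomp Require Import measurable_realfun ring lra.
Set Implicit Arguments.
Unset Strict Implicit.
Unset Printing Implicit Defensive.
Import Order.TTheory GRing.Theory Num.Theory.
Import numFieldNormedType.Exports.
Local Open Scope classical_set_scope.
Local Open Scope ring_scope.

(** * Almost everywhere statements *)

(** On X no differential structure is available, and minimality there rests on 0 < phi_n' <= 1: for
    psi(r) = eta phi_n(r) or r - eta phi_n(r), with eta in [0, 1], both psi and id - psi have
    derivative in [0, 1], and their gradients psi'(f) |Df| and (1 - psi'(f)) |Df| add up to |Df|,
    which leaves no room for a smaller one. The arctangent is differentiable everywhere, so that no
    exceptional level sets enter the chain rule. On I, the weight is bounded below near almost every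
    point with w_m > 0, so uniformly distributed translated segments form a test plan; they detect
    the derivative, and this makes the difference quotient a lower bound for every weak upper
    gradient. Functions live on X_w and not on I x X, so cutoffs and gradients have to descend to
    Borel functions on X_w. This works over {w_d > 0}, where d_w is locally comparable to the
    product distance; the rest is null. The energy allowed to eta_n near the zeros is fixed after
    the bound on phi_n. *)

Section almost_everywhere_lemmas.
Context d (T : measurableType d) (R : realType) (m : {measure set T -> \bar R}).
Implicit Types P Q : T -> Prop.

Lemma ae_mono P Q : (forall x, P x -> Q x) ->
  (\forall x \ae m, P x) -> \forall x \ae m, Q x.
Proof. by move=> PQ; apply: negligibleS => x /= nQ Px; exact/nQ/PQ. Qed.

Lemma ae_and P Q : (\forall x \ae m, P x) -> (\forall x \ae m, Q x) ->
  \forall x \ae m, P x /\ Q x.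
Proof.
move=> hP hQ; apply: negligibleS (negligibleU hP hQ) => x /= nPQ.
by have [Px|] := pselect (P x); [right => Qx; exact: nPQ|left].
Qed.

Lemma ae_and3 P1 P2 P3 : (\forall x \ae m, P1 x) -> (\forall x \ae m, P2 x) ->
  (\forall x \ae m, P3 x) -> \forall x \ae m, [/\ P1 x, P2 x & P3 x].
Proof.
move=> h1 h2 h3; apply: ae_mono (ae_and h1 (ae_and h2 h3)) => x.
by move=> [? []].
Qed.

Lemma ae_nat (P : nat -> T -> Prop) : (forall n, \forall x \ae m, P n x) ->
  \forall x \ae m, forall n, P n x.
Proof.
move=> hP; apply: negligibleS (negligible_bigcup hP) => x /= /existsNP[n nP].
by exists n.
Qed.

Lemma ae_count (I : countType) (P : I -> T -> Prop) :
  (forall i, \forall x \ae m, P i x) -> \forall x \ae m, forall i, P i x.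
Proof.
move=> hP.
have : \forall x \ae m, forall n, if unpickle n is Some i then P i x else True.
  by apply: ae_nat => n; case: unpickle => [i|]; [exact: hP|exact: aeW].
by apply: ae_mono => x h i; have := h (pickle i); rewrite pickleK.
Qed.

End almost_everywhere_lemmas.

(** * Absolutely continuous real functions *)

Section slope.
Context {R : realType}.
Implicit Types (a b f g : R -> R) (x y l k : R).

(** Differentiability without a quotient: [y = x] needs no exclusion, and the inequality passes
    directly through sums, products and compositions. *)
Definition has_slope a x l := forall e : R, 0 < e -> exists2 d : R, 0 < d &
  forall y, `|y - x| < d -> `|a y - a x - l * (y - x)| <= e * `|y - x|.

Lemma le_of_eq x y : x = y -> x <= y. Proof. by move=> ->. Qed.

Lemma derive1_slope f x l : derivable f x 1 /\ derive1 f x = l -> has_slope f x l.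
Proof.
move=> [df dfE] e e0.
have : h^-1 *: (f (h *: 1 + x) - f x) @[h --> 0^'] --> l.
  by rewrite -dfE derive1E; exact: df.
move=> /cvgrPdist_le/(_ e e0); rewrite /dnbhs/= /within/= /nbhs/= => -[d d0 hd].
exists d => // y yd; have [->|yx] := eqVneq y x.
  by rewrite !subrr mulr0 subrr normr0 mulr0.
have yx0 : y - x != 0 by rewrite subr_eq0.
have := hd (y - x); rewrite /= sub0r normrN => /(_ yd yx0).
rewrite [in X in X -> _]/GRing.scale/= mulr1 subrK => h.
have -> : f y - f x - l * (y - x) = - (l - (y - x)^-1 * (f y - f x)) * (y - x).
  by field.
by rewrite normrM normrN ler_wpM2r.
Qed.

Lemma has_slopeDr a x l c : has_slope a x l -> has_slope (fun t => a t + c) x l.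
Proof.
move=> ha e e0; have [d d0 hd] := ha e e0; exists d => // y yd.
have -> : a y + c - (a x + c) = a y - a x by ring.
exact: hd.
Qed.

Lemma has_slope_cst c x : has_slope (fun=> c) x 0.
Proof. by move=> e e0; exists 1 => // y _; rewrite subrr mul0r subrr normr0 mulr_ge0// ltW. Qed.

Lemma has_slope_id x : has_slope id x 1.
Proof. by move=> e e0; exists 1 => // y _; rewrite mul1r subrr normr0 mulr_ge0// ltW. Qed.

Lemma has_slopeD a b x l k : has_slope a x l -> has_slope b x k ->
  has_slope (fun t => a t + b t) x (l + k).
Proof.
move=> ha hb e e0; have e20 : 0 < e / 2 by rewrite divr_gt0.
have [d d0 hd] := ha _ e20; have [d' d'0 hd'] := hb _ e20.
exists (Num.min d d'); first by rewrite lt_min d0.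
move=> y; rewrite lt_min => /andP[/hd h1 /hd' h2].
have -> : a y + b y - (a x + b x) - (l + k) * (y - x) =
  (a y - a x - l * (y - x)) + (b y - b x - k * (y - x)) by ring.
apply: le_trans (ler_normD _ _) _; lra.
Qed.

Lemma has_slope_lip a x l : has_slope a x l -> exists2 d : R, 0 < d &
  forall y, `|y - x| < d -> `|a y - a x| <= (`|l| + 1) * `|y - x|.
Proof.
move=> ha; have [d d0 hd] := ha 1 ltr01; exists d => // y /hd h.
have -> : a y - a x = (a y - a x - l * (y - x)) + l * (y - x) by ring.
apply: le_trans (ler_normD _ _) _; rewrite normrM; lra.
Qed.

Lemma has_slopeM a b x l k : has_slope a x l -> has_slope b x k ->
  has_slope (fun t => a t * b t) x (l * b x + a x * k).
Proof.
move=> ha hb e e0.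
have [d1 d10 h1] := has_slope_lip ha; have [d2 d20 h2] := has_slope_lip hb.
pose M := (`|l| + 1) * (`|k| + 1).
have M0 : 0 < M by rewrite mulr_gt0// ltr_wpDl.
have ea : 0 < e / (3 * (`|b x| + 1)) by rewrite divr_gt0// mulr_gt0// ltr_wpDl.
have eb : 0 < e / (3 * (`|a x| + 1)) by rewrite divr_gt0// mulr_gt0// ltr_wpDl.
have em : 0 < e / (3 * M) by rewrite divr_gt0// mulr_gt0.
have [d3 d30 h3] := ha _ ea; have [d4 d40 h4] := hb _ eb.
(* Two radii for the local Lipschitz bounds, two for the slopes; the last one makes the product of
   the two increments, quadratic in [|y - x|], small. *)
exists (Num.min (Num.min (Num.min d1 d2) (Num.min d3 d4)) (e / (3 * M))).
  by rewrite !lt_min d10 d20 d30 d40.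
move=> y; rewrite !lt_min => /andP[/andP[/andP[/h1 {}h1 /h2 {}h2] /andP[/h3 {}h3 /h4 {}h4]] h5].
have -> : a y * b y - a x * b x - (l * b x + a x * k) * (y - x) =
  (a y - a x - l * (y - x)) * b x + (a x * (b y - b x - k * (y - x)) + (a y - a x) * (b y - b x)) by ring.
apply: le_trans (ler_normD _ _) _.
apply: le_trans (lerD (lexx _) (ler_normD _ _)) _; rewrite !normrM.
set r := `|y - x| in h1 h2 h3 h4 h5 *.
have r0 : 0 <= r by exact: normr_ge0.
have A : `|a y - a x - l * (y - x)| * `|b x| <= e / 3 * r.
  apply: (@le_trans _ _ (e / (3 * (`|b x| + 1)) * r * (`|b x| + 1))).
    by rewrite ler_pM// lerDl.
  have : `|b x| + 1 != 0 by rewrite gt_eqF// ltr_wpDl.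
  by move=> ?; apply: le_of_eq; field.
have B : `|a x| * `|b y - b x - k * (y - x)| <= e / 3 * r.
  apply: (@le_trans _ _ ((`|a x| + 1) * (e / (3 * (`|a x| + 1)) * r))).
    by rewrite ler_pM// lerDl.
  have : `|a x| + 1 != 0 by rewrite gt_eqF// ltr_wpDl.
  by move=> ?; apply: le_of_eq; field.
have C : `|a y - a x| * `|b y - b x| <= e / 3 * r.
  apply: (@le_trans _ _ (((`|l| + 1) * r) * ((`|k| + 1) * r))).
    by rewrite ler_pM.
  have -> : (`|l| + 1) * r * ((`|k| + 1) * r) = (M * r) * r by rewrite /M; ring.
  rewrite ler_wpM2r//.
  have : M * r <= M * (e / (3 * M)) by rewrite ler_wpM2l// ltW.
  have -> // : M * (e / (3 * M)) = e / 3 by field; rewrite gt_eqF.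
lra.
Qed.

Lemma has_slope_comp f g x l k : has_slope g x l -> has_slope f (g x) k ->
  has_slope (fun t => f (g t)) x (k * l).
Proof.
move=> hg hf e e0.
have [d1 d10 h1] := has_slope_lip hg.
have L0 : 0 < `|l| + 1 by rewrite ltr_wpDl.
have K0 : 0 < `|k| + 1 by rewrite ltr_wpDl.
have ef : 0 < e / (2 * (`|l| + 1)) by rewrite divr_gt0// mulr_gt0.
have eg : 0 < e / (2 * (`|k| + 1)) by rewrite divr_gt0// mulr_gt0.
have [d2 d20 h2] := hf _ ef; have [d3 d30 h3] := hg _ eg.
exists (Num.min (Num.min d1 d3) (d2 / (`|l| + 1))).
  by rewrite !lt_min d10 d30 divr_gt0.
move=> y; rewrite !lt_min => /andP[/andP[/h1 {}h1 /h3 {}h3]].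
rewrite ltr_pdivlMr// mulrC => h4.
have /h2 {}h2 : `|g y - g x| < d2 by exact: le_lt_trans h1 h4.
have -> : f (g y) - f (g x) - k * l * (y - x) =
  (f (g y) - f (g x) - k * (g y - g x)) + k * (g y - g x - l * (y - x)) by ring.
apply: le_trans (ler_normD _ _) _; rewrite normrM.
set r := `|y - x| in h1 h3 *.
have r0 : 0 <= r by exact: normr_ge0.
have A : e / (2 * (`|l| + 1)) * `|g y - g x| <= e / 2 * r.
  apply: (@le_trans _ _ (e / (2 * (`|l| + 1)) * ((`|l| + 1) * r))).
    by rewrite ler_wpM2l// ltW.
  by apply: le_of_eq; field; rewrite gt_eqF.
have B : `|k| * `|g y - g x - l * (y - x)| <= e / 2 * r.
  apply: (@le_trans _ _ ((`|k| + 1) * (e / (2 * (`|k| + 1)) * r))).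
    by rewrite ler_pM// lerDl.
  by apply: le_of_eq; field; rewrite gt_eqF.
lra.
Qed.

End slope.

Section absolutely_continuous_real.
Context {R : realType}.
Local Notation mu := (@lebesgue_measure R).
Implicit Types (a b u : R -> R).

Definition density u := (forall r, 0 <= u r) /\ mu.-integrable setT (EFin \o u).

(** Absolute continuity on the whole line with an explicit majorant. Curves on [0, 1] are later
    extended by their endpoints, with a majorant vanishing outside ]0, 1]. *)
Definition ac_with u a := forall s t, s <= t ->
  `|a t - a s| <= \int[mu]_(r in `]s, t]) u r.

Definition primitive u t : R := \int[mu]_(r in `]-oo, t]) u r.

Lemma lebesgue_measure_oc (s t : R) : s <= t -> mu `]s, t]%classic = (t - s)%:E.
Proof.
rewrite le_eqVlt => /predU1P[->|st]; rewrite lebesgue_measure_itv/= lte_fin.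
  by rewrite ltxx subrr.
by rewrite st -EFinD.
Qed.

Lemma primitiveB b s t : mu.-integrable setT (EFin \o b) -> s <= t ->
  primitive b t - primitive b s = \int[mu]_(r in `]s, t]) b r.
Proof.
move=> ib st; rewrite /primitive Rintegral_itvB//.
exact: integrableS ib.
Qed.

Lemma primitive_continuous b : mu.-integrable setT (EFin \o b) ->
  continuous (primitive b).
Proof.
move=> ib x; apply/cvgrPdist_lt => e e0.
have [d [d0 hd]] := integral_normr_continuous ib e0.
have key y z : y <= z -> `|y - z| < d -> `|primitive b y - primitive b z| < e.
  move=> yz yzd; rewrite distrC primitiveB//.
  apply: (le_lt_trans (le_normr_Rintegral _ _)) => //.
    exact: integrableS ib.
  apply: hd => //.
  rewrite [X in (X < _)%E](_ : _ = (z - y)%:E); last exact: lebesgue_measure_oc.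
  by rewrite lte_fin -(@ger0_norm _ (z - y)) ?subr_ge0// distrC.
near=> y.
have yd : `|x - y| < d by near: y; exists d.
have [xy|/ltW yx] := leP x y; first exact: key.
by rewrite distrC; apply: key => //; rewrite distrC.
Unshelve. all: by end_near. Qed.

(** Lebesgue differentiation, in the form of the fundamental theorem of calculus for integrals from
    -oo. *)
Lemma primitive_slope b : mu.-integrable setT (EFin \o b) ->
  \forall x \ae mu, has_slope (primitive b) x (b x).
Proof.
move=> ib.
have lb : locally_integrable [set: R] b.
  by apply: open_integrable_locally => //; exact: openT.
have ib' y : mu.-integrable `]-oo, y] (EFin \o b) by exact: integrableS ib.
have := FTC1Ny ib' lb; apply: ae_mono => x; exact: derive1_slope.
Qed.

Lemma ac_with_continuous u a : density u -> ac_with u a -> continuous a.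
Proof.
move=> [u0 iu] au x; apply/cvgrPdist_lt => e e0.
have /cvgrPdist_lt/(_ e e0) := @primitive_continuous _ iu x.
apply: filterS => y.
wlog xy : x y / x <= y.
  move=> h; have [|yx] := leP x y; first exact: h.
  by rewrite distrC [in X in _ -> X]distrC; apply: h; rewrite ltW.
rewrite distrC [in X in _ -> X]distrC primitiveB// => ?.
apply: le_lt_trans (au _ _ xy) _.
by apply: le_lt_trans (ler_norm _) _.
Qed.

End absolutely_continuous_real.

Section integral_measure.
Context d (T : measurableType d) (R : realType).
Variables (m : {measure set T -> \bar R}) (u : T -> R).
Hypotheses (u0 : forall r, 0 <= u r) (iu : m.-integrable setT (EFin \o u)).

Definition integral_measure (A : set T) : \bar R := (\int[m]_(x in A) (u x)%:E)%E.

Let im0 : integral_measure set0 = 0%E.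
Proof. by rewrite /integral_measure integral_set0. Qed.

Let im_ge0 A : (0 <= integral_measure A)%E.
Proof. by apply: integral_ge0 => x _; rewrite lee_fin u0. Qed.

Let im_additive : semi_sigma_additive integral_measure.
Proof.
apply: (@semi_sigma_additive_nng_induced _ _ _ m (EFin \o u)) => //=.
exact: measurable_int iu.
Qed.

HB.instance Definition _ := isMeasure.Build _ _ _ integral_measure
  im0 im_ge0 im_additive.

Let im_fin : fin_num_fun integral_measure.
Proof.
move=> A mA; rewrite /integral_measure.
apply: integrable_fin_num => //.
exact: (integrableS measurableT mA (@subsetT _ _) iu).
Qed.

HB.instance Definition _ := Measure_isFinite.Build _ _ _ integral_measure im_fin.

Definition integral_fmeasure : {finite_measure set T -> \bar R} := integral_measure.

End integral_measure.

(** * Absolutely continuous functions are primitives *)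

Section ac_density.
Context {R : realType}.
Local Notation mu := (@lebesgue_measure R).
Variables (u a : R -> R).
Hypotheses (du : density u) (au : ac_with u a).

(** Jordan decomposition of [a]: with U the primitive of [u], the bound on increments makes U + a
    and U - a nondecreasing, and their sum 2 U has Lebesgue-Stieltjes measure 2 u dx. *)
Let up t := primitive u t + a t.
Let down t := primitive u t - a t.

Let incr s t : s <= t -> up s <= up t /\ down s <= down t.
Proof.
move=> st; have := au st; rewrite -primitiveB//; last by case: du.
rewrite ler_norml => /andP[h1 h2]; rewrite /up /down; split; lra.
Qed.

Let up_cumulative : isCumulative R _ R up.
Proof.
split.
- by move=> s t st; have [] := incr st.
- apply: right_continuousW => x; apply: cvgD.
    by case: du => ? iu; exact: primitive_continuous.
  exact: ac_with_continuous au _.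
Qed.

Let down_cumulative : isCumulative R _ R down.
Proof.
split.
- by move=> s t st; have [] := incr st.
- apply: right_continuousW => x; apply: cvgB.
    by case: du => ? iu; exact: primitive_continuous.
  exact: ac_with_continuous au _.
Qed.

Let sum_cumulative : isCumulative R _ R (fun t => up t + down t).
Proof.
split.
- by move=> s t st; have [] := incr st; exact: lerD.
- apply: right_continuousW => x; apply: cvgD.
  + apply: cvgD; last exact: ac_with_continuous au _.
    by case: du => ? iu; exact: primitive_continuous.
  + apply: cvgB; last exact: ac_with_continuous au _.
    by case: du => ? iu; exact: primitive_continuous.
Qed.

Let cup : cumulative R R := HB.pack up up_cumulative.
Let cdown : cumulative R R := HB.pack down down_cumulative.
Let csum : cumulative R R := HB.pack (fun t => up t + down t) sum_cumulative.

Let iu2 : mu.-integrable setT (EFin \o (fun r => 2 * u r)).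
Proof.
have [_ iu] := du.
by apply: eq_integrable (integrableZl measurableT 2 iu) => //.
Qed.

Let u2_ge0 r : 0 <= 2 * u r. Proof. by rewrite mulr_ge0//; case: du. Qed.

Let nu2 : {finite_measure set (measurableTypeR R) -> \bar R} :=
  @integral_fmeasure _ (measurableTypeR R) R mu _ u2_ge0 iu2.

Let ls_itv (f : cumulative R R) s t : s <= t ->
  lebesgue_stieltjes_measure f `]s, t]%classic = (f t - f s)%:E.
Proof.
move=> st; rewrite -(wlength_itv_bnd f false false st).
rewrite /lebesgue_stieltjes_measure/= /measure_extension/=.
by rewrite measurable_mu_extE//; exact: is_ocitv.
Qed.

Let sum_nu2 (A : set (measurableTypeR R)) : measurable A ->
  lebesgue_stieltjes_measure csum A = nu2 A.
Proof.
apply: lebesgue_stieltjes_measure_unique => _ [[s t] _ <-] /=.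
have [st|ts] := leP s t; last first.
  by rewrite set_itv_ge ?measure0// bnd_simp -leNgt ltW.
rewrite ls_itv//= /nu2/= /integral_measure.
have [_ iu] := du.
have -> : up t + down t - (up s + down s) =
    2 * (primitive u t - primitive u s) by rewrite /up /down; ring.
rewrite primitiveB// -RintegralZl//; last exact: integrableS iu.
rewrite /Rintegral fineK//; apply: integrable_fin_num => //.
exact: integrableS iu2.
Qed.

Let sum_updown (A : set (measurableTypeR R)) : measurable A ->
  lebesgue_stieltjes_measure csum A =
  measure_add (lebesgue_stieltjes_measure cup) (lebesgue_stieltjes_measure cdown) A.
Proof.
apply: lebesgue_stieltjes_measure_unique => _ [[s t] _ <-] /=.
have [st|ts] := leP s t; last first.
  by rewrite set_itv_ge ?measure0// bnd_simp -leNgt ltW.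
rewrite ls_itv//; apply/esym.
apply: (etrans (measure_addE (lebesgue_stieltjes_measure cup)
  (lebesgue_stieltjes_measure cdown) `]s, t]%classic)).
apply: etrans (congr2 adde (ls_itv cup st) (ls_itv cdown st)) _.
congr EFin => /=; ring.
Qed.

(** The measure of U + a is one of two summands of 2 u dx. This gives its finiteness and absolute
    continuity, as Radon-Nikodym requires. *)
Let nu1_le (A : set (measurableTypeR R)) : measurable A ->
  (lebesgue_stieltjes_measure cup A <= nu2 A)%E.
Proof.
by move=> mA; rewrite -sum_nu2// sum_updown// measure_addE leeDl.
Qed.

Let nu1_fin : fin_num_fun (lebesgue_stieltjes_measure cup).
Proof.
move=> A mA; rewrite ge0_fin_numE//.
by apply: le_lt_trans (nu1_le mA) _; rewrite ltey_eq fin_num_measure.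
Qed.

Let nu1 : {finite_measure set (measurableTypeR R) -> \bar R} :=
  HB.pack (lebesgue_stieltjes_measure cup)
    (Measure_isFinite.Build _ _ _ (lebesgue_stieltjes_measure cup) nu1_fin).

Let nu1_dom : nu1 `<< (mu : set (measurableTypeR R) -> \bar R).
Proof.
apply/null_content_dominatesP => A mA A0; apply/eqP; rewrite -measure_le0.
apply: (le_trans (nu1_le mA)).
rewrite /nu2/= /integral_measure null_set_integral//.
  by have /integrableP[h _] := iu2; exact: measurable_funTS h.
Qed.

Lemma ac_with_density : exists b,
  mu.-integrable setT (EFin \o b) /\
  forall s t, s <= t -> a t - a s = \int[mu]_(r in `]s, t]) b r.
Proof.
have [_ iu] := du.
have [f [f0 ff fi fE]] := radon_nikodym_sigma_finite nu1_dom.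
have fK : EFin \o (fine \o f) = f by apply/funext => x /=; rewrite fineK.
(* [f] is the density of U + a, so removing [u] leaves the density of [a]. *)
exists (fun r => fine (f r) - u r).
have ib : mu.-integrable setT (EFin \o (fun r => fine (f r) - u r)).
  rewrite [X in _.-integrable _ X](_ : _ = f \- (EFin \o u))%E.
    exact: integrableB.
  by apply/funext => x /=; rewrite EFinB fineK.
split=> // s t st.
rewrite RintegralB//; last 2 first.
- by rewrite fK; exact: integrableS fi.
- exact: integrableS iu.
rewrite -(primitiveB iu)//.
have := fE `]s, t]%classic (measurable_itv _).
rewrite /= ls_itv// => h.
by rewrite /Rintegral [X in fine X](_ : _ = (up t - up s)%:E)/= /up; [lra|rewrite h -fK].
Qed.

End ac_density.

Section ac_derivative.
Context {R : realType}.
Local Notation mu := (@lebesgue_measure R).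
Implicit Types (a b u v : R -> R).

(** One increment to the right is enough: |a(x + h) - a(x)| is at most the increment of the
    primitive of [u], and both are divided by a small h > 0. *)
Lemma slope_le a u (x l : R) : density u -> ac_with u a ->
  has_slope (primitive u) x (u x) -> has_slope a x l -> `|l| <= u x.
Proof.
move=> [u0 iu] au hu ha; apply/ler_addgt0Pr => e e0.
have e20 : 0 < e / 2 by rewrite divr_gt0.
have [d d0 hd] := hu _ e20; have [d' d'0 hd'] := ha _ e20.
pose h := Num.min d d' / 2.
have h0 : 0 < h by rewrite divr_gt0// lt_min d0.
have xh : x + h - x = h by ring.
have hm : h < Num.min d d' by rewrite /h ltr_pdivrMr// ltr_pMr ?ltr1n// lt_min d0.
move: hm; rewrite lt_min => /andP[hmd hmd'].
have := hd (x + h); have := hd' (x + h); rewrite !xh !(gtr0_norm h0) => /(_ hmd') A /(_ hmd) B.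
have xxh : x <= x + h by lra.
have := au _ _ xxh; rewrite -primitiveB// => C.
have D : `|l| * h <= u x * h + e * h.
  rewrite -[X in _ * X <= _](gtr0_norm h0) -normrM.
  have -> : l * h = (a (x + h) - a x) - (a (x + h) - a x - l * h) by ring.
  apply: (le_trans (ler_normB _ _)).
  move: B; rewrite ler_norml => /andP[B1 B2].
  lra.
by rewrite -(ler_pM2r h0) mulrDl.
Qed.

Lemma ac_with_derivative u a : density u -> ac_with u a -> exists b,
  [/\ mu.-integrable setT (EFin \o b),
    forall s t, s <= t -> a t - a s = \int[mu]_(r in `]s, t]) b r,
    \forall x \ae mu, has_slope a x (b x) &
    \forall x \ae mu, `|b x| <= u x].
Proof.
move=> du au; have [b [ib ab]] := ac_with_density du au.
have [u0 iu] := du.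
exists b.
have db : \forall x \ae mu, has_slope a x (b x).
  apply: ae_mono (primitive_slope ib) => x hx.
  have -> : a = (fun t => primitive b t + (a 0 - primitive b 0)).
    apply/funext => t; have [t0|/ltW t0] := leP t 0.
      by have := ab _ _ t0; rewrite -primitiveB// => ?; lra.
    by have := ab _ _ t0; rewrite -primitiveB// => ?; lra.
  exact: has_slopeDr.
split => //.
apply: ae_mono (ae_and db (primitive_slope iu)) => x [ha hu].
exact: slope_le hu ha.
Qed.

(** Turns a pointwise bound on slopes into a bound on an increment; the gradients of cutoff
    functions and of functions on the interval are verified along curves through it. The integral of
    [v] may be infinite, hence the extended real conclusion. *)
Lemma ac_with_le u a v (s t : R) : density u -> ac_with u a -> s <= t ->
  (forall r, 0 <= v r) -> measurable_fun `]s, t] v ->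
  (\forall x \ae mu, s < x <= t -> forall l, has_slope a x l -> `|l| <= v x) ->
  (`|a t - a s|%:E <= \int[mu]_(r in `]s, t]) (v r)%:E)%E.
Proof.
move=> du au st v0 mv h; have [b [ib ab bd _]] := ac_with_derivative du au.
have ibst : mu.-integrable `]s, t] (EFin \o b) by exact: integrableS ib.
rewrite ab//.
apply: (@le_trans _ _ (\int[mu]_(r in `]s, t]) `|b r|)%:E).
  by rewrite lee_fin le_normr_Rintegral.
rewrite /Rintegral fineK; last first.
  by apply: integrable_fin_num => //; exact: integrable_norm.
apply: ae_ge0_le_integral => //=.
- by case/integrableP : (integrable_norm ibst).
- by move=> x _; rewrite lee_fin.
- exact/measurable_EFinP.
apply: ae_mono (ae_and h bd) => x [hx dx] /=; rewrite in_itv/= lee_fin => xst.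
exact: hx dx.
Qed.

End ac_derivative.

(** * Measures and measurability *)

Section integral_lemmas.
Context d (T : measurableType d) (R : realType).
Import HBNNSimple.

(** The integral is a supremum over the simple functions below [f], and this family is the same for
    both measures. *)
Lemma ge0_le_measure_integral (m1 m2 : {measure set T -> \bar R}) (D : set T)
    (f : T -> \bar R) :
  (forall A, measurable A -> (m1 A <= m2 A)%E) ->
  (forall x, D x -> (0 <= f x)%E) ->
  (\int[m1]_(x in D) f x <= \int[m2]_(x in D) f x)%E.
Proof.
move=> m12 f0; rewrite !ge0_integralE//; apply: ge_ereal_sup => _ /= [h hf <-].
apply: (@le_trans _ _ (sintegral m2 h)).
  rewrite !sintegralE; apply: lee_fsum => [|r [x _ <-]]; first exact: fimfunP.
  by apply: lee_wpmul2l; [rewrite lee_fin|exact: m12].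
by apply: ereal_sup_ubound; exists h.
Qed.

End integral_lemmas.

Section integral_lemmas2.
Context d (T : measurableType d) (R : realType).

Lemma ge0_integral_mrestr (m : {measure set T -> \bar R}) (D E : set T)
    (mD : measurable D) (f : T -> \bar R) :
  measurable E -> measurable_fun E f -> (forall x, E x -> (0 <= f x)%E) ->
  (\int[mrestr m mD]_(x in E) f x = \int[m]_(x in E `&` D) f x)%E.
Proof.
move=> mE mf f0.
have mED : measurable (E `\` D) by exact: measurableD.
have mEI : measurable (E `&` D) by exact: measurableI.
have ED0 : (mrestr m mD).-null_set (E `\` D).
  apply: (measure0_null_setP (mrestr m mD) mED).2.
  rewrite /= /mrestr (_ : _ `&` _ = set0) ?measure0//.
  by apply/seteqP; split => // x [[]].
rewrite -{1}(setUIDK E D) ge0_integral_setU ?setUIDK//; last first.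
  by rewrite disj_set2E; apply/eqP/seteqP; split => // x [[? ?] []].
have -> : (\int[mrestr m mD]_(x in E `\` D) f x = 0)%E.
  apply: (null_set_integral mED) => //.
  by apply: measurable_funS mf => // x [].
  exact: ED0.
rewrite adde0; apply: eq_measure_integral => A mA AED.
by rewrite /= /mrestr setIidl// => x /AED[].
Qed.

Lemma ge0_integral_push d' (U : measurableType d') (m : {measure set T -> \bar R})
    (m' : {measure set U -> \bar R}) (phi : T -> U) (f : U -> \bar R) :
  measurable_fun setT phi ->
  (forall A, measurable A -> m' A = pushforward m phi A) ->
  measurable_fun setT f -> (forall x, (0 <= f x)%E) ->
  (\int[m']_x f x = \int[m]_x f (phi x))%E.
Proof.
move=> mphi mE mf f0.
transitivity (\int[pushforward m phi]_x f x)%E.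
  by apply: eq_measure_integral => A mA _; exact: mE.
by rewrite ge0_integral_pushforward//.
Qed.

Lemma ge0_integral_push_le d' (U : measurableType d') (m : {measure set T -> \bar R})
    (m' : {measure set U -> \bar R}) (phi : T -> U) (f : U -> \bar R) (C : R) :
  measurable_fun setT phi -> 0 <= C ->
  (forall A, measurable A -> (pushforward m phi A <= C%:E * m' A)%E) ->
  measurable_fun setT f -> (forall x, (0 <= f x)%E) ->
  (\int[m]_x f (phi x) <= C%:E * \int[m']_x f x)%E.
Proof.
move=> mphi C0 mE mf f0.
have -> : (\int[m]_x f (phi x) = \int[measure_function_pushforward__canonical__measure_function_Measure m mphi]_x f x)%E.
  by rewrite (ge0_integral_pushforward mphi m measurableT mf).
rewrite -(@ge0_integral_mscale _ _ _ m' setT measurableT (NngNum C0))//.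
exact: (@ge0_le_measure_integral _ U R (measure_function_pushforward__canonical__measure_function_Measure m mphi)).
Qed.

End integral_lemmas2.

(** * Measurability of maps into Borel spaces *)

Section measurability_lemmas.

Lemma inv_nat_lt (R : archiRealFieldType) (e : R) : 0 < e -> exists k : nat, k.+1%:R^-1 < e.
Proof.
move=> e0; exists (Num.bound e^-1).
rewrite -[ltRHS]invrK ltf_pV2 ?posrE ?invr_gt0//.
apply: lt_trans (archi_boundP _) _; first by rewrite invr_ge0 ltW.
by rewrite ltr_nat.
Qed.

Lemma measurable_fun_borel d (T : measurableType d) (U : ptopologicalType)
    (f : T -> borel U) : (forall V : set U, open V -> measurable (f @^-1` V)) ->
  measurable_fun setT f.
Proof.
move=> mf; apply: (@measurability _ _ _ (borel U) setT f (@open U) erefl).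
by move=> _ [V oV <-]; rewrite setTI; exact: mf.
Qed.

Lemma continuous_borel (T U : ptopologicalType) (f : T -> U) :
  continuous f -> measurable_fun setT (f : borel T -> borel U).
Proof.
move=> cf; apply: measurable_fun_borel => V oV.
by apply: sub_sigma_algebra; apply: open_comp => // t _; exact: cf.
Qed.

Lemma continuous_borelR (R : realType) (T : ptopologicalType) (f : T -> R) :
  continuous f -> measurable_fun setT (f : borel T -> R).
Proof.
move=> cf; apply: (measurability _ (RGenOpens.measurableE R)) => //.
move=> _ [_ [a [b ->]] <-]; rewrite setTI; apply: sub_sigma_algebra.
by apply: open_comp; [move=> t _; exact: cf|exact: interval_open].
Qed.

Lemma continuousR_eps (R : realType) (T : ptopologicalType) (f : T -> R) :
  (forall x (e : R), 0 < e -> \forall y \near x, `|f x - f y| < e) -> continuous f.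
Proof. by move=> h x; apply/cvgrPdist_lt => e e0; exact: h. Qed.

Lemma measurable_fun_invr d (T : measurableType d) (R : realType) (f : T -> R) :
  (forall x, 0 <= f x) -> measurable_fun setT f -> measurable_fun setT (fun x => (f x)^-1).
Proof.
move=> f0 mf; rewrite (_ : (fun x => _) = (fun x => f x `^ (-1))).
  exact: measurableT_comp (measurable_powR _) mf.
by apply/funext => x; rewrite powR_inv1.
Qed.

(** Applied with [k] the index of the grid point to which a time is rounded, which reduces a
    time-dependent map to countably many fixed times. *)
Lemma measurable_fun_choice d d' (T : measurableType d) (U : measurableType d')
    (k : T -> nat) (g : nat -> T -> U) :
  (forall n, measurable (k @^-1` [set n])) ->
  (forall n, measurable_fun setT (g n)) ->
  measurable_fun setT (fun x => g (k x) x).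
Proof.
move=> mk mg _ B mB; rewrite setTI.
rewrite (_ : _ @^-1` B = \bigcup_n (k @^-1` [set n] `&` g n @^-1` B)).
  apply: bigcupT_measurable => n; apply: measurableI => //.
  by rewrite -[X in measurable X]setTI; exact: mg.
apply/seteqP; split=> [x Bx|x [n _ [<-]]//].
by exists (k x).
Qed.

(** An open U is exhausted by the open sets [V k] of points having a ball of radius larger than 1/(k
    + 1) inside U; the limit lies in U exactly when, for some k, all late terms lie in [V k]. *)
Lemma measurable_fun_cvg_metric d (T : measurableType d) (R : realType)
    (Z : pmetricType R) (f_ : nat -> T -> borel Z) (f : T -> borel Z) :
  (forall n, measurable_fun setT (f_ n)) ->
  (forall x (e : R), 0 < e -> exists N, forall n, (N <= n)%N ->
     mdist (f_ n x : Z) (f x) < e) ->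
  measurable_fun setT f.
Proof.
move=> mf_ ff; apply: measurable_fun_borel => U oU.
pose V k : set Z := [set z | exists2 r : R, k.+1%:R^-1 < r & ball z r `<=` U].
have oV k : open (V k).
  rewrite openE => z [r kr rU]; apply/nbhs_ballP.
  exists ((r - k.+1%:R^-1) / 2); first by rewrite /= divr_gt0// subr_gt0.
  move=> y zy; exists (r - (r - k.+1%:R^-1) / 2); first by move: kr; set q := _^-1 => ?; lra.
  move=> w yw; apply: rU; have := ball_triangle zy yw.
  by congr (ball _ _ _); ring.
rewrite (_ : f @^-1` U = \bigcup_k \bigcup_N \bigcap_(n in [set n | (N <= n)%N])
    (f_ n @^-1` V k)); last first.
  apply/seteqP; split=> [x Ux|x [k _] [N _] h].
  - have /nbhs_ballP[r /= r0 rU] : nbhs (f x : Z) U.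
      by move: oU; rewrite openE; exact.
    have [k kr] : exists k : nat, k.+1%:R^-1 < r / 2.
      by apply: inv_nat_lt; rewrite divr_gt0.
    have [N hN] := ff x _ (divr_gt0 r0 (ltr0n _ 2)).
    exists k => //; exists N => // n /hN nr; exists (r / 2) => // w.
    move: nr; rewrite !ballEmdist/= => nr w2; apply: rU.
    rewrite ballEmdist/=; apply: le_lt_trans (metric_triangle _ (f_ n x : Z) _) _.
    rewrite (metric_sym (f x : Z)); lra.
  - have k0 : 0 < k.+1%:R^-1 :> R by rewrite invr_gt0.
    have [N' hN'] := ff x _ k0.
    have [r kr] := h (maxn N N') (leq_maxl _ _); apply.
    by rewrite ballEmdist/=; apply: lt_trans kr; apply: hN'; exact: leq_maxr.
apply: bigcupT_measurable => k; apply: bigcupT_measurable => N.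
apply: bigcap_measurable => [|n _]; first by exists N => /=.
rewrite -[X in measurable X]setTI; apply: mf_ => //.
exact: sub_sigma_algebra.
Qed.

End measurability_lemmas.

(** * The interval as a subset of the line *)

Section real_interval_type.
Context {R : realType} (I : closed_itv R).
Local Notation mu := (@lebesgue_measure R).

(** A total left inverse of [val], with value [point] outside [I]; integrals over [I] become
    Lebesgue integrals on the line. *)
Definition to_itv (x : R) : I := insubd (point : I) x.

Lemma to_itvK (x : R) : citv_set I x -> val (to_itv x) = x.
Proof. by move=> Ix; rewrite /to_itv val_insubd mem_set. Qed.

Lemma val_to_itv (t : I) : to_itv (val t) = t.
Proof. by apply: val_inj; rewrite to_itvK//; exact: set_valP. Qed.

Lemma measurable_citv_set : measurable (citv_set I).
Proof. by apply: closed_measurable; exact: citv_closed. Qed.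

Lemma measurable_val_itv : measurable_fun setT (val : borel I -> R).
Proof.
apply: continuous_borelR => t A /nbhs_ballP[e /= e0 eA].
by apply/nbhs_ballP; exists e => // s ts; exact: eA.
Qed.

Lemma measurable_to_itv : measurable_fun setT (to_itv : R -> borel I).
Proof.
apply: measurable_fun_borel => V oV.
have mV : measurable [set val t | t in (V : set (borel I))].
  by apply: measurable_citv_image; exact: sub_sigma_algebra.
(* All points outside [I] are sent to [point], so the preimage contains the complement of [I]
   exactly when [V] contains [point]. *)
have [Vp|Vp] := pselect (V point).
- rewrite (_ : _ @^-1` _ = [set val t | t in V] `|` ~` citv_set I).
    by apply: measurableU => //; apply: measurableC; exact: measurable_citv_set.
  apply/seteqP; split=> [x /= Vx|x [[t Vt <-]|nIx] /=].
  + have [Ix|] := pselect (citv_set I x); last by right.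
    by left; exists (to_itv x) => //; rewrite to_itvK.
  + by rewrite val_to_itv.
  + by rewrite /to_itv /insubd insubF//; apply/negbTE/negP; rewrite inE.
- rewrite (_ : _ @^-1` _ = [set val t | t in V])//.
  apply/seteqP; split=> [x /= Vx|x [t Vt <-] /=]; last by rewrite val_to_itv.
  have [Ix|nIx] := pselect (citv_set I x).
    by exists (to_itv x) => //; rewrite to_itvK.
  exfalso; apply: Vp; move: Vx.
  by rewrite /to_itv /insubd insubF//; apply/negbTE/negP; rewrite inE.
Qed.

Lemma measurable_comp_to_itv d (U : measurableType d) (f : borel I -> U) :
  measurable_fun setT f -> measurable_fun setT (fun x : R => f (to_itv x)).
Proof.
move=> mf; apply: (@measurableT_comp _ _ _ _ _ _ f _ (to_itv : R -> borel I)) => //.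
exact: measurable_to_itv.
Qed.

Lemma citv_lebesgueE (B : set (borel I)) : measurable B ->
  citv_lebesgue I B =
  pushforward (mrestr mu measurable_citv_set) (to_itv : R -> borel I) B.
Proof.
move=> mB; rewrite /pushforward /mrestr /citv_lebesgue; congr (mu _).
apply/seteqP; split=> [_ [t Bt <-]|x [/= Bx Ix]].
  by split; [rewrite /= val_to_itv|exact: set_valP].
by exists (to_itv x) => //; rewrite to_itvK.
Qed.

Lemma image_val_itv (B : set I) :
  [set val t | t in B] = to_itv @^-1` B `&` citv_set I.
Proof.
apply/seteqP; split=> [_ [t Bt <-]|x [/= Bx Ix]].
  by split; [rewrite /= val_to_itv|exact: set_valP].
by exists (to_itv x) => //; rewrite to_itvK.
Qed.

Lemma integral_citv (B : set (borel I)) (f : borel I -> \bar R) :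
  measurable B -> measurable_fun setT f -> (forall t, (0 <= f t)%E) ->
  (\int[citv_lebesgue I]_(t in B) f t =
   \int[mu]_(x in [set val t | t in B]) f (to_itv x))%E.
Proof.
move=> mB mf f0.
have mB' : measurable (to_itv @^-1` B).
  by rewrite -[X in measurable X]setTI; exact: measurable_to_itv.
have mft : measurable_fun setT (f \o (to_itv : R -> borel I)).
  by apply: measurableT_comp => //; exact: measurable_to_itv.
rewrite image_val_itv -(@ge0_integral_mrestr _ _ _ mu _ _ measurable_citv_set)//; last first.
  exact: measurable_funTS.
rewrite [LHS]integral_mkcond [RHS]integral_mkcond.
rewrite (@ge0_integral_push _ _ _ _ _ (mrestr mu measurable_citv_set) _
  (to_itv : R -> borel I)).
- by apply: eq_integral => x _; rewrite !patchE.
- exact: measurable_to_itv.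
- by move=> A mA; exact: citv_lebesgueE.
- by apply/(measurable_restrictT _ mB); exact: measurable_funTS.
- by move=> x; rewrite patchE; case: ifP.
Qed.

Lemma ae_citv (P : I -> Prop) :
  (\forall t \ae citv_lebesgue I, P t) <->
  (\forall x \ae mu, citv_set I x -> P (to_itv x)).
Proof.
split.
- move=> [A [mA A0 PA]].
  exists [set val t | t in A]; split => //; first exact: measurable_citv_image.
  by move=> x /= /not_implyP[Ix nP]; exists (to_itv x); [exact: PA|rewrite to_itvK].
- move=> [A [mA A0 PA]].
  exists (val @^-1` A); split.
  + by rewrite -[X in measurable X]setTI; exact: measurable_val_itv.
  + apply/eqP; rewrite -measure_le0 -A0; apply: le_measure; rewrite ?inE//.
    * apply: measurable_citv_image.
      by rewrite -[X in measurable X]setTI; exact: measurable_val_itv.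
    * by move=> _ [t At <-].
  + move=> t /= nPt; apply: PA => /= /(_ (set_valP t)).
    by rewrite val_to_itv.
Qed.

End real_interval_type.

Section unit_interval.
Context {R : realType}.
Local Notation mu := (@lebesgue_measure R).

(** Unlike [to_itv itv01], this map is 1-Lipschitz on the line, so composing with it extends a curve
    continuously by its endpoints. *)
Definition clamp01 (x : R) : itv01 := to_itv itv01 (Num.max 0 (Num.min 1 x)).

Lemma val_clamp01 x : val (clamp01 x) = Num.max 0 (Num.min 1 x).
Proof.
rewrite to_itvK//= in_itv/= le_max lexx/= ge_max ler01/= ge_min lexx//.
Qed.

Lemma clamp01K x : 0 <= x <= 1 -> val (clamp01 x) = x.
Proof.
move=> /andP[x0 x1]; rewrite val_clamp01 min_r// max_r//.
Qed.

Lemma itv01P (t : @itv01 R) : 0 <= val t <= 1.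
Proof. by have := set_valP t; rewrite /= in_itv. Qed.

Lemma val_clamp01K (t : itv01) : clamp01 (val t) = t.
Proof. by apply: val_inj; rewrite clamp01K// itv01P. Qed.

Lemma clamp01_to_itv x : 0 <= x <= 1 -> clamp01 x = to_itv itv01 x.
Proof. by move=> x01; apply: val_inj; rewrite clamp01K// to_itvK//= in_itv. Qed.

Lemma clamp01_le x y : x <= y -> val (clamp01 x) <= val (clamp01 y).
Proof. move=> xy; rewrite !val_clamp01 /Num.max /Num.min; repeat case: ifPn; rewrite -?leNgt; lra. Qed.

Lemma clamp01_lip x y : `|val (clamp01 x) - val (clamp01 y)| <= `|x - y|.
Proof.
wlog xy : x y / x <= y.
  move=> h; have [|yx] := leP x y; first exact: h.
  by rewrite distrC [leRHS]distrC; apply: h; exact: ltW.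
rewrite distrC [leRHS]distrC !ger0_norm ?subr_ge0//; last exact: clamp01_le.
rewrite !val_clamp01 /Num.max /Num.min; repeat case: ifPn; rewrite -?leNgt; lra.
Qed.

Lemma clamp01_0 : clamp01 0 = start01.
Proof. by apply: val_inj; rewrite clamp01K// lexx ler01. Qed.

Lemma clamp01_1 : clamp01 1 = end01.
Proof. by apply: val_inj; rewrite clamp01K// lexx ler01. Qed.

Lemma measurable_clamp01 : measurable_fun setT (clamp01 : R -> borel itv01).
Proof.
apply: (@measurableT_comp _ _ _ _ _ _ (to_itv itv01 : R -> borel itv01)).
  exact: measurable_to_itv.
by apply: measurable_maxr => //; apply: measurable_minr.
Qed.

Lemma ball_itv01 (I : closed_itv R) (t s : I) (e : R) : ball t e s = (`|val t - val s| < e) :> Prop.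
Proof. by []. Qed.

Lemma integral_itv01 (f : borel (@itv01 R) -> \bar R) (s t : itv01) :
  val s <= val t -> measurable_fun setT f -> (forall r, (0 <= f r)%E) ->
  (\int[citv_lebesgue itv01]_(r in [set r | (val s <= val r <= val t)%R]) f r =
   \int[mu]_(x in `]val s, val t]) f (clamp01 x))%E.
Proof.
move=> st mf f0.
have mst : measurable ([set r | (val s <= val r <= val t)%R] : set (borel itv01)).
  rewrite (_ : mkset _ = (val : borel itv01 -> R) @^-1` `[val s, val t]).
    by rewrite -[X in measurable X]setTI; exact: measurable_val_itv.
  by apply/seteqP; split => r /=; rewrite in_itv.
rewrite integral_citv//.
have [/andP[s0 s1] /andP[t0 t1]] := (itv01P s, itv01P t).
rewrite (_ : [set val r | r in _] = `[val s, val t]%classic); last first.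
  move: s0 s1 t0 t1; set a := val s; set b := val t => s0 s1 t0 t1.
  apply/seteqP; split => [_ [r rst <-]|x] /=; rewrite in_itv//= => xst.
  have x01 : 0 <= x <= 1 by lra.
  by exists (clamp01 x); rewrite /= clamp01K.
rewrite -integral_itv_obnd_cbnd; last first.
  by apply: measurable_funTS; exact: measurable_comp_to_itv.
move: s0 s1 t0 t1; set a := val s; set b := val t => s0 s1 t0 t1.
apply: eq_integral => x; rewrite inE/= in_itv/= => xst.
by rewrite clamp01_to_itv//; lra.
Qed.

Lemma integral_itv01T (f : borel (@itv01 R) -> \bar R) :
  measurable_fun setT f -> (forall r, (0 <= f r)%E) ->
  (\int[citv_lebesgue itv01]_r f r = \int[mu]_(x in `]0%R, 1%R]) f (clamp01 x))%E.
Proof.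
move=> mf f0; rewrite -(@integral_itv01 _ start01 end01)//=.
by congr (integral _ _ _); apply/seteqP; split => // r _ /=; exact: itv01P.
Qed.

Lemma ae_itv01 (P : itv01 -> Prop) : (\forall t \ae citv_lebesgue itv01, P t) <->
  (\forall x \ae mu, 0 <= x <= 1 -> P (clamp01 x)).
Proof.
rewrite ae_citv; split; apply: ae_mono => x h; rewrite /= ?in_itv/=.
  by move=> x01; rewrite clamp01_to_itv//; apply: h; rewrite /= in_itv.
by move=> x01; rewrite -clamp01_to_itv//; exact: h.
Qed.

Lemma citv_lebesgue01 : citv_lebesgue (@itv01 R) setT = 1%E.
Proof.
rewrite /citv_lebesgue (_ : [set _ | _ in _] = `[0, 1]%classic).
  by rewrite lebesgue_measure_itv/= lte_fin ltr01 oppr0 adde0.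
apply/seteqP; split => [_ [t _ <-]|x x01]; first exact: set_valP.
by exists (clamp01 x) => //; rewrite clamp01K//; move: x01; rewrite /= in_itv.
Qed.

Let citv_fin : fin_num_fun (citv_lebesgue (@itv01 R)).
Proof.
move=> A mA; rewrite ge0_fin_numE//.
apply: le_lt_trans (ltry 1); rewrite -citv_lebesgue01; apply: le_measure; rewrite ?inE//.
Qed.

HB.instance Definition _ := Measure_isFinite.Build _ _ _
  (citv_lebesgue (@itv01 R)) citv_fin.

End unit_interval.

(** * Curves and metric speed *)

Section curve_topology.
Context {R : realType} (Z : pmetricType R).
Implicit Types (c : curve Z) (s t : @itv01 R).

Lemma metric_ballP (V : metricType R) (x y : V) (e : R) :
  ball x e y = (mdist x y < e) :> Prop.
Proof. by rewrite ballEmdist. Qed.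

Lemma curve_fun_continuous c t (e : R) : 0 < e -> exists2 d : R, 0 < d &
  forall s, `|val t - val s| < d -> mdist (curve_fun c t) (curve_fun c s) < e.
Proof.
move=> e0; have ct : continuous (curve_fun c) by exact: cts_fun.
have /nbhs_ballP[d /= d0 dc] := ct t _ (nbhsx_ballx (curve_fun c t) e e0).
exists d => // s ts; have := dc s ts; rewrite /preimage/=.
by rewrite metric_ballP.
Qed.

Lemma curve_nbhs c (e : R) : 0 < e ->
  \forall c' \near c, forall s, mdist (curve_fun c s) (curve_fun c' s) < e.
Proof.
move=> e0.
have cc : continuous (@curve_fun R Z : curve Z -> arrow_uniform_type itv01 Z).
  exact: initial_continuous.
have h0 := cc c _ (nbhsx_ballx (curve_fun c : arrow_uniform_type itv01 Z) e e0).
apply: (@filterS _ (nbhs c) _ _ _ _ h0) => c' h s; have := h s.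
by rewrite metric_ballP.
Qed.

Lemma eval_continuous s : continuous (fun c => curve_fun c s).
Proof.
move=> c A /nbhs_ballP[e /= e0 eA].
have := curve_nbhs c e0; apply: filterS => c' h; apply: eA.
by rewrite metric_ballP.
Qed.

Lemma curve_continuous (T : topologicalType) (F : T -> curve Z) :
  (forall x (e : R), 0 < e ->
    \forall x' \near x, forall s, mdist (curve_fun (F x) s) (curve_fun (F x') s) < e) ->
  continuous F.
Proof.
move=> hF; apply: continuous_comp_initial => x A /nbhs_ballP[e /= e0 eA].
have := hF x e e0; apply: filterS => x' h; apply: eA => s.
by rewrite metric_ballP.
Qed.

Lemma measurable_eval_at s : measurable_fun setT (@eval_at R Z s).
Proof. apply: continuous_borel; exact: eval_continuous. Qed.

Lemma mdist_lip (V : metricType R) (x x' y y' : V) :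
  `|mdist x y - mdist x' y'| <= mdist x x' + mdist y y'.
Proof.
have h1 := metric_triangle x x' y; have h2 := metric_triangle x' y' y.
have h3 := metric_triangle x' x y'; have h4 := metric_triangle x y y'.
move: h1 h2 h3 h4; rewrite (metric_sym x' x) (metric_sym y' y) => *.
by rewrite ler_norml; apply/andP; split; lra.
Qed.

Lemma measurable_mdist_curve s t :
  measurable_fun setT (fun c : borel (curve Z) => mdist (curve_fun c s) (curve_fun c t)).
Proof.
apply: continuous_borelR; apply: continuousR_eps => c e e0.
have := curve_nbhs c (divr_gt0 e0 (ltr0n _ 2)); apply: filterS => c' h.
apply: le_lt_trans (mdist_lip _ _ _ _) _.
by have := h s; have := h t; lra.
Qed.

(** Together with [grid_point], rounds a time down to a multiple of 1/(N + 1), so that only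
    countably many evaluation maps occur. *)
Definition grid_index (N : nat) t : nat := Num.truncn (N.+1%:R * val t).
Definition grid_point (N n : nat) : @itv01 R := clamp01 (n%:R / N.+1%:R).
Definition grid N t := grid_point N (grid_index N t).

Lemma gridP N t : `|val t - val (grid N t)| < N.+1%:R^-1.
Proof.
have /andP[t0 t1] := itv01P t.
have Nt0 : 0 <= N.+1%:R * val t by rewrite mulr_ge0.
have N0 : 0 < N.+1%:R :> R by [].
have /andP[h1 h2] := truncn_itv Nt0.
rewrite /grid /grid_point /grid_index; set n := Num.truncn _ in h1 h2 *.
have n1 : n%:R / N.+1%:R <= val t by rewrite ler_pdivrMr// mulrC.
rewrite clamp01K; last by rewrite divr_ge0//= (le_trans n1).
rewrite ger0_norm ?subr_ge0// -(ltr_pM2l N0) mulfV ?gt_eqF// mulrBr mulrCA.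
by rewrite mulfV ?gt_eqF// mulr1; move: h2; rewrite -natr1; lra.
Qed.

Lemma measurable_grid_index N n : measurable (grid_index N @^-1` [set n] : set (borel itv01)).
Proof.
rewrite (_ : _ @^-1` _ = (val : borel itv01 -> R) @^-1` `[n%:R / N.+1%:R, n.+1%:R / N.+1%:R[).
  by rewrite -[X in measurable X]setTI; exact: measurable_val_itv.
apply/seteqP; split => t; have /andP[t0 t1] := itv01P t;
  have Nt0 : 0 <= N.+1%:R * val t by rewrite mulr_ge0.
- move=> /= <-; have := truncn_itv Nt0; rewrite in_itv/= /grid_index.
  by rewrite ler_pdivrMr// ltr_pdivlMr// ![_ * N.+1%:R]mulrC.
- rewrite /= in_itv/= ler_pdivrMr// ltr_pdivlMr// ![_ * N.+1%:R]mulrC => h.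
  by apply/truncn_def.
Qed.

Lemma grid_cvg c t (e : R) : 0 < e -> exists N, forall n, (N <= n)%N ->
  mdist (curve_fun c (grid n t)) (curve_fun c t) < e.
Proof.
move=> e0; have [d d0 hd] := curve_fun_continuous c t e0.
have [k kd] := inv_nat_lt d0; exists k => n kn; rewrite metric_sym; apply: hd.
apply: lt_le_trans (gridP n t) _; apply: le_trans (ltW kd).
by rewrite lef_pV2 ?posrE// ler_nat ltnS.
Qed.

Section joint.
Variables (sg ta : borel (@itv01 R) -> borel (@itv01 R)).
Hypotheses (msg : measurable_fun setT sg) (mta : measurable_fun setT ta).

Let mk (rho : borel (@itv01 R) -> borel (@itv01 R)) (mrho : measurable_fun setT rho) N n :
  measurable ((fun p : borel (curve Z) * borel (@itv01 R) => grid_index N (rho p.2)) @^-1` [set n]).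
Proof.
have m1 : measurable_fun setT (fun p : borel (curve Z) * borel (@itv01 R) => rho p.2).
  by apply: measurableT_comp => //; exact: measurable_snd.
rewrite -[X in measurable X]setTI; apply: (m1 measurableT (grid_index N @^-1` [set n])).
exact: measurable_grid_index.
Qed.

(** At a fixed time, evaluation is continuous in the curve; rounding the time reduces to countably
    many such maps, and continuity of each curve gives the pointwise limit. *)
Lemma measurable_joint_eval :
  measurable_fun setT (fun p : borel (curve Z) * borel (@itv01 R) =>
    (curve_fun p.1 (sg p.2) : borel Z)).
Proof.
apply: (@measurable_fun_cvg_metric _ (borel (curve Z) * borel (@itv01 R))%type R Z
  (fun N (p : borel (curve Z) * borel (@itv01 R)) => curve_fun p.1 (grid N (sg p.2)))).
- move=> N; apply: (measurable_fun_choice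
    (k := fun p : borel (curve Z) * borel (@itv01 R) => grid_index N (sg p.2))
    (g := fun n p => curve_fun p.1 (grid_point N n) : borel Z)).
  + by move=> n; exact: mk.
  + move=> n; apply: (@measurableT_comp _ _ _ _ _ _ (@eval_at R Z (grid_point N n))).
      exact: measurable_eval_at.
    exact: measurable_fst.
- by move=> [c t] e e0; exact: grid_cvg.
Qed.

Lemma measurable_joint_mdist :
  measurable_fun setT (fun p : borel (curve Z) * borel (@itv01 R) =>
    mdist (curve_fun p.1 (sg p.2)) (curve_fun p.1 (ta p.2))).
Proof.
apply: (@measurable_fun_cvg _ (borel (curve Z) * borel (@itv01 R))%type R setT
  (fun N (p : borel (curve Z) * borel (@itv01 R)) => mdist (curve_fun p.1 (grid N (sg p.2))) (curve_fun p.1 (grid N (ta p.2))))).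
- move=> N; apply: (measurable_fun_choice
    (k := fun p : borel (curve Z) * borel (@itv01 R) => grid_index N (sg p.2))
    (g := fun n p => mdist (curve_fun p.1 (grid_point N n)) (curve_fun p.1 (grid N (ta p.2))))).
  + by move=> n; exact: mk.
  + move=> n; apply: (measurable_fun_choice
      (k := fun p : borel (curve Z) * borel (@itv01 R) => grid_index N (ta p.2))
      (g := fun m p => mdist (curve_fun p.1 (grid_point N n)) (curve_fun p.1 (grid_point N m)))).
    * by move=> m; exact: mk.
    * move=> m; apply: (@measurableT_comp _ _ _ _ _ _
        (fun c : borel (curve Z) => mdist (curve_fun c (grid_point N n)) (curve_fun c (grid_point N m)))).
        exact: measurable_mdist_curve.
      exact: measurable_fst.
- move=> [c t] _; apply/cvgrPdist_lt => e e0 /=.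
  have e20 := divr_gt0 e0 (ltr0n R 2).
  have [N hN] := grid_cvg c (sg t) e20; have [M hM] := grid_cvg c (ta t) e20.
  exists (maxn N M) => // n /=; rewrite geq_max => /andP[/hN h1 /hM h2].
  apply: le_lt_trans (mdist_lip _ _ _ _) _.
  by rewrite (metric_sym (curve_fun c (sg t))) (metric_sym (curve_fun c (ta t))); lra.
Qed.

End joint.

End curve_topology.

(** * Metric speed and its measurability *)

Section metric_speed.
Context {R : realType} (Z : pmetricType R).
Implicit Types (c : @itv01 R -> Z) (s t : @itv01 R).

Lemma near_dnbhs_itv01 t (P : itv01 -> Prop) : (\forall s \near t^', P s) <->
  exists2 d : R, 0 < d & forall s, 0 < `|val s - val t| < d -> P s.
Proof.
rewrite /dnbhs /within/=; split.
- move=> /nbhs_ballP[d /= d0 dP]; exists d => // s /andP[s0 sd].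
  apply: dP; first by rewrite ball_itv01 distrC.
  by apply/eqP => st; move: s0; rewrite st subrr normr0 ltxx.
- move=> [d d0 dP]; apply/nbhs_ballP; exists d => // s.
  rewrite ball_itv01 distrC => sd /eqP st; apply: dP.
  rewrite sd normr_gt0 subr_eq0 andbT; apply/eqP => h; apply: st; exact: val_inj.
Qed.

(** A time at distance exactly 1/(n + 2) <= 1/2 from [t], to the right in the left half and to the
    left in the right half, so that clamping does not alter it. It shows that punctured
    neighbourhoods are nonempty and gives a sequence along which the speed is computed. *)
Definition step (n : nat) t : @itv01 R :=
  clamp01 (if val t <= 2^-1 then val t + n.+2%:R^-1 else val t - n.+2%:R^-1).

Lemma inv_step n : 0 < (n.+2%:R^-1 : R) <= 2^-1.
Proof. by rewrite invr_gt0 ltr0n/= lef_pV2 ?posrE// ler_nat. Qed.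

Lemma stepP n t : `|val (step n t) - val t| = n.+2%:R^-1.
Proof.
have /andP[t0 t1] := itv01P t; have /andP[n0 n2] := inv_step n.
move: n0 n2; rewrite /step; set k := _^-1 => k0 k2.
have h2 : 2^-1 + 2^-1 = 1 :> R by field.
case: ifPn; rewrite -?ltNge => th; rewrite clamp01K.
- by rewrite (_ : _ - val t = k) ?gtr0_norm//; ring.
- lra.
- by rewrite (_ : _ - val t = - k) ?normrN ?gtr0_norm//; ring.
- lra.
Qed.

Lemma proper_dnbhs_itv01 t : ProperFilter t^'.
Proof.
split; last exact: within_filter.
move=> /near_dnbhs_itv01[d d0 dP].
have [k kd] := inv_nat_lt d0; apply: (dP (step k t)).
rewrite stepP; have /andP[-> _]/= := inv_step k.
by apply: le_lt_trans kd; rewrite lef_pV2 ?posrE// ler_nat.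
Qed.

Definition speed_quotient c t s : R := mdist (c s) (c t) / `|val s - val t|.

Definition has_mspeed c t (l : R) := forall e : R, 0 < e -> exists2 d : R, 0 < d &
  forall s, 0 < `|val s - val t| < d -> `|speed_quotient c t s - l| <= e.

Lemma has_mspeedP c t l : has_mspeed c t l <->
  speed_quotient c t s @[s --> t^'] --> l.
Proof.
have FF := proper_dnbhs_itv01 t.
split.
- move=> h; apply/cvgrPdist_le => e /h[d d0 hd]; apply/near_dnbhs_itv01.
  by exists d => // s sd; rewrite distrC; exact: hd.
- move=> /cvgrPdist_le h e /h /near_dnbhs_itv01[d d0 hd].
  by exists d => // s sd; rewrite distrC; exact: hd.
Qed.

Lemma mspeed_lim c t l : has_mspeed c t l -> mspeed c t = l.
Proof.
move=> /has_mspeedP h; have FF := proper_dnbhs_itv01 t.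
by apply: cvg_lim h; exact: Rhausdorff.
Qed.

(** [lim] returns the default point of [R], which is 0, where no limit exists. *)
Lemma mspeed_dvg c t : ~ (exists l, has_mspeed c t l) -> mspeed c t = 0.
Proof.
move=> h; rewrite /mspeed /lim_in; apply: xgetPN => l hl.
by apply: h; exists l; apply/has_mspeedP.
Qed.

Lemma mspeed_step c t l : has_mspeed c t l ->
  speed_quotient c t (step n t) @[n --> \oo] --> l.
Proof.
move=> h; apply/cvgrPdist_le => e /h[d d0 hd].
have [k kd] := inv_nat_lt d0; exists k => // n /= kn; rewrite distrC; apply: hd.
rewrite stepP; have /andP[-> _]/= := inv_step n.
by apply: le_lt_trans kd; rewrite lef_pV2 ?posrE// ler_nat ltnS; exact: leqW.
Qed.

Lemma mspeed_ge0 c t : 0 <= mspeed c t.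
Proof.
have [[l hl]|/mspeed_dvg ->//] := pselect (exists l, has_mspeed c t l).
rewrite (mspeed_lim hl); have := mspeed_step hl.
move=> h; rewrite -(cvg_lim (@Rhausdorff R) h); apply: limr_ge; first by apply/cvg_ex; exists l.
by apply: nearW => n; rewrite /speed_quotient divr_ge0// mdist_ge0.
Qed.

Definition rat_point (i : nat) : @itv01 R := clamp01 (ratr (odflt 0%Q (unpickle i))).

Lemma rat_point_dense t (e : R) : 0 < e -> exists i, `|val (rat_point i) - val t| < e.
Proof.
move=> e0; have te : val t - e < val t + e by lra.
have [r r12] := @rat_in_itvoo R _ _ te.
have /andP[r1 r2] : val t - e < ratr r < val t + e by move: r12; rewrite in_itv.
exists (pickle r); rewrite /rat_point pickleK -[X in _ - val X]val_clamp01K.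
apply: le_lt_trans (clamp01_lip _ _) _; rewrite [odflt _ _]/=.
by rewrite ltr_norml; apply/andP; split; lra.
Qed.

(** The Cauchy criterion restricted to rational times. For a continuous curve it amounts to the
    existence of the speed, and it consists of countably many measurable conditions. *)
Definition mspeed_cauchy c t := forall k : nat, exists n : nat, forall i j : nat,
  0 < `|val (rat_point i) - val t| < n.+1%:R^-1 ->
  0 < `|val (rat_point j) - val t| < n.+1%:R^-1 ->
  `|speed_quotient c t (rat_point i) - speed_quotient c t (rat_point j)| <= k.+1%:R^-1.

Lemma speed_quotient_approx (c : curve Z) t s (e d : R) : 0 < e ->
  0 < `|val s - val t| < d -> exists2 i, 0 < `|val (rat_point i) - val t| < d &
    `|speed_quotient (curve_fun c) t s - speed_quotient (curve_fun c) t (rat_point i)| <= e.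
Proof.
move=> e0 /andP[st0 std].
set r := `|val s - val t| in st0 std *.
pose D := mdist (curve_fun c s) (curve_fun c t).
have D0 : 0 <= D by exact: mdist_ge0.
have e1 : 0 < e * r / 4 by rewrite divr_gt0// mulr_gt0.
have [d1 d10 hd1] := curve_fun_continuous c s e1.
have D10 : 0 < D + 1 by rewrite ltr_wpDl.
(* Bounds the effect of replacing [|s - t|] by the nearby denominator by e / 2; the denominator
   [D + 1] covers the case [D = 0]. *)
pose e2 := e * r ^+ 2 / (4 * (D + 1)).
have e20 : 0 < e2 by rewrite divr_gt0// ?mulr_gt0// exprn_gt0.
pose d2 := Num.min (Num.min d1 (r / 2)) (Num.min (d - r) e2).
have d20 : 0 < d2 by rewrite !lt_min d10 divr_gt0//= subr_gt0 std e20.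
have [i hi] := rat_point_dense s d20; exists i.
  move: hi; rewrite !lt_min => /andP[/andP[_ h2] /andP[h3 _]].
  have h4 := ler_normD (val (rat_point i) - val s) (val s - val t).
  have h5 := ler_normB (val (rat_point i) - val s) (val (rat_point i) - val t).
  move: h4 h5; have -> : val (rat_point i) - val s + (val s - val t) = val (rat_point i) - val t by ring.
  have -> : val (rat_point i) - val s - (val (rat_point i) - val t) = - (val s - val t) by ring.
  by rewrite normrN -/r => h4 h5; apply/andP; split; lra.
move: hi; rewrite !lt_min => /andP[/andP[h1 h2] /andP[h3 h4]].
rewrite /speed_quotient -/r -/D.
set r' := `|val (rat_point i) - val t|; set D' := mdist (curve_fun c (rat_point i)) _.
have rr' : `|r - r'| < e2 /\ `|r - r'| < r / 2.
  suff : `|r - r'| <= `|val (rat_point i) - val s| by move=> h; split; exact: le_lt_trans h _.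
  apply: (le_trans (ler_dist_dist _ _)).
  by rewrite distrC; apply: le_of_eq; congr (`|_|); ring.
have DD' : `|D - D'| < e * r / 4.
  apply: le_lt_trans (mdist_lip _ _ _ _) _; rewrite mdistxx addr0; apply: hd1.
  by rewrite distrC.
have [rr1 rr2] := rr'.
have r'0 : r / 2 < r' by move: rr2; rewrite ltr_norml => /andP[_ ?]; lra.
have r'p : 0 < r' by lra.
have -> : D / r - D' / r' = (D - D') / r' + D * (r' - r) / (r * r').
  by field; rewrite !gt_eqF.
apply: le_trans (ler_normD _ _) _.
have A : `|(D - D') / r'| <= e / 2.
  rewrite normrM normfV (gtr0_norm r'p) ler_pdivrMr//.
  by apply: le_trans (ltW DD') _; have := ler_wpM2l (ltW e0) (ltW r'0); lra.
have B : `|D * (r' - r) / (r * r')| <= e / 2.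
  rewrite normrM normfV (gtr0_norm (mulr_gt0 st0 r'p)) ler_pdivrMr ?mulr_gt0//.
  rewrite normrM (ger0_norm D0) distrC.
  apply: (@le_trans _ _ ((D + 1) * e2)); first by rewrite ler_pM// ?lerDl// ltW.
  have -> : (D + 1) * e2 = e * r / 2 * (r / 2) by rewrite /e2; field; rewrite gt_eqF.
  have -> : e / 2 * (r * r') = e * r / 2 * r' by field.
  by rewrite ler_wpM2l ?ltW// divr_gt0// mulr_gt0.
lra.
Qed.

Lemma mspeed_cauchyP (c : curve Z) t :
  (exists l, has_mspeed (curve_fun c) t l) <-> mspeed_cauchy (curve_fun c) t.
Proof.
split.
- move=> [l hl] k; have k0 : 0 < k.+1%:R^-1 / 2 :> R by rewrite divr_gt0// invr_gt0.
  have [d d0 hd] := hl _ k0; have [n nd] := inv_nat_lt d0.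
  exists n => i j /andP[i0 id] /andP[j0 jd].
  have := hd (rat_point i); rewrite i0 (lt_trans id nd) => /(_ isT) h1.
  have := hd (rat_point j); rewrite j0 (lt_trans jd nd) => /(_ isT) h2.
  apply: le_trans (ler_distD l _ _) _; rewrite (distrC l).
  by move: h1 h2; set q := _^-1; lra.
- move=> hc; have FF := proper_dnbhs_itv01 t.
  suff : cvg (speed_quotient (curve_fun c) t s @[s --> t^']).
    by move=> /cvg_ex[l hl]; exists l; apply/has_mspeedP.
  apply: cauchy_cvg; apply/cauchy_ballP => e e0.
  have [k ke] := inv_nat_lt (divr_gt0 e0 (ltr0n R 4)); have [n hn] := hc k.
  have n0 : 0 < n.+1%:R^-1 :> R by rewrite invr_gt0.
  have k0 : 0 < k.+1%:R^-1 :> R by rewrite invr_gt0.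
  have key : \forall s \near t^', 0 < `|val s - val t| < n.+1%:R^-1.
    by apply/near_dnbhs_itv01; exists n.+1%:R^-1.
  rewrite near_map2; near=> s s' => /=.
  have hs : 0 < `|val s - val t| < n.+1%:R^-1 by near: s.
  have hs' : 0 < `|val s' - val t| < n.+1%:R^-1 by near: s'.
  have [i hi ai] := speed_quotient_approx c k0 hs.
  have [j hj aj] := speed_quotient_approx c k0 hs'.
  have aij := hn i j hi hj.
  rewrite /ball/=.
  apply: le_lt_trans (ler_distD (speed_quotient (curve_fun c) t (rat_point i)) _ _) _.
  apply: le_lt_trans (lerD (lexx _) (ler_distD (speed_quotient (curve_fun c) t (rat_point j)) _ _)) _.
  move: ai aj aij ke; rewrite (distrC (speed_quotient _ t (rat_point j))); set q := _^-1; lra.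
Unshelve. all: by end_near. Qed.

End metric_speed.

Section joint_mspeed.
Context {R : realType} (Z : pmetricType R).
Local Notation prodT := (borel (curve Z) * borel (@itv01 R))%type.

Lemma measurable_step n : measurable_fun setT (step n : borel (@itv01 R) -> borel (@itv01 R)).
Proof.
apply: (@measurableT_comp _ _ _ _ _ _ (@clamp01 R : R -> borel itv01)).
  exact: measurable_clamp01.
have mv := @measurable_val_itv R itv01.
apply: measurable_fun_ifT => //.
- by apply: measurable_fun_ler.
- by apply: measurable_funD.
- by apply: measurable_funB.
Qed.

Let dist_val (sg : borel (@itv01 R) -> borel (@itv01 R)) : measurable_fun setT sg ->
  measurable_fun setT (fun p : prodT => `|val (sg p.2) - val p.2|).
Proof.
move=> msg; apply: measurableT_comp => //.
have mv := @measurable_val_itv R itv01.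
apply: measurable_funB.
  apply: (@measurableT_comp _ _ _ _ _ _ (val : borel (@itv01 R) -> R)) => //.
  by apply: measurableT_comp => //; exact: measurable_snd.
exact: (@measurableT_comp _ _ _ _ _ _ (val : borel (@itv01 R) -> R)).
Qed.

Lemma measurable_speed_quotient (sg : borel (@itv01 R) -> borel (@itv01 R)) :
  measurable_fun setT sg ->
  measurable_fun setT (fun p : prodT => speed_quotient (curve_fun p.1) p.2 (sg p.2)).
Proof.
move=> msg; apply: measurable_funM.
  exact: (@measurable_joint_mdist R Z sg id msg (@measurable_id _ _ _)).
by apply: measurable_fun_invr => //; exact: dist_val.
Qed.

Let mQ i : measurable_fun setT (fun p : prodT => speed_quotient (curve_fun p.1) p.2 (rat_point i)).
Proof. by apply: (@measurable_speed_quotient (fun=> rat_point i)); exact: measurable_cst. Qed.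

Let mN i n : measurable [set p : prodT | 0 < `|val (@rat_point R i) - val p.2| < n.+1%:R^-1].
Proof.
have h := @dist_val (fun=> rat_point i) (measurable_cst _).
rewrite (_ : mkset _ = (fun p : prodT => `|val (rat_point i) - val p.2|) @^-1` `]0, n.+1%:R^-1[).
  by rewrite -[X in measurable X]setTI; apply: h.
by apply/seteqP; split => p /=; rewrite in_itv.
Qed.

Lemma measurable_mspeed_cauchy :
  measurable [set p : prodT | mspeed_cauchy (curve_fun p.1) p.2].
Proof.
rewrite (_ : mkset _ = \bigcap_k \bigcup_n \bigcap_i \bigcap_j
  (~` [set p : prodT | 0 < `|val (@rat_point R i) - val p.2| < n.+1%:R^-1] `|`
   (~` [set p : prodT | 0 < `|val (@rat_point R j) - val p.2| < n.+1%:R^-1] `|`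
   [set p : prodT | `|speed_quotient (curve_fun p.1) p.2 (rat_point i) -
     speed_quotient (curve_fun p.1) p.2 (rat_point j)| <= k.+1%:R^-1]))); last first.
  apply/seteqP; split => p /=.
  - move=> h k _; have [n hn] := h k; exists n => // i _ j _.
    have [h1|] := pselect (0 < `|val (@rat_point R i) - val p.2| < n.+1%:R^-1); last by left.
    have [h2|] := pselect (0 < `|val (@rat_point R j) - val p.2| < n.+1%:R^-1); last by right; left.
    by right; right; exact: hn.
  - move=> h k; have [n _ hn] := h k I; exists n => i j h1 h2.
    by have [|[|]] := hn i I j I.
apply: bigcapT_measurable => k; apply: bigcupT_measurable => n.
apply: bigcapT_measurable => i; apply: bigcapT_measurable => j.
apply: measurableU; first exact: measurableC.
apply: measurableU; first exact: measurableC.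
have h : measurable_fun setT (fun p : prodT => `|speed_quotient (curve_fun p.1) p.2 (rat_point i) -
     speed_quotient (curve_fun p.1) p.2 (rat_point j)|).
  by apply: measurableT_comp => //; apply: measurable_funB.
rewrite (_ : mkset _ = (fun p : prodT => `|speed_quotient (curve_fun p.1) p.2 (rat_point i) -
     speed_quotient (curve_fun p.1) p.2 (rat_point j)|) @^-1` `]-oo, k.+1%:R^-1]).
  by rewrite -[X in measurable X]setTI; apply: h.
by apply/seteqP; split => p /=; rewrite in_itv.
Qed.

(** On the measurable set where the speed exists it is the limit of the quotients at [step n];
    elsewhere it is 0. *)
Lemma measurable_mspeed :
  measurable_fun setT (fun p : prodT => mspeed (curve_fun p.1) p.2).
Proof.
pose E := [set p : prodT | mspeed_cauchy (curve_fun p.1) p.2].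
have mE : measurable E by exact: measurable_mspeed_cauchy.
apply: (@measurable_fun_cvg _ prodT R setT
  (fun n => (fun p : prodT => speed_quotient (curve_fun p.1) p.2 (step n p.2)) \_ E)).
  move=> n; apply/(measurable_restrictT _ mE); apply: measurable_funTS.
  by apply: measurable_speed_quotient; exact: measurable_step.
move=> [c t] _; have [cE|nE] := pselect (E (c, t)).
- have [l hl] := (mspeed_cauchyP c t).2 cE.
  rewrite (mspeed_lim hl); apply: cvg_trans (mspeed_step hl).
  by apply: near_eq_cvg; apply: nearW => n /=; rewrite patchE mem_set.
- rewrite mspeed_dvg; last by move/mspeed_cauchyP.
  apply: cvg_near_cst; apply: nearW => n /=.
  by rewrite patchE memNset.
Qed.

Lemma measurable_mspeed1 (c : curve Z) :
  measurable_fun setT (fun t : borel (@itv01 R) => mspeed (curve_fun c) t).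
Proof.
exact: (measurableT_comp measurable_mspeed (pair1_measurable (c : borel (curve Z)))).
Qed.

Lemma measurable_mspeed2 (t : @itv01 R) :
  measurable_fun setT (fun c : borel (curve Z) => mspeed (curve_fun c) t).
Proof.
exact: (measurableT_comp measurable_mspeed (pair2_measurable (t : borel (@itv01 R)))).
Qed.

End joint_mspeed.

Lemma sqrD_le (R : realFieldType) (a b : R) : (a + b) ^+ 2 <= 2 * (a ^+ 2 + b ^+ 2).
Proof. by have := sqr_ge0 (a - b); rewrite !expr2; lra. Qed.

Section lfun2.
Context d (T : measurableType d) (R : realType) (m : {measure set T -> \bar R}).
Implicit Types f g : T -> R.

Lemma Lnorm2E f : ('N[m]_(2%:E) [EFin \o f] = (\int[m]_x (f x ^+ 2)%:E) `^ 2^-1)%E.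
Proof.
rewrite unlock /Lnorm/=.
congr (_ `^ _)%E; apply: eq_integral => x _.
by rewrite powR_mulrn// real_normK// num_real.
Qed.

Lemma ge0_integrableP f : (forall x, 0 <= f x) ->
  m.-integrable setT (EFin \o f) <->
  measurable_fun setT f /\ (\int[m]_x (f x)%:E < +oo)%E.
Proof.
move=> f0; have e : (\int[m]_x `|(EFin \o f) x| = \int[m]_x (f x)%:E)%E.
  by apply: eq_integral => x _ /=; rewrite ger0_norm.
split => [/integrableP[/measurable_EFinP mf]|[mf i]]; first by rewrite e.
by apply/integrableP; split; [exact/measurable_EFinP|rewrite e].
Qed.

Lemma Lfun2P f : f \in Lfun m 2%:E <->
  measurable_fun setT f /\ (\int[m]_x (f x ^+ 2)%:E < +oo)%E.
Proof.
split => [h|[mf i2]].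
- have /ge0_integrableP[|_ i2] := Lfun2_integrable_sqr h.
    by move=> x; rewrite sqr_ge0.
  by split => //; move: h; rewrite inE => /andP[/[!inE]].
- rewrite inE; apply/andP; split; rewrite inE//=.
  rewrite /finite_norm Lnorm2E.
  have : (0 <= \int[m]_x (f x ^+ 2)%:E)%E by apply: integral_ge0 => x _; rewrite lee_fin sqr_ge0.
  by move: i2; case: (integral _ _ _) => // r _ _; rewrite poweR_EFin ltry.
Qed.

End lfun2.

(** * Absolutely continuous curves and their densities *)

Section ac_curves.
Context {R : realType} (Z : pmetricType R).
Local Notation mu := (@lebesgue_measure R).
Implicit Types (c : @itv01 R -> Z).

Definition ac_bound (u : R -> R) c := density u /\
  forall s t, s <= t -> mdist (c (clamp01 s)) (c (clamp01 t)) <= \int[mu]_(r in `]s, t]) u r.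

Lemma ac_curve_bound c (g : borel (@itv01 R) -> R) :
  (forall r, 0 <= g r) -> g \in Lfun (citv_lebesgue itv01) 1 ->
  (forall s t : @itv01 R, val s <= val t -> ((mdist (c s) (c t))%:E <=
    \int[citv_lebesgue itv01]_(r in [set r | (val s <= val r <= val t)%R]) (g r)%:E)%E) ->
  ac_bound ((fun x : R => g (clamp01 x)) \_ `]0, 1]%classic) c.
Proof.
move=> g0 /Lfun1_integrable ig cg.
have mg : measurable_fun setT (EFin \o g) by case/integrableP : ig.
have g0' r : (0 <= (EFin \o g) r)%E by rewrite lee_fin.
set u : R -> R := (fun x : R => g (clamp01 x)) \_ `]0, 1]%classic.
have u0 x : 0 <= u x by rewrite /u patchE; case: ifP.
have mgc : measurable_fun setT (fun x : R => g (clamp01 x)).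
  apply: (@measurableT_comp _ _ _ _ _ _ g _ (@clamp01 R : R -> borel itv01)).
    exact/measurable_EFinP.
  exact: measurable_clamp01.
have mu' : measurable_fun setT u.
  by apply/(measurable_restrictT _ (measurable_itv _)); exact: measurable_funTS.
have iu : mu.-integrable setT (EFin \o u).
  apply/ge0_integrableP => //; split => //.
  have /ge0_integrableP[//|_] := ig.
  rewrite integral_itv01T// [X in (X < _)%E -> _]integral_mkcond => h.
  apply: le_lt_trans h; rewrite le_eqVlt; apply/orP; left; apply/eqP.
  by apply: eq_integral => x _; rewrite /= /u !patchE; case: ifP.
split => [|s t st]; first by split.
have cst : val (clamp01 s) <= val (clamp01 t) by exact: clamp01_le.
have := cg _ _ cst; rewrite integral_itv01// => h.
have iu' a b : (\int[mu]_(x in `]a, b]) (u x)%:E = (\int[mu]_(x in `]a, b]) u x)%:E)%E.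
  rewrite /Rintegral fineK//; apply: integrable_fin_num => //.
  exact: integrableS iu.
(* If the clamped times coincide there is nothing to bound; if they differ, the interval between
   them lies in ]s, t]. *)
have [e|ne] := eqVneq (val (clamp01 s)) (val (clamp01 t)).
  by rewrite (val_inj e) mdistxx; apply: Rintegral_ge0.
rewrite -lee_fin -iu'; apply: le_trans h _.
have -> : (\int[mu]_(x in `](val (clamp01 s)), (val (clamp01 t))]) (g (clamp01 x))%:E =
    \int[mu]_(x in `](val (clamp01 s)), (val (clamp01 t))]) (u x)%:E)%E.
  apply: eq_integral => x; rewrite inE/= in_itv/= /u patchE => /andP[x1 x2].
  rewrite mem_set//= in_itv/=.
  have /andP[s0 _] := itv01P (clamp01 s); have /andP[_ t1] := itv01P (clamp01 t).
  by rewrite (le_lt_trans s0 x1) (le_trans x2 t1).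
apply: ge0_subset_integral => //.
- by apply: measurable_funTS; exact/measurable_EFinP.
- by move=> x _; rewrite lee_fin.
- have /andP[s0 _] := itv01P (clamp01 s); have /andP[_ t1] := itv01P (clamp01 t).
  move: ne cst; rewrite !val_clamp01 => ne cst.
  apply: subset_itv; rewrite bnd_simp.
    by move: ne cst; clear; rewrite /Num.max /Num.min; repeat case: ifPn; rewrite -?leNgt ?eqxx//; lra.
  by move: ne cst; clear; rewrite /Num.max /Num.min; repeat case: ifPn; rewrite -?leNgt ?eqxx//; lra.
Qed.

Lemma ac_curve_density c : ac_curve 1 c -> exists u : R -> R, ac_bound u c.
Proof. by move=> [g [g0 g1 cg]]; eexists; exact: ac_curve_bound g0 g1 cg. Qed.

Lemma ac_bound_comp u c (phi : Z -> R) : ac_bound u c ->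
  (forall x y, `|phi x - phi y| <= mdist x y) -> ac_with u (fun x => phi (c (clamp01 x))).
Proof.
move=> [_ cu] lphi s t st; apply: le_trans (cu _ _ st).
by rewrite distrC.
Qed.

Lemma ac_bound_continuous u c : ac_bound u c -> forall x (e : R), 0 < e ->
  exists2 d : R, 0 < d & forall y, `|y - x| < d -> mdist (c (clamp01 x)) (c (clamp01 y)) < e.
Proof.
move=> [[u0 iu] cu] x e e0.
have := @primitive_continuous R u iu x.
move=> /cvgrPdist_lt/(_ e e0)/nbhs_ballP[d /= d0 hd]; exists d => // y yx.
have {hd} := hd y; rewrite /ball/= distrC => /(_ yx).
have [xy|/ltW yx'] := leP x y.
- by apply: le_lt_trans; apply: le_trans (cu _ _ xy) _; rewrite -primitiveB// distrC ler_norm.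
- by rewrite metric_sym; apply: le_lt_trans; apply: le_trans (cu _ _ yx') _; rewrite -primitiveB// ler_norm.
Qed.

Lemma ac_curve_continuous c : ac_curve 1 c -> continuous c.
Proof.
move=> /ac_curve_density[u du] t A /nbhs_ballP[e /= e0 eA].
have [d d0 hd] := ac_bound_continuous du (val t) e0.
apply/nbhs_ballP; exists d => // s ts; apply: eA; rewrite metric_ballP.
have := hd (val s); rewrite !val_clamp01K; apply.
by rewrite distrC; move: ts; rewrite ball_itv01.
Qed.

Lemma ac_curve21 c : ac_curve 2%:E c -> ac_curve 1 c.
Proof.
move=> [g [g0 g2 cg]]; exists g; split => //.
by apply: Lfun_subset12 g2; exact: fin_num_measure.
Qed.

(* The speed is the supremum of the derivatives of the distances to countably many points of the curve. *)
Lemma metric_speed u c : ac_bound u c -> exists m : R -> R,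
  [/\ ac_bound m c, (forall x, m x <= u x) &
    \forall x \ae mu, 0 < x < 1 -> has_mspeed c (clamp01 x) (m x)].
Proof.
move=> ac; have [du cu] := ac; have [u0 iu] := du.
pose phi i x := mdist (c (clamp01 x)) (c (rat_point i)).
have lphi i : ac_with u (phi i).
  apply: (@ac_bound_comp u c (fun z => mdist z (c (rat_point i)))) => // x y.
  by apply: le_trans (mdist_lip _ _ _ _) _; rewrite mdistxx addr0.
have /choice[b hb] : forall i, exists b : R -> R,
  [/\ mu.-integrable setT (EFin \o b),
    forall s t, s <= t -> phi i t - phi i s = \int[mu]_(r in `]s, t]) b r,
    \forall x \ae mu, has_slope (phi i) x (b x) &
    \forall x \ae mu, `|b x| <= u x].
  by move=> i; exact: ac_with_derivative.
(* The bound by [u x] holds only almost everywhere for the derivative; truncating makes the supremum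
   over i finite at every point. *)
pose h i x := Num.min `|b i x| (u x).
have h0 i x : 0 <= h i x by rewrite le_min normr_ge0 u0.
have hu i x : h i x <= u x by rewrite ge_min lexx orbT.
pose m x := sups (h ^~ x) 0.
have mh i : measurable_fun setT (h i).
  apply: measurable_minr.
    apply: measurableT_comp => //.
    by have [/integrableP[/measurable_EFinP]] := hb i.
  by case/integrableP : iu => /measurable_EFinP.
have hub x : has_ubound (range (h ^~ x)) by exists (u x) => _ [i _ <-].
have mm : measurable_fun setT m by apply: measurable_fun_sups.
have mE x : m x = sup (range (h ^~ x)).
  by rewrite /m /sups /sdrop; congr sup; apply/seteqP; split => _ [i _ <-]; exists i.
have hm i x : h i x <= m x by rewrite mE; apply: ub_le_sup => //; exists i.
have m0 x : 0 <= m x by apply: le_trans (hm 0%N x).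
have mu' x : m x <= u x.
  rewrite mE; apply: ge_sup; first by exists (h 0%N x); exists 0%N.
  by move=> _ [i _ <-].
have im : mu.-integrable setT (EFin \o m).
  apply: le_integrable iu => //; first exact/measurable_EFinP.
  by move=> x _; rewrite lee_fin !ger0_norm.
have bm : \forall x \ae mu, forall i, `|b i x| = h i x.
  apply: ae_nat => i; have [_ _ _] := hb i; apply: ae_mono => x bu.
  by rewrite /h min_l.
have phim i s t : s <= t -> `|phi i t - phi i s| <= \int[mu]_(r in `]s, t]) m r.
  move=> st; have [ib ab _ _] := hb i; rewrite ab//.
  have ib' : mu.-integrable `]s, t] (EFin \o b i) by exact: integrableS ib.
  have im' : mu.-integrable `]s, t] (EFin \o m) by exact: integrableS im.
  apply: (le_trans (le_normr_Rintegral _ _)) => //.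
  rewrite /Rintegral; apply: fine_le.
  - by apply: integrable_fin_num => //; exact: integrable_norm.
  - by apply: integrable_fin_num.
  apply: ae_ge0_le_integral => //=.
  - by case/integrableP : (integrable_norm ib').
  - by move=> x _; rewrite lee_fin.
  - by case/integrableP : im'.
  apply: ae_mono bm => x hx _ /=; rewrite lee_fin hx; exact: hm.
(* For a curve point close to the value at [t], the increment of the distance to it recovers the
   distance of the two values up to a small error. *)
have acm : ac_bound m c.
  split; first by split.
  move=> s t st; apply/ler_addgt0Pr => e e0.
  have e20 : 0 < e / 2 by rewrite divr_gt0.
  have [d d0 hd] := ac_bound_continuous ac (val (clamp01 t)) e20.
  have [i hi] := rat_point_dense (clamp01 t) d0.
  have := hd _ hi; rewrite !val_clamp01K => h1.
  have := phim i _ _ st; rewrite /phi ler_norml => /andP[h2 _].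
  have := metric_triangle (c (clamp01 s)) (c (rat_point i)) (c (clamp01 t)).
  rewrite (metric_sym (c (rat_point i))) => h3; lra.
exists m; split => //.
have hb' : \forall x \ae mu, forall i, has_slope (phi i) x (b i x).
  by apply: ae_nat => i; case: (hb i).
apply: ae_mono (ae_and3 bm hb' (primitive_slope im)) => x [bx sx mx] x01 e e0.
have x01' : 0 <= x <= 1 by lra.
have e20 : 0 < e / 2 by rewrite divr_gt0.
(* An index nearly attaining the supremum bounds the speed quotient from below; the derivative of
   the primitive of [m] bounds it from above. *)
have [_ [i _ <-] hi] : exists2 y, range (h ^~ x) y & m x - e / 2 < y.
  by apply: sup_gt; [exists (h 0%N x); exists 0%N|rewrite -mE; lra].
have [d1 d10 hd1] := mx _ e20; have [d2 d20 hd2] := sx i _ e20.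
exists (Num.min d1 d2); first by rewrite lt_min d10.
move=> s; rewrite clamp01K// lt_min => /andP[s0 /andP[s1 s2]].
set r := `|val s - x| in s0 s1 s2 *.
have := hd1 _ s1; have := hd2 _ s2; rewrite -/r => A B.
pose D := mdist (c s) (c (clamp01 x)).
have upper : D <= `|primitive m (val s) - primitive m x|.
  have cm := acm.2; have [xs|/ltW sx'] := leP x (val s).
    have := cm _ _ xs; rewrite -primitiveB// val_clamp01K metric_sym => h'.
    by apply: le_trans h' _; exact: ler_norm.
  have := cm _ _ sx'; rewrite -primitiveB// val_clamp01K => h'.
  by apply: le_trans h' _; rewrite distrC; exact: ler_norm.
have lower : `|phi i (val s) - phi i x| <= D.
  rewrite /phi val_clamp01K; apply: le_trans (mdist_lip _ _ _ _) _.
  by rewrite mdistxx addr0.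
have r0 : r != 0 by rewrite gt_eqF.
have -> : speed_quotient c (clamp01 x) s = D / r by rewrite /speed_quotient clamp01K.
have -> : D / r - m x = (D - m x * r) / r by field.
rewrite normrM normfV (gtr0_norm s0) ler_pdivrMr// ler_norml; apply/andP; split.
- have h3 : `|b i x| * r <= `|phi i (val s) - phi i x| + e / 2 * r.
    rewrite -[X in _ * X <= _](ger0_norm (ltW s0)) /r normr_id -normrM.
    have -> : b i x * (val s - x) = (phi i (val s) - phi i x) - (phi i (val s) - phi i x - b i x * (val s - x)) by ring.
    by apply: (le_trans (ler_normB _ _)); rewrite lerD2l.
  have h4 : (m x - e / 2) * r <= `|b i x| * r by rewrite ler_wpM2r ?ltW// bx.
  move: h4; rewrite mulrBl => h4; lra.
- have h3 : `|primitive m (val s) - primitive m x| <= m x * r + e / 2 * r.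
    have -> : primitive m (val s) - primitive m x = m x * (val s - x) + (primitive m (val s) - primitive m x - m x * (val s - x)) by ring.
    by apply: (le_trans (ler_normD _ _)); rewrite normrM (ger0_norm (m0 x)) lerD2l.
  rewrite lerBlDr; apply: le_trans upper _; apply: le_trans h3 _.
  by rewrite addrC lerD2r ler_wpM2r// ?ltW//; lra.
Qed.

End ac_curves.

(** * Test plans and weak upper gradients *)

Section fubini_ae.
Context d1 d2 (T1 : measurableType d1) (T2 : measurableType d2) (R : realType).
Variables (m1 : {sigma_finite_measure set T1 -> \bar R})
  (m2 : {sigma_finite_measure set T2 -> \bar R}).
Variables (G : set (T1 * T2)).
Hypothesis mG : measurable G.

Let A := ~` G.
Let mA : measurable A. Proof. exact: measurableC. Qed.

Let ge0_integral_eq0 d (T : measurableType d) (m : {measure set T -> \bar R})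
    (f : T -> \bar R) : measurable_fun setT f -> (forall x, (0 <= f x)%E) ->
  (\int[m]_x f x = 0)%E <-> (\forall x \ae m, f x = 0%E).
Proof.
move=> mf f0.
have e : (\int[m]_x `|f x| = \int[m]_x f x)%E.
  by apply: eq_integral => x _; rewrite gee0_abs.
rewrite -e ae_eq_integral_abs//; split; apply: ae_mono => x; first by apply.
by move=> ->.
Qed.

Let xs x : m2 (xsection A x) = 0%E <-> (\forall y \ae m2, G (x, y)).
Proof.
split=> [h|[B [mB B0 AB]]].
- exists (xsection A x); split => //; first exact: measurable_xsection.
  by move=> y /= nG; rewrite /xsection/= inE.
- apply/eqP; rewrite -measure_le0 -B0; apply: le_measure; rewrite ?inE//.
    exact: measurable_xsection.
  by move=> y; rewrite /xsection/= inE => nG; exact: AB.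
Qed.

Let ys y : m1 (ysection A y) = 0%E <-> (\forall x \ae m1, G (x, y)).
Proof.
split=> [h|[B [mB B0 AB]]].
- exists (ysection A y); split => //; first exact: measurable_ysection.
  by move=> x /= nG; rewrite /ysection/= inE.
- apply/eqP; rewrite -measure_le0 -B0; apply: le_measure; rewrite ?inE//.
    exact: measurable_ysection.
  by move=> x; rewrite /ysection/= inE => nG; exact: AB.
Qed.

Let intx : (\int[m1]_x m2 (xsection A x) = 0)%E <->
  (\forall x \ae m1, \forall y \ae m2, G (x, y)).
Proof.
rewrite ge0_integral_eq0//; last exact: measurable_fun_xsection.
by split; apply: ae_mono => x /xs.
Qed.

Let inty : (\int[m2]_y m1 (ysection A y) = 0)%E <->
  (\forall y \ae m2, \forall x \ae m1, G (x, y)).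
Proof.
rewrite ge0_integral_eq0//; last exact: measurable_fun_ysection.
by split; apply: ae_mono => x /ys.
Qed.

(** Both iterated statements say that the complement of [G] has product measure zero, computed by
    Tonelli in the two orders. *)
Lemma ae_swap : (\forall x \ae m1, \forall y \ae m2, G (x, y)) <->
  (\forall y \ae m2, \forall x \ae m1, G (x, y)).
Proof.
rewrite -intx -inty.
have := indic_fubini_tonelli m1 m2 mA.
by rewrite indic_fubini_tonelli_FE// indic_fubini_tonelli_GE// => ->.
Qed.

Lemma ae_prod1 : (\forall x \ae m1, \forall y \ae m2, G (x, y)) <->
  (\forall p \ae (m1 \x m2)%E, G p).
Proof.
rewrite -intx; split=> [h|[B [mB B0 AB]]].
- by exists A; split => //; rewrite -measurable_measureT.
- have : ((m1 \x m2)%E A <= (m1 \x m2)%E B)%E by apply: le_measure; rewrite ?inE.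
  by rewrite [X in (_ <= X)%E]B0 measure_le0 => /eqP.
Qed.

End fubini_ae.

(** * Line integrals under a test plan *)

Section test_plans.
Context {R : realType} (Z : pmetricType R) (m : {measure set (borel Z) -> \bar R}).
Local Notation mu := (@lebesgue_measure R).
Local Notation leb := (citv_lebesgue (@itv01 R)).
Implicit Types (P : probability (borel (curve Z)) R) (G f : borel Z -> R).

Definition curve_integrand G (p : borel (curve Z) * borel (@itv01 R)) : R :=
  G (curve_fun p.1 p.2) * mspeed (curve_fun p.1) p.2.

Lemma measurable_eval_comp G : measurable_fun setT G ->
  measurable_fun setT (fun p : borel (curve Z) * borel (@itv01 R) => G (curve_fun p.1 p.2)).
Proof.
move=> mG; apply: (@measurableT_comp _ _ _ _ _ _ G _
  (fun p : borel (curve Z) * borel (@itv01 R) => (curve_fun p.1 p.2 : borel Z))) => //.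
exact: (@measurable_joint_eval R Z id (@measurable_id _ _ _)).
Qed.

Lemma measurable_curve_integrand G : measurable_fun setT G ->
  measurable_fun setT (curve_integrand G).
Proof.
move=> mG; apply: measurable_funM; first exact: measurable_eval_comp.
exact: measurable_mspeed.
Qed.

Definition line_integral G (c : borel (curve Z)) : \bar R :=
  (\int[leb]_s (curve_integrand G (c, s))%:E)%E.

Lemma curve_integrand_ge0 G p : (forall z, 0 <= G z) -> 0 <= curve_integrand G p.
Proof. by move=> G0; rewrite mulr_ge0// mspeed_ge0. Qed.

Lemma measurable_line_integral G : (forall z, 0 <= G z) -> measurable_fun setT G ->
  measurable_fun setT (line_integral G).
Proof.
move=> G0 mG; apply: (@measurable_fun_fubini_tonelli_F _ _ _ _ _ leb
  (fun p => (curve_integrand G p)%:E)).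
  by apply/measurable_EFinP; exact: measurable_curve_integrand.
by move=> p; rewrite lee_fin curve_integrand_ge0.
Qed.

Lemma line_integral_ge0 G c : (forall z, 0 <= G z) -> (0 <= line_integral G c)%E.
Proof. by move=> G0; apply: integral_ge0 => s _; rewrite lee_fin curve_integrand_ge0. Qed.

Lemma test_plan_energy P : test_plan m P ->
  (\int[P]_c \int[leb]_s (mspeed (curve_fun c) s ^+ 2)%:E < +oo)%E.
Proof.
move=> [_ _ h]; rewrite (@fubini_tonelli _ _ _ _ _ P leb
  (fun p => (mspeed (curve_fun p.1) p.2 ^+ 2)%:E))//.
- apply/measurable_EFinP; apply: measurable_funX; exact: measurable_mspeed.
- by move=> p; rewrite lee_fin sqr_ge0.
Qed.

Lemma integral_eval_le P (F : borel Z -> \bar R) : test_plan m P ->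
  measurable_fun setT F -> (forall z, (0 <= F z)%E) ->
  exists2 C : R, 0 < C & forall t, (\int[P]_c F (eval_at t c) <= C%:E * \int[m]_z F z)%E.
Proof.
move=> [[C C0 hC] _ _] mF F0; exists C => // t.
apply: ge0_integral_push_le => //; first exact: measurable_eval_at.
  exact: ltW.
exact: hC.
Qed.

(** From G |c'| <= G^2 + |c'|^2: the first term is controlled by the bounded compression of the
    plan, the second is its kinetic energy. *)
Lemma line_integral_fin P G : test_plan m P -> (forall z, 0 <= G z) ->
  G \in Lfun m 2%:E -> (\int[P]_c line_integral G c < +oo)%E.
Proof.
move=> tP G0 /Lfun2P[mG G2].
have mG2 : measurable_fun setT (fun z => (G z ^+ 2)%:E).
  by apply/measurable_EFinP; exact: measurable_funX.
have [C C0 hC] := integral_eval_le tP mG2 (fun z => sqr_ge0 (G z)).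
have e2 := test_plan_energy tP.
have m1 : measurable_fun setT (fun p : borel (curve Z) * borel (@itv01 R) =>
    (G (curve_fun p.1 p.2) ^+ 2)%:E).
  by apply/measurable_EFinP; apply: measurable_funX; exact: measurable_eval_comp.
have m2 : measurable_fun setT (fun p : borel (curve Z) * borel (@itv01 R) =>
    (mspeed (curve_fun p.1) p.2 ^+ 2)%:E).
  by apply/measurable_EFinP; apply: measurable_funX; exact: measurable_mspeed.
have p1 p : (0 <= (G (curve_fun (p : borel (curve Z) * borel (@itv01 R)).1 p.2) ^+ 2)%:E)%E by rewrite lee_fin sqr_ge0.
have p2 p : (0 <= (mspeed (curve_fun (p : borel (curve Z) * borel (@itv01 R)).1) p.2 ^+ 2)%:E)%E by rewrite lee_fin sqr_ge0.
have i1 : (\int[P]_c \int[leb]_s (G (curve_fun c s) ^+ 2)%:E < +oo)%E.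
  rewrite (@fubini_tonelli _ _ _ _ _ P leb _ m1 p1).
  apply: (@le_lt_trans _ _ (\int[leb]_s (C%:E * \int[m]_z (G z ^+ 2)%:E))%E).
    apply: ge0_le_integral => //.
    - by move=> s _; apply: integral_ge0.
    - exact: (@measurable_fun_fubini_tonelli_G _ _ _ _ _ P _ m1 p1).
    - by move=> s _; exact: hC.
  rewrite -[X in (integral _ _ X < _)%E]/(cst (C%:E * \int[m]_z (G z ^+ 2)%:E)%E).
  rewrite integral_cst// [X in (_ * X)%E]citv_lebesgue01 mule1.
  by rewrite lte_mul_pinfty// ?lee_fin ltW.
apply: (@le_lt_trans _ _ (\int[P]_c (\int[leb]_s (G (curve_fun c s) ^+ 2)%:E +
   \int[leb]_s (mspeed (curve_fun c) s ^+ 2)%:E))%E).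
  apply: ge0_le_integral => //.
  - by move=> c _; exact: line_integral_ge0.
  - exact: measurable_line_integral.
  - apply: emeasurable_funD.
      exact: (@measurable_fun_fubini_tonelli_F _ _ _ _ _ leb _ m1 p1).
    exact: (@measurable_fun_fubini_tonelli_F _ _ _ _ _ leb _ m2 p2).
  - move=> c _; rewrite -ge0_integralD//;
      [|by move=> s _; exact: (p1 (c, s))|exact: measurableT_comp m1 (pair1_measurable c)
       |by move=> s _; exact: (p2 (c, s))|exact: measurableT_comp m2 (pair1_measurable c)].
    apply: ge0_le_integral => //.
    + by move=> s _; rewrite lee_fin curve_integrand_ge0.
    + apply/measurable_EFinP.
      exact: measurableT_comp (measurable_curve_integrand mG) (pair1_measurable c).
    + apply: emeasurable_funD.
        exact: measurableT_comp m1 (pair1_measurable c).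
      exact: measurableT_comp m2 (pair1_measurable c).
    + move=> s _; rewrite -EFinD lee_fin /curve_integrand/=.
      set a := G _; set b := mspeed _ _.
      have := sqr_ge0 (a - b); have := sqr_ge0 (a + b); lra.
rewrite ge0_integralD//.
- exact: lte_add_pinfty i1 e2.
- by move=> c _; apply: integral_ge0 => s _; exact: (p1 (c, s)).
- exact: (@measurable_fun_fubini_tonelli_F _ _ _ _ _ leb _ m1 p1).
- by move=> c _; apply: integral_ge0 => s _; exact: (p2 (c, s)).
- exact: (@measurable_fun_fubini_tonelli_F _ _ _ _ _ leb _ m2 p2).
Qed.

(** Serves for a plan conditioned to a set of positive probability, with [K] the inverse of that
    probability. *)
Lemma test_plan_dominated P (P' : probability (borel (curve Z)) R) (K : R) :
  test_plan m P -> 0 < K -> (forall B, measurable B -> (P' B <= K%:E * P B)%E) ->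
  test_plan m P'.
Proof.
move=> [[C C0 hC] ae2 e2] K0 PP'; split.
- exists (K * C); first exact: mulr_gt0.
  move=> t A mA.
  have mtA : measurable (eval_at t @^-1` A : set (borel (curve Z))).
    by rewrite -[X in measurable X]setTI; exact: measurable_eval_at.
  apply: (le_trans (PP' _ mtA)); rewrite EFinM -muleA.
  by apply: lee_wpmul2l; [rewrite lee_fin ltW|exact: hC].
- move: ae2 => [A [mA A0 hA]]; exists A; split => //.
  by apply/eqP; rewrite -measure_le0; apply: le_trans (PP' _ mA) _; rewrite [P A]A0 mule0.
- have m2 : measurable_fun setT (fun p : borel (curve Z) * borel (@itv01 R) =>
      (mspeed (curve_fun p.1) p.2 ^+ 2)%:E).
    by apply/measurable_EFinP; apply: measurable_funX; exact: measurable_mspeed.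
  have p2 p : (0 <= (mspeed (curve_fun (p : borel (curve Z) * borel (@itv01 R)).1) p.2 ^+ 2)%:E)%E by rewrite lee_fin sqr_ge0.
  apply: (@le_lt_trans _ _ (\int[leb]_t (K%:E * \int[P]_c (mspeed (curve_fun c) t ^+ 2)%:E))%E).
    apply: ge0_le_integral => //.
    + by move=> t _; apply: integral_ge0 => c _; rewrite lee_fin sqr_ge0.
    + exact: (@measurable_fun_fubini_tonelli_G _ _ _ _ _ P' _ m2 p2).
    + apply: measurable_funeM.
      exact: (@measurable_fun_fubini_tonelli_G _ _ _ _ _ P _ m2 p2).
    + move=> t _.
      rewrite -(@ge0_integral_mscale _ _ _ P setT measurableT (NngNum (ltW K0)))//.
      * by apply: ge0_le_measure_integral => // x _; rewrite lee_fin sqr_ge0.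
      * exact: measurableT_comp m2 (pair2_measurable t).
      * by move=> x _; rewrite lee_fin sqr_ge0.
  rewrite ge0_integralZl_EFin//; last 2 first.
  + exact: (@measurable_fun_fubini_tonelli_G _ _ _ _ _ P _ m2 p2).
  + exact: ltW.
  + by rewrite lte_mul_pinfty// lee_fin ltW.
  + by move=> t _; apply: integral_ge0 => c _; exact: (p2 (c, t)).
Qed.

End test_plans.

Section conditioning.
Context {R : realType} (Z : pmetricType R) (m : {measure set (borel Z) -> \bar R}).
Implicit Types (P : probability (borel (curve Z)) R) (G f : borel Z -> R).

(* Otherwise the plan conditioned to the exceptional set is a test plan violating the integral inequality. *)
Lemma weak_upper_gradient_ae P f G : measurable_fun setT f ->
  weak_upper_gradient m f G -> test_plan m P ->
  \forall c \ae P, (`|f (eval_at end01 c) - f (eval_at start01 c)|%:E <= line_integral G c)%E.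
Proof.
move=> mf [G0 G2 wug] tP; have /Lfun2P[mG _] := G2.
have mev t : measurable_fun setT (fun c => f (eval_at t c)).
  by apply: (@measurableT_comp _ _ _ _ _ _ f) => //; exact: measurable_eval_at.
pose D c := `|f (eval_at end01 c) - f (eval_at start01 c)|.
have mD : measurable_fun setT (EFin \o D).
  by apply/measurable_EFinP; apply: measurableT_comp => //; exact: measurable_funB.
have mJ := measurable_line_integral G0 mG.
have J0 c := line_integral_ge0 c G0.
pose A := [set c | (line_integral G c < (D c)%:E)%E].
have mA : measurable A.
  rewrite (_ : A = ~` [set c | ((D c)%:E <= line_integral G c)%E]).
    apply: measurableC.
    have := @measurable_fun_lee _ _ _ setT _ _ mD mJ.
    move=> /(_ measurableT [set true])/=; rewrite setTI; apply.
    by [].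
  by apply/seteqP; split => c /= h; [apply/negP; rewrite -ltNge|rewrite /A/= ltNge; exact/negP].
exists A; split => //; last by move=> c /= /negP; rewrite -ltNge.
apply: contrapT => /eqP PA0.
have PAfin : P A \is a fin_num by exact: fin_num_measure.
pose k := (fine (P A))^-1.
have PApos : 0 < fine (P A).
  by rewrite fine_gt0// lt0e PA0/= measure_ge0/= -ge0_fin_numE.
have k0 : 0 < k by rewrite invr_gt0.
pose P' : probability (borel (curve Z)) R := mnormalize (mrestr P mA) P.
have P'E B : P' B = (k%:E * P (B `&` A))%E.
  change (mnormalize (mrestr P mA) P B = (k%:E * P (B `&` A))%E).
  rewrite /mnormalize/= /mrestr setTI (negbTE PA0) ifF; first by rewrite muleC.
  by apply/negbTE; rewrite -ltey ltey_eq PAfin.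
have tP' : test_plan m P'.
  apply: (test_plan_dominated tP k0) => B mB; rewrite P'E.
  by apply: lee_wpmul2l; [rewrite lee_fin ltW|apply: le_measure; rewrite ?inE//; exact: measurableI].
have intP' (F : borel (curve Z) -> \bar R) : measurable_fun setT F -> (forall c, (0 <= F c)%E) ->
    (\int[P']_c F c = k%:E * \int[P]_(c in A) F c)%E.
  move=> mF F0.
  rewrite (@eq_measure_integral _ _ _ setT (mscale (NngNum (ltW k0)) (mrestr P mA))); last first.
    by move=> B mB _; exact: P'E.
  rewrite ge0_integral_mscale// ge0_integral_mrestr//.
  by rewrite setTI.
have := wug _ tP'; rewrite !intP'//.
rewrite lee_pmul2l ?lte_fin//.
apply/negP; rewrite -ltNge.
have JA : (\int[P]_(c in A) line_integral G c < +oo)%E.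
  apply: le_lt_trans (line_integral_fin tP G0 G2).
  by apply: ge0_subset_integral.
have Jfin c : A c -> line_integral G c \is a fin_num.
  move=> Ac; rewrite ge0_fin_numE//; exact: lt_trans Ac (ltry _).
(* Since line integrals have finite mean, the averaged inequality would force this excess, positive
   on [A], to have integral zero; then [A] would be null. *)
pose g c := ((D c)%:E - line_integral G c)%E.
have mg : measurable_fun A g.
  by apply: emeasurable_funB; exact: measurable_funTS.
have gpos c : A c -> (0 < g c)%E.
  by move=> Ac; rewrite /g sube_gt0.
have DE : (\int[P]_(c in A) (D c)%:E = \int[P]_(c in A) line_integral G c + \int[P]_(c in A) g c)%E.
  rewrite -ge0_integralD//; [|exact: measurable_funTS|by move=> c /gpos /ltW].
  apply: eq_integral => c; rewrite inE => Ac.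
  by rewrite /g addeC subeK// Jfin.
have JAfin : (\int[P]_(c in A) line_integral G c)%E \is a fin_num.
  by rewrite ge0_fin_numE//; apply: integral_ge0.
rewrite [X in (_ < X)%E]DE -[X in (X < _)%E]adde0 lteD2lE//.
rewrite lt0e; apply/andP; split; last by apply: integral_ge0 => c /gpos/ltW.
apply/eqP => g0.
have : (\int[P]_(c in A) `|g c| = 0)%E.
  by rewrite -g0; apply: eq_integral => c; rewrite inE => /gpos/ltW/gee0_abs.
rewrite ae_eq_integral_abs// => -[B [mB B0 AB]].
move: PA0; rewrite -measure_le0 -B0 => /negP; apply.
apply: le_measure; rewrite ?inE// => c Ac; apply: AB => /= /(_ Ac).
by have := gpos _ Ac; move=> /[swap] ->; rewrite ltxx.
Qed.

End conditioning.

(** * Curves stopped outside a subinterval *)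

Section clamp_real.
Context {R : realType}.
Implicit Types s t a b : R.

Lemma clamp_real_cases s t a : s <= t ->
  [/\ a <= s & Num.max s (Num.min t a) = s] \/
  [/\ s <= a, a <= t & Num.max s (Num.min t a) = a] \/
  [/\ t <= a & Num.max s (Num.min t a) = t].
Proof.
move=> st; have [sa|/ltW as'] := leP s a; last first.
  by left; split => //; rewrite min_r ?(le_trans as')// max_l.
right; have [at'|/ltW ta] := leP a t.
  by left; split => //; rewrite max_r.
by right; split => //; rewrite max_r.
Qed.

Lemma clamp_real_le s t a b : s <= t -> a <= b ->
  0 <= Num.max s (Num.min t b) - Num.max s (Num.min t a) <= b - a.
Proof.
move=> st ab; apply/andP.
have [[? ->]|[[? ? ->]|[? ->]]] := clamp_real_cases a st;
have [[? ->]|[[? ? ->]|[? ->]]] := clamp_real_cases b st; split; lra.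
Qed.

Lemma clamp_real_sub s t a b : s <= t -> a <= b ->
  Num.max s (Num.min t a) <> Num.max s (Num.min t b) ->
  a <= Num.max s (Num.min t a) /\ Num.max s (Num.min t b) <= b.
Proof.
move=> st ab.
have [[? ->]|[[? ? ->]|[? ->]]] := clamp_real_cases a st;
have [[? ->]|[[? ? ->]|[? ->]]] := clamp_real_cases b st => // ne; split; try lra;
by exfalso; apply: ne; lra.
Qed.

End clamp_real.

Section clamped_curves.
Context {R : realType} (Z : pmetricType R).
Local Notation leb := (citv_lebesgue (@itv01 R)).
Variables (s t : @itv01 R).
Hypothesis st : val s <= val t.

Definition clampst (r : @itv01 R) : @itv01 R :=
  clamp01 (Num.max (val s) (Num.min (val t) (val r))).

Lemma val_clampst r : val (clampst r) = Num.max (val s) (Num.min (val t) (val r)).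
Proof.
have /andP[s0 s1] := itv01P s; have /andP[t0 t1] := itv01P t.
rewrite clamp01K// le_max s0/= ge_max s1/= ge_min t1//.
Qed.

Lemma clampst_lip r r' : `|val (clampst r) - val (clampst r')| <= `|val r - val r'|.
Proof.
wlog rr' : r r' / val r <= val r'.
  move=> h; have [|yx] := leP (val r) (val r'); first exact: h.
  by rewrite distrC [leRHS]distrC; apply: h; exact: ltW.
rewrite distrC [leRHS]distrC [leRHS]ger0_norm ?subr_ge0// !val_clampst.
by have /andP[h1 h2] := clamp_real_le st rr'; rewrite ger0_norm.
Qed.

Lemma clampst_continuous (c : curve Z) : continuous (fun r => curve_fun c (clampst r)).
Proof.
move=> r A /nbhs_ballP[e /= e0 eA].
have [d d0 hd] := curve_fun_continuous c (clampst r) e0.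
apply/nbhs_ballP; exists d => // r' rr'; apply: eA; rewrite metric_ballP; apply: hd.
by apply: le_lt_trans (clampst_lip _ _) _; move: rr'; rewrite ball_itv01.
Qed.

Definition clamp_curve (c : curve Z) : curve Z := mkcts (@clampst_continuous c).

Lemma clamp_curveE c r : curve_fun (clamp_curve c) r = curve_fun c (clampst r).
Proof. by []. Qed.

Lemma clamp_curve_continuous : continuous clamp_curve.
Proof.
apply: curve_continuous => c e e0; have := curve_nbhs c e0.
by apply: (@filterS _ (nbhs c)) => c' h r; rewrite !clamp_curveE.
Qed.

Lemma clamp_curve_ac c p : ac_curve p (curve_fun c) -> ac_curve p (curve_fun (clamp_curve c)).
Proof.
move=> [g [g0 gp cg]]; exists g; split => // r r' rr'.
rewrite !clamp_curveE.
have [->|ne] := eqVneq (clampst r) (clampst r').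
  by rewrite mdistxx; apply: integral_ge0 => x _; rewrite lee_fin.
have ne' : val (clampst r) != val (clampst r') by apply: contra ne => /eqP/val_inj/eqP.
have le' : val (clampst r) <= val (clampst r').
  by rewrite !val_clampst -subr_ge0; have /andP[] := clamp_real_le st rr'.
apply: le_trans (cg _ _ le') _.
have mitv (a b : R) : measurable ([set r | (a <= val r <= b)%R] : set (borel (@itv01 R))).
  rewrite (_ : mkset _ = (val : borel itv01 -> R) @^-1` `[a, b]).
    by rewrite -[X in measurable X]setTI; exact: measurable_val_itv.
  by apply/seteqP; split => x /=; rewrite in_itv.
apply: ge0_subset_integral => //.
- apply: measurable_funTS; apply/measurable_EFinP.
  by move: gp; rewrite inE => /andP[/[!inE]].
- by move=> x _; rewrite lee_fin.
- have [h1 h2] : val r <= val (clampst r) /\ val (clampst r') <= val r'.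
    by move: ne'; rewrite !val_clampst => /eqP; exact: clamp_real_sub.
  by move=> x /= /andP[x1 x2]; rewrite (le_trans h1 x1) (le_trans x2 h2).
Qed.

Lemma mspeed_local (c c' : @itv01 R -> Z) r (e : R) : 0 < e ->
  (forall r', `|val r' - val r| < e -> c r' = c' r') -> mspeed c r = mspeed c' r.
Proof.
move=> e0 cc'.
have key (a b : @itv01 R -> Z) l : (forall r', `|val r' - val r| < e -> a r' = b r') ->
    has_mspeed a r l -> has_mspeed b r l.
  move=> ab ha e1 /ha[d d0 hd]; exists (Num.min d e); first by rewrite lt_min d0.
  move=> r'; rewrite lt_min => /andP[r0 /andP[rd re]].
  rewrite /speed_quotient -ab// -ab ?subrr ?normr0//; apply: hd.
  by rewrite r0.
have [[l hl]|h] := pselect (exists l, has_mspeed c r l).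
  by rewrite (mspeed_lim hl) (mspeed_lim (key _ _ _ cc' hl)).
rewrite !mspeed_dvg// => -[l hl]; apply: h; exists l; apply: key hl => r' /cc'.
by [].
Qed.

Lemma mspeed_cst (z : Z) r : mspeed (fun=> z) r = 0.
Proof.
apply: mspeed_lim => e e0; exists 1 => // r' _.
by rewrite /speed_quotient mdistxx mul0r subrr normr0 ltW.
Qed.

(** The two end times are excluded because the stopped curve may have a corner there. *)
Lemma mspeed_clamp c r : r != s -> r != t ->
  mspeed (curve_fun (clamp_curve c)) r =
  if val s < val r < val t then mspeed (curve_fun c) r else 0.
Proof.
move=> rs rt.
have ne (x y : @itv01 R) : x != y -> val x != val y.
  by apply: contra => /eqP/val_inj/eqP.
have {}rs := ne _ _ rs; have {}rt := ne _ _ rt.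
case: ifPn => [/andP[sr rt']|].
- apply: (@mspeed_local _ _ _ (Num.min (val r - val s) (val t - val r))).
    by rewrite lt_min !subr_gt0 sr.
  move=> r'; rewrite lt_min clamp_curveE => /andP[]; rewrite !ltr_norml => /andP[h1 h2] /andP[h3 h4].
  congr curve_fun; apply: val_inj; rewrite val_clampst.
  move: h1 h2 h3 h4; set a := val r; set b := val r'; set x := val s; set y := val t => *.
  by rewrite /Num.max /Num.min; repeat case: ifPn; rewrite -?leNgt => *; lra.
- rewrite negb_and -!leNgt => /orP[rs'|tr].
  + have rs2 : val r < val s by rewrite lt_neqAle rs.
    rewrite -[RHS](mspeed_cst (curve_fun c s) r).
    apply: (@mspeed_local _ _ _ (val s - val r)); first by rewrite subr_gt0.
    move=> r'; rewrite ltr_norml clamp_curveE => /andP[h1 h2].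
    congr curve_fun; apply: val_inj; rewrite val_clampst.
    move: st h1 h2; set a := val r; set b := val r'; set x := val s; set y := val t => *.
    by rewrite /Num.max /Num.min; repeat case: ifPn; rewrite -?leNgt => *; lra.
  + have rs2 : val t < val r by rewrite lt_neqAle eq_sym rt.
    rewrite -[RHS](mspeed_cst (curve_fun c t) r).
    apply: (@mspeed_local _ _ _ (val r - val t)); first by rewrite subr_gt0.
    move=> r'; rewrite ltr_norml clamp_curveE => /andP[h1 h2].
    congr curve_fun; apply: val_inj; rewrite val_clampst.
    move: st h1 h2; set a := val r; set b := val r'; set x := val s; set y := val t => *.
    by rewrite /Num.max /Num.min; repeat case: ifPn; rewrite -?leNgt => *; lra.
Qed.

Lemma ae_neq (r0 : @itv01 R) : \forall r \ae leb, r != r0.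
Proof.
apply/ae_itv01; exists [set val r0]; split => //.
- by rewrite lebesgue_measure_set1.
- move=> x /= /not_implyP[x01] /negP/negPn/eqP <-.
  by rewrite clamp01K.
Qed.

End clamped_curves.

Lemma inner_points01 {R : realFieldType} (s t h : R) : 0 <= s -> t <= 1 -> 0 < h -> 4 * h <= t - s ->
  0 <= s + h <= 1 /\ 0 <= t - h <= 1.
Proof. by move=> s0 t1 h0 hst; split; apply/andP; split; lra. Qed.

Lemma inner_points {R : realFieldType} (s t h i j : R) : 4 * h <= t - s ->
  `|i - (s + h)| < h -> `|j - (t - h)| < h ->
  [/\ i <= j, (s <= i) && (j <= t), `|s - i| < 4 * h & `|t - j| < 4 * h].
Proof.
rewrite !ltr_norml => hst /andP[i1 i2] /andP[j1 j2].
by split; first [lra|apply/andP; split; lra].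
Qed.

(** * Measurability of the class AC^2 *)

Section ac2_measurable.
Context {R : realType} (Z : pmetricType R).
Local Notation leb := (citv_lebesgue (@itv01 R)).
Local Notation mu := (@lebesgue_measure R).
Implicit Types (c : curve Z).

Lemma measurable_itv01_cc (a b : R) :
  measurable ([set r | (a <= val r <= b)%R] : set (borel (@itv01 R))).
Proof.
rewrite (_ : mkset _ = (val : borel itv01 -> R) @^-1` `[a, b]).
  by rewrite -[X in measurable X]setTI; exact: measurable_val_itv.
by apply/seteqP; split => x /=; rewrite in_itv.
Qed.

(** Makes the metric speed the canonical density, so that absolute continuity can be tested without
    quantifying over densities. *)
Lemma mspeed_ac c (g : borel (@itv01 R) -> R) :
  (forall r, 0 <= g r) -> g \in Lfun leb 1 ->
  (forall s t : @itv01 R, val s <= val t -> ((mdist (curve_fun c s) (curve_fun c t))%:E <=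
    \int[leb]_(r in [set r | (val s <= val r <= val t)%R]) (g r)%:E)%E) ->
  [/\ \forall r \ae leb, has_mspeed (curve_fun c) r (mspeed (curve_fun c) r),
    \forall r \ae leb, mspeed (curve_fun c) r <= g r &
    forall s t : @itv01 R, val s <= val t -> ((mdist (curve_fun c s) (curve_fun c t))%:E <=
    \int[leb]_(r in [set r | (val s <= val r <= val t)%R]) (mspeed (curve_fun c) r)%:E)%E].
Proof.
move=> g0 g1 cg; have acu := ac_curve_bound g0 g1 cg.
have [v [[[v0 iv] cv] vu hv]] := metric_speed acu.
have hvE : \forall x \ae mu, 0 < x < 1 ->
    has_mspeed (curve_fun c) (clamp01 x) (mspeed (curve_fun c) (clamp01 x)) /\
    mspeed (curve_fun c) (clamp01 x) = v x.
  by apply: ae_mono hv => x h /h h'; rewrite (mspeed_lim h').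
have key : \forall r \ae leb, has_mspeed (curve_fun c) r (mspeed (curve_fun c) r) /\
    mspeed (curve_fun c) r <= g r.
  have h01 := ae_and (ae_neq (@start01 R)) (ae_neq (@end01 R)).
  move/ae_itv01 : h01 => h01; apply/ae_itv01.
  apply: ae_mono (ae_and h01 hvE) => x [h1 h2] x01.
  have [n0 n1] := h1 x01; have /andP[x0 x1] := x01.
  have x0' : 0 < x.
    rewrite lt_neqAle x0 andbT; apply: contra n0 => /eqP <-; apply/eqP.
    exact: clamp01_0.
  have x1' : x < 1.
    rewrite lt_neqAle x1 andbT; apply: contra n1 => /eqP ->; apply/eqP.
    exact: clamp01_1.
  have [h3 h4] := h2 (introT andP (conj x0' x1')); split => //.
  by have := vu x; rewrite h4 patchE mem_set//= in_itv/= x0' ltW.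
split.
- by apply: ae_mono key => r [].
- by apply: ae_mono key => r [].
- move=> s t st; rewrite integral_itv01//; last 2 first.
  + by apply/measurable_EFinP; exact: measurable_mspeed1.
  + by move=> r; rewrite lee_fin mspeed_ge0.
  have := cv _ _ st; rewrite !val_clamp01K -lee_fin => h.
  apply: (le_trans h).
  rewrite /Rintegral fineK; last by apply: integrable_fin_num => //; exact: integrableS iv.
  apply: ae_ge0_le_integral => //.
  + by move=> x _; rewrite lee_fin.
  + by apply: measurable_funTS; case/integrableP : iv.
  + by move=> x _; rewrite lee_fin mspeed_ge0.
  + apply: measurable_funTS; apply/measurable_EFinP.
    apply: (measurableT_comp (measurable_mspeed1 c)); exact: measurable_clamp01.
  have /andP[s0 s1] := itv01P s; have /andP[t0 t1] := itv01P t.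
  have ne1 : \forall x \ae mu, x != 1.
    exists [set 1]; split => //; first by rewrite lebesgue_measure_set1.
    by move=> x /= /negP/negPn/eqP.
  apply: ae_mono (ae_and ne1 hvE) => x [x1 h2]; rewrite /= in_itv/= => /andP[sx xt].
  have x0 : 0 < x by exact: le_lt_trans sx.
  have x1' : x < 1 by rewrite lt_neqAle x1 (le_trans xt).
  by have [_ ->] := h2 (introT andP (conj x0 x1')).
Qed.

(** For a continuous curve, AC^2 means finite kinetic energy together with the admissibility of the
    speed between rational times, which are countably many measurable conditions. *)
Lemma measurable_ac2 :
  measurable ([set c | ac_curve 2%:E (curve_fun c)] : set (borel (curve Z))).
Proof.
have m2 : measurable_fun setT (fun p : borel (curve Z) * borel (@itv01 R) =>
    (mspeed (curve_fun p.1) p.2 ^+ 2)%:E).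
  by apply/measurable_EFinP; apply: measurable_funX; exact: measurable_mspeed.
have p2 p : (0 <= (mspeed (curve_fun (p : borel (curve Z) * borel (@itv01 R)).1) p.2 ^+ 2)%:E)%E by rewrite lee_fin sqr_ge0.
pose V (a b : R) (c : borel (curve Z)) := (\int[leb]_r ((mspeed (curve_fun c) r)%:E * (\1_[set r | (a <= val r <= b)%R] r)%:E))%E.
have V_E a b c : V a b c = (\int[leb]_(r in [set r | (a <= val r <= b)%R]) (mspeed (curve_fun c) r)%:E)%E.
  rewrite [RHS]integral_mkcond; apply: eq_integral => r _.
  by rewrite patchE indicE; case: ifP => _; rewrite ?mule1 ?mule0.
have mV a b : measurable_fun setT (V a b).
  apply: (@measurable_fun_fubini_tonelli_F _ _ _ _ _ leb
    (fun p : borel (curve Z) * borel (@itv01 R) => ((mspeed (curve_fun p.1) p.2)%:E * (\1_[set r | (a <= val r <= b)%R] p.2)%:E)%E)).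
    apply: emeasurable_funM; first by apply/measurable_EFinP; exact: measurable_mspeed.
    apply/measurable_EFinP; apply: (@measurableT_comp _ _ _ _ _ _ (\1_[set r | (a <= val r <= b)%R] : borel (@itv01 R) -> R)) => //.
    by apply: measurable_indic; exact: measurable_itv01_cc.
  by move=> p; rewrite mule_ge0// lee_fin ?mspeed_ge0.
rewrite (_ : mkset _ = [set c | (\int[leb]_t (mspeed (curve_fun c) t ^+ 2)%:E < +oo)%E] `&`
  \bigcap_i \bigcap_j [set c | val (@rat_point R i) <= val (@rat_point R j) ->
    ((mdist (curve_fun c (rat_point i)) (curve_fun c (rat_point j)))%:E <=
     V (val (rat_point i)) (val (rat_point j)) c)%E]); last first.
  apply/seteqP; split => c.
  - move=> /= ac2; have [g [g0 g2 cg]] := ac2.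
    have g1 : g \in Lfun leb 1 by apply: Lfun_subset12 g2; exact: fin_num_measure.
    have [_ mg cm] := mspeed_ac g0 g1 cg; split.
    + have /Lfun2P[mg' g2'] := g2; apply: le_lt_trans g2'; apply: ae_ge0_le_integral => //.
      * by move=> r _; rewrite lee_fin sqr_ge0.
      * by apply/measurable_EFinP; apply: measurable_funX; exact: measurable_mspeed1.
      * by move=> r _; rewrite lee_fin sqr_ge0.
      * by apply/measurable_EFinP; exact: measurable_funX.
      * apply: ae_mono mg => r h _; rewrite lee_fin ler_pXn2r ?nnegrE//; exact: mspeed_ge0.
    + by move=> i _ j _ /= ij; rewrite V_E; exact: cm.
  - move=> [i2 hq]; exists (mspeed (curve_fun c)); split.
    + by move=> r; exact: mspeed_ge0.
    + by apply/Lfun2P; split => //; exact: measurable_mspeed1.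
    + move=> s t; rewrite le_eqVlt => /predU1P[/val_inj ->|st].
        by rewrite mdistxx; apply: integral_ge0 => x _; rewrite lee_fin mspeed_ge0.
      have [/andP[s0 s1] /andP[t0 t1]] := (itv01P s, itv01P t).
      apply/lee_addgt0Pr => e e0; have e20 : 0 < e / 2 by rewrite divr_gt0.
      have [d1 d10 h1] := curve_fun_continuous c s e20.
      have [d2 d20 h2] := curve_fun_continuous c t e20.
      have [h h0 [hd1 hd2 hst]] : exists2 h : R, 0 < h &
          [/\ 4 * h <= d1, 4 * h <= d2 & 4 * h <= val t - val s].
        exists (Num.min (Num.min d1 d2) (val t - val s) / 4).
          by rewrite divr_gt0// !lt_min d10 d20 subr_gt0.
        rewrite mulrC divfK//; split.
        - by rewrite !ge_min lexx.
        - by rewrite !ge_min lexx orbT.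
        - by rewrite !ge_min lexx orbT.
      (* Rational times inside [s, t] and close to its ends: the integral between them is at most
         the integral over [s, t]. *)
      have [i hi] := rat_point_dense (clamp01 (val s + h)) h0.
      have [j hj] := rat_point_dense (clamp01 (val t - h)) h0.
      have [hs01 ht01] := inner_points01 s0 t1 h0 hst.
      move: hi hj; rewrite (clamp01K hs01) (clamp01K ht01) => hi hj.
      have [ij /andP[si jt] si4 tj4] := inner_points hst hi hj.
      have := hq i I j I ij; rewrite V_E => A.
      have B := h1 (rat_point i); have C := h2 (rat_point j).
      have {}B : mdist (curve_fun c s) (curve_fun c (rat_point i)) < e / 2.
        by apply: B; exact: lt_le_trans si4 hd1.
      have {}C : mdist (curve_fun c t) (curve_fun c (rat_point j)) < e / 2.
        by apply: C; exact: lt_le_trans tj4 hd2.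
      apply: (@le_trans _ _ (\int[leb]_(r in [set r | (val (@rat_point R i) <= val r <= val (@rat_point R j))%R]) (mspeed (curve_fun c) r)%:E + e%:E)%E).
        apply: le_trans (leeD A (lexx _)); rewrite -EFinD lee_fin.
        have := metric_triangle (curve_fun c s) (curve_fun c (rat_point i)) (curve_fun c t).
        have := metric_triangle (curve_fun c (rat_point i)) (curve_fun c (rat_point j)) (curve_fun c t).
        rewrite (metric_sym (curve_fun c (rat_point j))).
        by move: B C; clear; lra.
      apply: leeD => //; apply: ge0_subset_integral => //.
      * exact: measurable_itv01_cc.
      * exact: measurable_itv01_cc.
      * by apply: measurable_funTS; apply/measurable_EFinP; exact: measurable_mspeed1.
      * by move=> r _; rewrite lee_fin mspeed_ge0.
      * by move=> r; rewrite /mkset => /andP[r1 r2]; rewrite (le_trans si r1) (le_trans r2 jt).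
apply: measurableI.
  have := @measurable_fun_fubini_tonelli_F _ _ _ _ _ leb _ m2 p2 => h.
  rewrite -[X in measurable X]setTI; exact: emeasurable_fun_infty_o.
apply: bigcapT_measurable => i; apply: bigcapT_measurable => j.
have [ij|ij] := pselect (val (@rat_point R i) <= val (@rat_point R j)); last first.
  by rewrite (_ : mkset _ = setT)//; apply/seteqP; split => // c _ /= /ij.
rewrite (_ : mkset _ = [set c | ((mdist (curve_fun c (rat_point i)) (curve_fun c (rat_point j)))%:E <=
     V (val (rat_point i)) (val (rat_point j)) c)%E]); last first.
  by apply/seteqP; split => c /=; [exact|move=> h _].
have := @measurable_fun_lee _ _ _ setT (fun c : borel (curve Z) => (mdist (curve_fun c (rat_point i)) (curve_fun c (rat_point j)))%:E) (V (val (rat_point i)) (val (rat_point j))).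
move=> /(_ _ (mV _ _) measurableT [set true]); rewrite setTI; apply => //.
by apply/measurable_EFinP; exact: measurable_mdist_curve.
Qed.

End ac2_measurable.

Section clamped_plans.
Context {R : realType} (Z : pmetricType R) (m : {measure set (borel Z) -> \bar R}).
Local Notation leb := (citv_lebesgue (@itv01 R)).
Local Notation mu := (@lebesgue_measure R).
Variables (P : probability (borel (curve Z)) R) (tP : test_plan m P).
Implicit Types (f G : borel Z -> R).

Let mclamp (s t : @itv01 R) (st : val s <= val t) :
  measurable_fun setT (clamp_curve st : borel (curve Z) -> borel (curve Z)).
Proof. by apply: continuous_borel; exact: clamp_curve_continuous. Qed.

Lemma clamp_plan (s t : @itv01 R) (st : val s <= val t) :
  exists2 P' : probability (borel (curve Z)) R, test_plan m P' &
  forall B, P' B = P ((clamp_curve st : borel (curve Z) -> borel (curve Z)) @^-1` B).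
Proof.
pose Pm := measure_function_pushforward__canonical__measure_function_Measure P (mclamp st).
have PmE B : Pm B = P ((clamp_curve st : borel (curve Z) -> borel (curve Z)) @^-1` B) by [].
have PmT : Pm setT = 1%E by rewrite PmE preimage_setT; exact: probability_setT.
(* [Pm] has mass one; normalizing only packages it as a probability. *)
pose P' : probability (borel (curve Z)) R := mnormalize Pm P.
have P'E B : P' B = Pm B.
  change (mnormalize Pm P B = Pm B).
  by rewrite /mnormalize PmT/= onee_eq0/= invr1 mule1.
exists P'; last by move=> B; rewrite P'E.
have [[C C0 hC] ae2 e2] := tP.
have m2 : measurable_fun setT (fun p : borel (curve Z) * borel (@itv01 R) =>
    (mspeed (curve_fun p.1) p.2 ^+ 2)%:E).
  by apply/measurable_EFinP; apply: measurable_funX; exact: measurable_mspeed.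
have p2 p : (0 <= (mspeed (curve_fun (p : borel (curve Z) * borel (@itv01 R)).1) p.2 ^+ 2)%:E)%E by rewrite lee_fin sqr_ge0.
split.
- by exists C => // r A mA; rewrite /pushforward P'E PmE; exact: (hC (clampst s t r) A mA).
- exists (~` [set c | ac_curve 2%:E (curve_fun c)]); split => //.
    by apply: measurableC; exact: measurable_ac2.
  rewrite P'E PmE; have [A [mA A0 hA]] := ae2.
  apply/eqP; rewrite -measure_le0 -A0; apply: le_measure; rewrite ?inE//.
    rewrite -[X in measurable X]setTI; apply: (mclamp st) => //.
    by apply: measurableC; exact: measurable_ac2.
  by move=> c /= nac; apply: hA => /= ac; apply: nac; exact: clamp_curve_ac.
- apply: le_lt_trans e2; apply: ae_ge0_le_integral => //.
  + by move=> r _; apply: integral_ge0 => c _; rewrite lee_fin sqr_ge0.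
  + exact: (@measurable_fun_fubini_tonelli_G _ _ _ _ _ P' _ m2 p2).
  + by move=> r _; apply: integral_ge0 => c _; rewrite lee_fin sqr_ge0.
  + exact: (@measurable_fun_fubini_tonelli_G _ _ _ _ _ P _ m2 p2).
  apply: ae_mono (ae_and (ae_neq s) (ae_neq t)) => r [rs rt] _.
  have mr : measurable_fun setT (fun c : borel (curve Z) => (mspeed (curve_fun c) r ^+ 2)%:E).
    by apply/measurable_EFinP; apply: measurable_funX; exact: measurable_mspeed2.
  have nn (c : borel (curve Z)) : (0 <= (mspeed (curve_fun c) r ^+ 2)%:E)%E.
    by rewrite lee_fin sqr_ge0.
  have -> := @ge0_integral_push _ _ _ _ _ P P' _ _ (mclamp st) (fun A _ => P'E A) mr nn.
  apply: ge0_le_integral => //.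
  + exact: measurableT_comp mr (mclamp st).
  + move=> c _; rewrite mspeed_clamp//; case: ifP => // _.
    by rewrite expr0n/= lee_fin sqr_ge0.
Qed.

(** The running line integral. Its value may be infinite, so inequalities between its increments are
    written without subtraction. *)
Definition upto G (p : (borel (curve Z) * borel (@itv01 R))%type) : \bar R :=
  (\int[leb]_r (if val r <= val p.2 then curve_integrand G (p.1, r) else 0)%:E)%E.

Let measurable_upto_integrand G : measurable_fun setT G ->
  measurable_fun setT (fun q : (borel (curve Z) * borel (@itv01 R)) * borel (@itv01 R) =>
    (if val q.2 <= val q.1.2 then curve_integrand G (q.1.1, q.2) else 0)%:E).
Proof.
move=> mG; apply/measurable_EFinP; apply: measurable_fun_ifT => //.
- apply: measurable_fun_ler.
    by apply: (@measurableT_comp _ _ _ _ _ _ (val : borel (@itv01 R) -> R)) => //; exact: measurable_val_itv.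
  apply: (@measurableT_comp _ _ _ _ _ _ (val : borel (@itv01 R) -> R)); first exact: measurable_val_itv.
  by apply: measurableT_comp => //; exact: measurable_snd.
- apply: (@measurableT_comp _ _ _ _ _ _ (curve_integrand G) _
    (fun q : (borel (curve Z) * borel (@itv01 R)) * borel (@itv01 R) => (q.1.1, q.2))).
    exact: measurable_curve_integrand.
  apply: measurable_fun_pair => //.
  by apply: measurableT_comp => //; exact: measurable_fst.
Qed.

Lemma measurable_upto G : (forall z, 0 <= G z) -> measurable_fun setT G ->
  measurable_fun setT (upto G).
Proof.
move=> G0 mG; apply: (@measurable_fun_fubini_tonelli_F _ _ _ _ _ leb _ (measurable_upto_integrand mG)).
by move=> q; rewrite lee_fin; case: ifP => // _; exact: curve_integrand_ge0.
Qed.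

(* The plan of the curves stopped outside [[s, t]] is again a test plan. *)
Lemma weak_upper_gradient_pair f G (s t : @itv01 R) : measurable_fun setT f ->
  weak_upper_gradient m f G -> val s <= val t ->
  \forall c \ae P, (`|f (eval_at t c) - f (eval_at s c)|%:E + upto G (c, s) <= upto G (c, t))%E.
Proof.
move=> mf wug st; have [G0 /Lfun2P[mG _] _] := wug.
have [P' tP' P'E] := clamp_plan st.
have [A [mA A0 hA]] := weak_upper_gradient_ae mf wug tP'.
exists ((clamp_curve st : borel (curve Z) -> borel (curve Z)) @^-1` A); split.
- by rewrite -[X in measurable X]setTI; exact: mclamp.
- by rewrite -A0; exact/esym/P'E.
move=> c /= nc; apply: hA => /= hc; apply: nc.
have [/andP[s0 s1] /andP[t0 t1]] := (itv01P s, itv01P t).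
have e1 : eval_at end01 (clamp_curve st c) = eval_at t c.
  rewrite /eval_at clamp_curveE; congr curve_fun; apply: val_inj; rewrite val_clampst//.
  by rewrite [X in Num.min _ X](_ : _ = 1)// min_l// max_r.
have e0 : eval_at start01 (clamp_curve st c) = eval_at s c.
  rewrite /eval_at clamp_curveE; congr curve_fun; apply: val_inj; rewrite val_clampst//.
  by rewrite [X in Num.min _ X](_ : _ = 0)// min_r// max_l.
have {hc} : (`|f (eval_at end01 (clamp_curve st c)) - f (eval_at start01 (clamp_curve st c))|%:E <=
  line_integral G (clamp_curve st c))%E := hc.
rewrite e1 e0 => hc.
have mct (c' : borel (curve Z)) :
    measurable_fun setT (fun r : borel (@itv01 R) => (curve_integrand G (c', r))%:E).
  apply/measurable_EFinP.
  exact: measurableT_comp (measurable_curve_integrand mG) (pair1_measurable c').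
have mup (t' : borel (@itv01 R)) : measurable_fun setT (fun r : borel (@itv01 R) => (if val r <= val t' then curve_integrand G (c, r) else 0)%:E).
  exact: measurableT_comp (measurable_upto_integrand mG) (pair1_measurable (c, t')).
apply: (@le_trans _ _ (line_integral G (clamp_curve st c) + upto G (c, s))%E).
  by apply: leeD.
have mcl := mct (clamp_curve st c).
rewrite /line_integral /upto -ge0_integralD//; [|by move=> r _; rewrite lee_fin curve_integrand_ge0|by move=> r _; rewrite lee_fin; case: ifP => // _; exact: curve_integrand_ge0].
apply: ae_ge0_le_integral => //.
- by move=> r _; rewrite -EFinD lee_fin addr_ge0//; [exact: curve_integrand_ge0|case: ifP => // _; exact: curve_integrand_ge0].
- by apply: emeasurable_funD => //; exact: mup.
- by move=> r _; rewrite lee_fin; case: ifP => // _; exact: curve_integrand_ge0.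
apply: ae_mono (ae_and (ae_neq s) (ae_neq t)) => r [rs rt] _.
have -> : curve_integrand G (clamp_curve st c, r) =
    if val s < val r < val t then curve_integrand G (c, r) else 0.
  rewrite /curve_integrand (mspeed_clamp st c rs rt); case: ifPn => [/andP[sr rt']|_]; last by rewrite mulr0.
  rewrite [(_, _).2]/= [(_, _).1]/= clamp_curveE (_ : clampst s t r = r)//.
  by apply: val_inj; rewrite val_clampst// min_r ?max_r// ltW.
rewrite -EFinD lee_fin; case: ifPn => [/andP[sr rt']|nst].
  by rewrite ifF ?addr0 ?(ltW rt')//; apply/negbTE; rewrite -ltNge.
rewrite add0r; case: ifPn => rs'.
  by rewrite (le_trans rs' st).
by case: ifP => // _; exact: curve_integrand_ge0.
Qed.

End clamped_plans.

(** McShane extension, the infimum over i of [F i + |v x - v (q i)|], for the pseudometric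
    [|v x - v y|]. At a point approximated by the [q i] in this pseudometric, a compatible value is
    the only possible one. *)
Lemma lipschitz_extension (R : realType) (v : R -> R) (q F : nat -> R) :
  (forall i j, `|F i - F j| <= `|v (q i) - v (q j)|) ->
  exists a : R -> R, (forall x y, `|a x - a y| <= `|v x - v y|) /\
    forall x y, (forall i, `|y - F i| <= `|v x - v (q i)|) ->
      (forall e : R, 0 < e -> exists i, `|v x - v (q i)| < e) -> a x = y.
Proof.
move=> hF.
pose S x := range (fun i => F i + `|v x - v (q i)|).
have S0 x : S x !=set0 by exists (F 0%N + `|v x - v (q 0%N)|); exists 0%N.
have Slb x : lbound (S x) (F 0%N - `|v x - v (q 0%N)|).
  move=> _ [i _ <-]; have := hF 0%N i; have := ler_distD (v x) (v (q 0%N)) (v (q i)).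
  by rewrite (distrC (v (q 0%N)) (v x)) => h1 h2; have h3 := le_trans h2 h1; have := ler_norm (F 0%N - F i); lra.
have hS x : has_inf (S x) by split => //; exists (F 0%N - `|v x - v (q 0%N)|).
have key x y : inf (S x) <= inf (S y) + `|v x - v y|.
  rewrite -lerBlDr; apply: lb_le_inf => // _ [i _ <-]; rewrite lerBlDr.
  apply: (@le_trans _ _ (F i + `|v x - v (q i)|)).
    by apply: ge_inf; [case: (hS x)|exists i].
  by rewrite -addrA lerD2l addrC; exact: ler_distD.
exists (fun x => inf (S x)); split => [x y|x y hy hd].
  rewrite ler_norml; apply/andP; split; last by rewrite lerBlDl; exact: key.
  by have := key y x; rewrite distrC; lra.
apply: le_anti; apply/andP; split.
- apply/ler_addgt0Pr => e e0.
  have [i hi] := hd (e / 2) (divr_gt0 e0 (ltr0n _ 2)).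
  apply: (@le_trans _ _ (F i + `|v x - v (q i)|)).
    by apply: ge_inf; [case: (hS x)|exists i].
  by have := hy i; rewrite ler_norml => /andP[h _]; lra.
- apply: lb_le_inf => // _ [i _ <-].
  by have := hy i; rewrite ler_norml => /andP[_ h]; lra.
Qed.

(** * Absolutely continuous representatives along almost every curve *)

Section ac_representatives.
Context {R : realType} (Z : pmetricType R) (m : {measure set (borel Z) -> \bar R}).
Local Notation leb := (citv_lebesgue (@itv01 R)).
Local Notation mu := (@lebesgue_measure R).
Variables (P : probability (borel (curve Z)) R) (tP : test_plan m P).
Implicit Types (f G : borel Z -> R).

Definition curve_density G (c : borel (curve Z)) : R -> R :=
  (fun x : R => curve_integrand G (c, clamp01 x)) \_ `]0, 1]%classic.

Let mcurve G c : measurable_fun setT G ->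
  measurable_fun setT (fun r : borel (@itv01 R) => (curve_integrand G (c, r))%:E).
Proof.
move=> mG; apply/measurable_EFinP.
exact: measurableT_comp (measurable_curve_integrand mG) (pair1_measurable c).
Qed.

Lemma curve_density_ge0 G c x : (forall z, 0 <= G z) -> 0 <= curve_density G c x.
Proof. by move=> G0; rewrite /curve_density patchE; case: ifP => // _; exact: curve_integrand_ge0. Qed.

Lemma curve_densityE G c x : 0 < x <= 1 -> curve_density G c x = curve_integrand G (c, clamp01 x).
Proof. by move=> x01; rewrite /curve_density patchE mem_set//= in_itv/=. Qed.

Lemma measurable_curve_density G c : measurable_fun setT G ->
  measurable_fun setT (curve_density G c).
Proof.
move=> mG; apply/(measurable_restrictT _ (measurable_itv _)); apply: measurable_funTS.
apply: (@measurableT_comp _ _ _ _ _ _ (fun r : borel (@itv01 R) => curve_integrand G (c, r)) _ (@clamp01 R : R -> borel itv01)).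
  by apply/measurable_EFinP; exact: mcurve.
exact: measurable_clamp01.
Qed.

Lemma line_integralE G c : (forall z, 0 <= G z) -> measurable_fun setT G ->
  line_integral G c = (\int[mu]_x (curve_density G c x)%:E)%E.
Proof.
move=> G0 mG; rewrite /line_integral integral_itv01T//; last 2 first.
- exact: mcurve.
- by move=> r; rewrite lee_fin curve_integrand_ge0.
rewrite integral_mkcond; apply: eq_integral => x _.
by rewrite /curve_density !patchE; case: ifP.
Qed.

Lemma density_curve_density G c : (forall z, 0 <= G z) -> measurable_fun setT G ->
  (line_integral G c < +oo)%E -> density (curve_density G c).
Proof.
move=> G0 mG fin; split => [x|]; first exact: curve_density_ge0.
apply/ge0_integrableP => [x|]; first exact: curve_density_ge0.
by split; [exact: measurable_curve_density|rewrite -line_integralE].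
Qed.

Lemma upto_primitive G c t : (forall z, 0 <= G z) -> measurable_fun setT G ->
  (line_integral G c < +oo)%E -> upto G (c, t) = (primitive (curve_density G c) (val t))%:E.
Proof.
move=> G0 mG fin; have [_ id] := density_curve_density G0 mG fin.
rewrite /primitive /Rintegral fineK; last first.
  by apply: integrable_fin_num => //; exact: integrableS id.
transitivity (\int[leb]_(r in [set r | (val (@start01 R) <= val r <= val t)%R]) (curve_integrand G (c, r))%:E)%E.
  rewrite /upto [RHS]integral_mkcond; apply: eq_integral => r _.
  rewrite patchE; have /andP[r0 _] := itv01P r.
  case: ifPn => rt; first by rewrite mem_set//= r0.
  by rewrite memNset//= => /andP[_]; exact/negP.
have /andP[t0 t1] := itv01P t.
rewrite integral_itv01//; last 2 first.
- exact: mcurve.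
- by move=> r; rewrite lee_fin curve_integrand_ge0.
rewrite [LHS]integral_mkcond [RHS]integral_mkcond; apply: eq_integral => x _.
rewrite !patchE; have [x0|x0] := ltP 0 x; last first.
  rewrite memNset/= ?in_itv/= ?ltNge ?x0//.
  by rewrite /curve_density patchE (memNset (A := `]0, 1]%classic))/= ?in_itv/= ?ltNge ?x0//; case: ifP.
have [xt|xt] := leP x (val t); last first.
  by rewrite !memNset//= in_itv/= (leNgt x) xt ?andbF.
rewrite !mem_set/= ?in_itv/= ?xt ?x0// curve_densityE// x0.
exact: le_trans xt t1.
Qed.

(** The stopped plans bound increments between two fixed times, for almost every curve. By Tonelli,
    almost every curve satisfies the bound between almost every time and every rational one; the
    function is then extended from the rational times by the McShane formula. *)
Lemma ac_representative f G : measurable_fun setT f -> weak_upper_gradient m f G ->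
  \forall c \ae P, density (curve_density G c) /\ exists a : R -> R,
    [/\ ac_with (curve_density G c) a, a 0 = f (eval_at start01 c),
        a 1 = f (eval_at end01 c) &
        \forall x \ae mu, 0 <= x <= 1 -> a x = f (curve_fun c (clamp01 x))].
Proof.
move=> mf wug; have [G0 G2 _] := wug; have /Lfun2P[mG _] := G2.
(* One alternative for each order of the time and the rational time. *)
pose good (i : nat) : set (borel (curve Z) * borel (@itv01 R)) := [set p |
  (`|f (curve_fun p.1 p.2) - f (curve_fun p.1 (rat_point i))|%:E + upto G (p.1, rat_point i) <= upto G p)%E] `|`
  [set p | (`|f (curve_fun p.1 p.2) - f (curve_fun p.1 (rat_point i))|%:E + upto G p <= upto G (p.1, rat_point i))%E].
have mD i : measurable_fun setT (fun p : borel (curve Z) * borel (@itv01 R) =>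
    `|f (curve_fun p.1 p.2) - f (curve_fun p.1 (rat_point i))|%:E).
  apply/measurable_EFinP; apply: measurableT_comp => //; apply: measurable_funB.
    exact: measurable_eval_comp.
  apply: (@measurableT_comp _ _ _ _ _ _ (fun c : borel (curve Z) => f (eval_at (rat_point i) c))).
    by apply: (@measurableT_comp _ _ _ _ _ _ f) => //; exact: measurable_eval_at.
  exact: measurable_fst.
have mU := measurable_upto G0 mG.
have mUi i : measurable_fun setT (fun p : borel (curve Z) * borel (@itv01 R) => upto G (p.1, rat_point i)).
  apply: (@measurableT_comp _ _ _ _ _ _ (upto G)) => //.
  by apply: measurable_fun_pair => //; exact: measurable_fst.
have mle (g h : borel (curve Z) * borel (@itv01 R) -> \bar R) : measurable_fun setT g -> measurable_fun setT h ->
    measurable [set p | (g p <= h p)%E].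
  move=> mg mh; have := @measurable_fun_lee _ _ _ setT _ _ mg mh measurableT [set true].
  by rewrite setTI; apply.
have mgood i : measurable (good i).
  by apply: measurableU; apply: mle; [exact: emeasurable_funD|exact: mU|exact: emeasurable_funD|exact: mUi].
have pair i t : \forall c \ae P, good i (c, t).
  have [ti|/ltW it] := leP (val t) (val (@rat_point R i)).
    have := weak_upper_gradient_pair tP mf wug ti; apply: ae_mono => c h; right.
    by rewrite /= distrC.
  by have := weak_upper_gradient_pair tP mf wug it; apply: ae_mono => c h; left.
have aegood : \forall c \ae P, forall i, \forall t \ae leb, good i (c, t).
  apply: ae_nat => i; apply/(ae_swap P leb (mgood i)); exact: aeW.
(* Tonelli controls almost all times only; the two ends and the rational times are needed exactly,
   and they are countably many fixed times. *)
have aepts : \forall c \ae P, forall i, [/\ good i (c, start01), good i (c, end01) & forall j, good i (c, rat_point j)].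
  by apply: ae_nat => i; apply: ae_and3; [exact: pair|exact: pair|apply: ae_nat => j; exact: pair].
have aefin : \forall c \ae P, (line_integral G c < +oo)%E.
  have mL := measurable_line_integral G0 mG.
  have : P.-integrable setT (line_integral G).
    apply/integrableP; split => //; under eq_integral do rewrite gee0_abs ?line_integral_ge0//.
    exact: (line_integral_fin tP G0 G2).
  move=> /(integrable_ae measurableT); apply: ae_mono => c /(_ I).
  by rewrite ge0_fin_numE// line_integral_ge0.
apply: ae_mono (ae_and3 aegood aepts aefin) => c [gc pc fc].
have dc := density_curve_density G0 mG fc; split => //.
have [_ id] := dc; set u := curve_density G c in dc id *; pose v := primitive u.
have goodP i (t : @itv01 R) : good i (c, t) -> `|f (curve_fun c t) - f (curve_fun c (rat_point i))| <=
    `|v (val t) - v (val (rat_point i))|.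
  rewrite /good/= !upto_primitive// -!EFinD !lee_fin -/u -/v => -[h|h].
    by apply: le_trans (ler_norm _); rewrite lerBrDr.
  by rewrite [leRHS]distrC; apply: le_trans (ler_norm _); rewrite lerBrDr.
have [a [av aE]] := @lipschitz_extension R v (fun i => val (rat_point i)) (fun i => f (curve_fun c (rat_point i)))
  (fun i j => goodP j _ ((let: And3 _ _ h := pc j in h) i)).
have vdense (t : @itv01 R) : forall e : R, 0 < e -> exists i, `|v (val t) - v (val (@rat_point R i))| < e.
  move=> e e0; have /cvgrPdist_lt/(_ e e0)/nbhs_ballP[d /= d0 hd] := @primitive_continuous _ u id (val t).
  have [i hi] := rat_point_dense t d0; exists i; apply: hd.
  by rewrite /ball/= distrC.
have aT (t : @itv01 R) : (forall i, good i (c, t)) -> a (val t) = f (curve_fun c t).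
  by move=> h; apply: aE => [i|]; [apply: goodP|exact: vdense].
exists a; split.
- by move=> s t st; apply: le_trans (av _ _) _; rewrite primitiveB// ger0_norm// Rintegral_ge0// => r _; exact: dc.1.
- by have := aT start01; apply => i; case: (pc i).
- by have := aT end01; apply => i; case: (pc i).
- have : \forall t \ae leb, forall i, good i (c, t) by exact: ae_nat.
  move/ae_itv01; apply: ae_mono => x h x01; rewrite -[in LHS](clamp01K x01).
  by apply: aT; exact: h.
Qed.

End ac_representatives.

(** * Truncations *)

Section slope_bounds.
Context {R : realType}.
Implicit Types (F G : R -> R) (x A B : R).

(** An upper bound for the pointwise Lipschitz constant at [x]. It replaces the derivative for terms
    that need not be differentiable, such as a cutoff composed with a curve. *)
Definition slope_bound F x A := forall e : R, 0 < e -> exists2 d : R, 0 < d &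
  forall y, `|y - x| < d -> `|F y - F x| <= (A + e) * `|y - x|.

Lemma slope_bound_slope F x l : has_slope F x l -> slope_bound F x `|l|.
Proof.
move=> h e /h[d d0 hd]; exists d => // y /hd h'.
have -> : F y - F x = (F y - F x - l * (y - x)) + l * (y - x) by ring.
by apply: (le_trans (ler_normD _ _)); rewrite normrM mulrDl addrC lerD2l.
Qed.

Lemma slope_bound_le F x l A : has_slope F x l -> slope_bound F x A -> `|l| <= A.
Proof.
move=> hl hA; apply/ler_addgt0Pr => e e0; have e20 : 0 < e / 2 by rewrite divr_gt0.
have [d1 d10 h1] := hl _ e20; have [d2 d20 h2] := hA _ e20.
pose y := x + Num.min d1 d2 / 2.
have m0 : 0 < Num.min d1 d2 by rewrite lt_min d10.
have yx : `|y - x| = Num.min d1 d2 / 2 by rewrite /y addrC addKr ger0_norm// divr_ge0// ltW.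
have ylt : `|y - x| < Num.min d1 d2 by rewrite yx; lra.
move: ylt; rewrite lt_min => /andP[/h1 {}h1 /h2 {}h2].
have y0 : 0 < `|y - x| by rewrite yx divr_gt0.
rewrite -(ler_pM2r y0) -normrM.
have -> : l * (y - x) = (F y - F x) - (F y - F x - l * (y - x)) by ring.
apply: (le_trans (ler_normB _ _)); lra.
Qed.

Lemma slope_boundD F G x A B : slope_bound F x A -> slope_bound G x B ->
  slope_bound (fun y => F y + G y) x (A + B).
Proof.
move=> hF hG e e0; have e20 : 0 < e / 2 by rewrite divr_gt0.
have [d1 d10 h1] := hF _ e20; have [d2 d20 h2] := hG _ e20.
exists (Num.min d1 d2); first by rewrite lt_min d10.
move=> y; rewrite lt_min => /andP[/h1 {}h1 /h2 {}h2].
have -> : F y + G y - (F x + G x) = (F y - F x) + (G y - G x) by ring.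
apply: (le_trans (ler_normD _ _)); lra.
Qed.

(** As [F] vanishes at [x], the increment of [G] enters only at higher order and continuity of [G]
    suffices. Applied to the difference of a cutoff and its value at [x]. *)
Lemma slope_boundM0 F G x A : 0 <= A -> F x = 0 -> slope_bound F x A ->
  {for x, continuous G} -> slope_bound (fun y => F y * G y) x (A * `|G x|).
Proof.
move=> A0 F0 hF cG e e0.
pose e1 := Num.min 1 (e / 2 / (A + 1)).
have e10 : 0 < e1 by rewrite lt_min ltr01 !divr_gt0// ltr_wpDl.
pose e2 := e / 2 / (`|G x| + 1).
have e20 : 0 < e2 by rewrite !divr_gt0// ltr_wpDl.
have [d1 d10 h1] := hF _ e20.
move/cvgrPdist_lt/(_ e1 e10)/nbhs_ballP : cG => [d2 /= d20 h2].
exists (Num.min d1 d2); first by rewrite lt_min d10.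
move=> y; rewrite lt_min => /andP[/h1 {}h1 yd2].
have {}h2 : `|G x - G y| < e1 by apply: h2; rewrite /ball/= distrC.
rewrite F0 mul0r subr0 normrM.
move: h1; rewrite F0 subr0 => h1.
have h3 : `|G y| <= `|G x| + e1.
  have -> : G y = G x - (G x - G y) by ring.
  by apply: (le_trans (ler_normB _ _)); rewrite lerD2l ltW.
apply: (le_trans (ler_pM (normr_ge0 _) (normr_ge0 _) h1 h3)).
rewrite mulrAC; apply: ler_wpM2r => //.
have h4 : A * e1 <= e / 2.
  apply: (@le_trans _ _ ((A + 1) * (e / 2 / (A + 1)))); last by rewrite mulrC divfK// gt_eqF// ltr_wpDl.
  apply: ler_pM => //; [exact: ltW|lra|by rewrite ge_min lexx orbT].
have h5 : e2 * (`|G x| + e1) <= e / 2.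
  apply: (@le_trans _ _ (e2 * (`|G x| + 1))); last by rewrite divfK// gt_eqF// ltr_wpDl.
  by apply: ler_wpM2l; [exact: ltW|rewrite lerD2l ge_min lexx].
by rewrite mulrDl !mulrDr; rewrite mulrDr in h5; lra.
Qed.

Lemma slope_bound_near F G x A : (exists2 d : R, 0 < d & forall y, `|y - x| < d -> F y = G y) ->
  slope_bound F x A -> slope_bound G x A.
Proof.
move=> [d0 d00 FG] hF e /hF[d d0' hd]; exists (Num.min d0 d); first by rewrite lt_min d00.
move=> y; rewrite lt_min => /andP[y0 /hd]; rewrite !FG//.
by rewrite subrr normr0.
Qed.

Lemma has_slope_continuous F x l : has_slope F x l -> {for x, continuous F}.
Proof.
move=> /has_slope_lip[d d0 hd]; apply/cvgrPdist_lt => e e0.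
have l0 : 0 < `|l| + 1 by rewrite ltr_wpDl.
apply/nbhs_ballP; exists (Num.min d (e / (`|l| + 1))); first by rewrite /= lt_min d0 divr_gt0.
move=> y; rewrite /ball/= distrC lt_min => /andP[/hd h1 h2].
rewrite distrC; apply: (le_lt_trans h1).
by rewrite -ltr_pdivlMl// mulrC.
Qed.

End slope_bounds.

Section speed_bounds.
Context {R : realType} (Z : pmetricType R).

(** A bound valid exactly on a small ball, without an error term: it suits piecewise linear cutoffs,
    where [k] may jump at the kinks. *)
Definition pt_slope (eta k : Z -> R) := forall z, exists2 d : R, 0 < d &
  forall z', mdist z' z < d -> `|eta z' - eta z| <= k z * mdist z' z.

Lemma has_mspeed_dist (c : @itv01 R -> Z) (x s : R) : 0 < x < 1 ->
  has_mspeed c (clamp01 x) s -> forall e : R, 0 < e -> exists2 d : R, 0 < d &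
  forall y, `|y - x| < d -> mdist (c (clamp01 y)) (c (clamp01 x)) <= (s + e) * `|y - x|.
Proof.
move=> /andP[x0 x1] hs e /hs[d d0 hd].
exists (Num.min d (Num.min x (1 - x))); first by rewrite !lt_min d0 x0/= subr_gt0.
move=> y; rewrite !lt_min => /and3P[yd yx y1x].
have y01 : 0 <= y <= 1.
  by move: yx y1x; rewrite !ltr_norml => /andP[? ?] /andP[? ?]; apply/andP; split; lra.
have x01 : 0 <= x <= 1 by rewrite !ltW.
have [->|yx0] := eqVneq y x; first by rewrite mdistxx subrr normr0 mulr0.
have n0 : 0 < `|y - x| by rewrite normr_gt0 subr_eq0.
have := hd (clamp01 y); rewrite /speed_quotient !clamp01K// n0 yd => /(_ isT).
rewrite ler_norml => /andP[_]; rewrite lerBlDr ler_pdivrMr//.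
by rewrite addrC.
Qed.

Lemma has_mspeed_slope_bound (c : @itv01 R -> Z) (eta k : Z -> R) (x s : R) : 0 < x < 1 -> 0 <= s ->
  (forall z, 0 <= k z) -> pt_slope eta k ->
  has_mspeed c (clamp01 x) s -> slope_bound (fun y => eta (c (clamp01 y))) x (k (c (clamp01 x)) * s).
Proof.
move=> x01 s0 k0 hk hs e e0; set K := k (c (clamp01 x)).
have K0 : 0 <= K by exact: k0.
have K1 : 0 < K + 1 by rewrite ltr_wpDl.
have [d1 d10 h1] := hk (c (clamp01 x)).
have [d2 d20 h2] := has_mspeed_dist x01 hs (divr_gt0 e0 K1).
have s1 : 0 < s + e / (K + 1) by rewrite ltr_wpDl// divr_gt0.
exists (Num.min d2 (d1 / (s + e / (K + 1)))); first by rewrite lt_min d20 divr_gt0.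
move=> y; rewrite lt_min => /andP[/h2 {}h2 yd].
apply: le_trans (h1 _ _) _; first by apply: (le_lt_trans h2); rewrite -ltr_pdivlMl// mulrC.
apply: (@le_trans _ _ (K * ((s + e / (K + 1)) * `|y - x|))); first exact: ler_wpM2l.
rewrite mulrA ler_wpM2r// mulrDr lerD2l mulrCA ger_pMr//.
by rewrite ler_pdivrMr// mul1r; lra.
Qed.

End speed_bounds.

(** * Calculus of weak upper gradients *)

Section wug_calculus.
Context {R : realType} (Z : pmetricType R) (m : {measure set (borel Z) -> \bar R}).
Local Notation leb := (citv_lebesgue (@itv01 R)).
Local Notation mu := (@lebesgue_measure R).
Implicit Types (f G k : borel Z -> R).

Lemma weak_upper_gradientI f G : measurable_fun setT f -> (forall z, 0 <= G z) ->
  G \in Lfun m 2%:E ->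
  (forall P, test_plan m P -> \forall c \ae P,
    (`|f (eval_at end01 c) - f (eval_at start01 c)|%:E <= line_integral G c)%E) ->
  weak_upper_gradient m f G.
Proof.
move=> mf G0 G2 h; split => // P tP; have /Lfun2P[mG _] := G2.
have mev t : measurable_fun setT (fun c => f (eval_at t c)).
  by apply: (@measurableT_comp _ _ _ _ _ _ f) => //; exact: measurable_eval_at.
apply: ae_ge0_le_integral => //.
- by apply/measurable_EFinP; apply: measurableT_comp => //; exact: measurable_funB.
- by move=> c _; exact: line_integral_ge0.
- exact: measurable_line_integral.
- by have := h P tP; apply: ae_mono => c hc _.
Qed.

Lemma Lfun2_le f G : measurable_fun setT f -> (forall z, `|f z| <= G z) ->
  G \in Lfun m 2%:E -> f \in Lfun m 2%:E.
Proof.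
move=> mf fG /Lfun2P[mG G2]; apply/Lfun2P; split => //; apply: le_lt_trans G2.
apply: ge0_le_integral => //.
- by move=> z _; rewrite lee_fin sqr_ge0.
- by apply/measurable_EFinP; exact: measurable_funX.
- by apply/measurable_EFinP; exact: measurable_funX.
- move=> z _; rewrite lee_fin -[f z ^+ 2]real_normK ?num_real// ler_pXn2r ?nnegrE//.
  exact: le_trans (fG z).
Qed.

Lemma Lfun2D f G : f \in Lfun m 2%:E -> G \in Lfun m 2%:E -> (fun z => f z + G z) \in Lfun m 2%:E.
Proof.
move=> /Lfun2P[mf f2] /Lfun2P[mG G2]; apply/Lfun2P; split; first exact: measurable_funD.
have mf2 : measurable_fun setT (fun z => (f z ^+ 2)%:E) by apply/measurable_EFinP; exact: measurable_funX.
have mG2 : measurable_fun setT (fun z => (G z ^+ 2)%:E) by apply/measurable_EFinP; exact: measurable_funX.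
apply: (@le_lt_trans _ _ (\int[m]_z (2%:E * ((f z ^+ 2)%:E + (G z ^+ 2)%:E)))%E).
  apply: ge0_le_integral => //.
  - by move=> z _; rewrite lee_fin sqr_ge0.
  - by apply/measurable_EFinP; apply: measurable_funX; exact: measurable_funD.
  - by apply: measurable_funeM; exact: emeasurable_funD.
  - by move=> z _; rewrite -EFinD -EFinM lee_fin; exact: sqrD_le.
rewrite ge0_integralZl//; [|exact: emeasurable_funD|by move=> z _; rewrite -EFinD lee_fin addr_ge0 ?sqr_ge0].
rewrite ge0_integralD//; try by move=> z _; rewrite lee_fin sqr_ge0.
by rewrite lte_mul_pinfty// lte_add_pinfty.
Qed.

Lemma Lfun2Z (a : R) f : f \in Lfun m 2%:E -> (fun z => a * f z) \in Lfun m 2%:E.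
Proof.
move=> /Lfun2P[mf f2]; apply/Lfun2P; split; first exact: measurable_funM.
under eq_integral do rewrite exprMn EFinM.
rewrite ge0_integralZl//; [|by apply/measurable_EFinP; exact: measurable_funX|by move=> z _; rewrite lee_fin sqr_ge0|by rewrite lee_fin sqr_ge0].
by rewrite lte_mul_pinfty// lee_fin sqr_ge0.
Qed.

Lemma line_integralD G k c : (forall z, 0 <= G z) -> (forall z, 0 <= k z) ->
  measurable_fun setT G -> measurable_fun setT k ->
  line_integral (fun z => G z + k z) c = (line_integral G c + line_integral k c)%E.
Proof.
move=> G0 k0 mG mk.
have mc F : measurable_fun setT F -> measurable_fun setT (fun r : borel (@itv01 R) => (curve_integrand F (c, r))%:E).
  move=> mF; apply/measurable_EFinP.
  exact: measurableT_comp (measurable_curve_integrand mF) (pair1_measurable c).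
rewrite /line_integral -ge0_integralD//; first last.
- exact: mc.
- by move=> r _; rewrite lee_fin curve_integrand_ge0.
- exact: mc.
- by move=> r _; rewrite lee_fin curve_integrand_ge0.
by apply: eq_integral => r _; rewrite -EFinD /curve_integrand mulrDl.
Qed.

Lemma weak_upper_gradientD f G f' G' : measurable_fun setT f -> measurable_fun setT f' ->
  weak_upper_gradient m f G -> weak_upper_gradient m f' G' ->
  weak_upper_gradient m (fun z => f z + f' z) (fun z => G z + G' z).
Proof.
move=> mf mf' wf wf'; have [G0 G2 _] := wf; have [G0' G2' _] := wf'.
have [/Lfun2P[mG _] /Lfun2P[mG' _]] := (G2, G2').
apply: weak_upper_gradientI.
- exact: measurable_funD.
- by move=> z; rewrite addr_ge0.
- exact: Lfun2D.
move=> P tP; have := ae_and (weak_upper_gradient_ae mf wf tP) (weak_upper_gradient_ae mf' wf' tP).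
apply: ae_mono => c [h1 h2]; rewrite line_integralD//; apply: le_trans (leeD h1 h2).
rewrite -EFinD lee_fin; apply: le_trans (ler_normD _ _).
by rewrite opprD addrACA.
Qed.

Section cutoff.
Variables (f G eta k : borel Z -> R) (phi dphi : R -> R) (la sg L M : R).
Hypotheses (mf : measurable_fun setT f) (wf : weak_upper_gradient m f G).
Hypotheses (phiE : forall r, has_slope phi r (dphi r)) (mdphi : measurable_fun setT dphi).
Hypotheses (phiM : forall r, `|phi r| <= M) (phi_lip : forall r s, `|phi r - phi s| <= `|r - s|).
Hypotheses (meta : measurable_fun setT eta) (eta1 : forall z, `|eta z| <= 1).
Hypotheses (L0 : 0 <= L) (eta_lip : forall z z' : Z, `|eta z - eta z'| <= L * mdist z z').
Hypotheses (k0 : forall z, 0 <= k z) (k2 : k \in Lfun m 2%:E) (etak : pt_slope eta k).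
Hypotheses (la1 : `|la| <= 1) (sg1 : `|sg| <= 1).
Hypothesis slope1 : forall z r, `|la + sg * eta z * dphi r| <= 1.

(** One formula for both functions to be studied: (la, sg) = (0, 1) gives eta phi(f), and (1, -1)
    gives f - eta phi(f). *)
Definition cutoff z := la * f z + sg * eta z * phi (f z).
Definition cutoff_slope z := `|la + sg * eta z * dphi (f z)| * G z + `|phi (f z)| * k z.

Let phi_cont : continuous phi.
Proof. by move=> r; exact: has_slope_continuous (phiE r). Qed.

Let mphi : measurable_fun setT phi. Proof. exact: continuous_measurable_fun. Qed.

Lemma measurable_cutoff : measurable_fun setT cutoff.
Proof.
apply: measurable_funD; first exact: measurable_funM.
apply: measurable_funM; first exact: measurable_funM.
exact: measurableT_comp.
Qed.

Let mG : measurable_fun setT G. Proof. by have [_ /Lfun2P[]] := wf. Qed.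
Let mk : measurable_fun setT k. Proof. by have /Lfun2P[] := k2. Qed.
Let G0 z : 0 <= G z. Proof. by have [] := wf. Qed.

Lemma cutoff_slope_ge0 z : 0 <= cutoff_slope z.
Proof. by rewrite addr_ge0// mulr_ge0. Qed.

Lemma measurable_cutoff_slope : measurable_fun setT cutoff_slope.
Proof.
apply: measurable_funD; apply: measurable_funM => //.
- apply: measurableT_comp => //; apply: measurable_funD => //; apply: measurable_funM.
    exact: measurable_funM.
  exact: measurableT_comp.
- by apply: measurableT_comp => //; exact: measurableT_comp.
Qed.

Let M0 : 0 <= M. Proof. exact: le_trans (phiM 0). Qed.

(** Along almost every curve, [f] is replaced by its absolutely continuous representative [a]. The
    composed function [b] is again absolutely continuous, and at almost every time its slope is
    bounded by the product rule. *)
Lemma weak_upper_gradient_cutoff : weak_upper_gradient m cutoff cutoff_slope.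
Proof.
apply: weak_upper_gradientI.
- exact: measurable_cutoff.
- exact: cutoff_slope_ge0.
- apply: (@Lfun2_le _ (fun z => G z + M * k z)).
  + exact: measurable_cutoff_slope.
  + move=> z; rewrite ger0_norm ?cutoff_slope_ge0//; apply: lerD.
      by rewrite ler_piMl.
    exact: ler_wpM2r.
  + by apply: Lfun2D; [case: wf|exact: Lfun2Z].
move=> P tP; have [_ ac2 _] := tP.
apply: ae_mono (ae_and (ac_representative tP mf wf) ac2) => c [[du [a [au a0 a1 aE]]] /ac_curve21/ac_curve_density[u hu]].
have [s [acs su hs]] := metric_speed hu; have [[s0 isp] cs] := acs.
set v := curve_density G c in du au; have [v0 iv] := du.
pose et x := eta (curve_fun c (clamp01 x)).
pose b x := la * a x + sg * (et x * phi (a x)).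
have et1 x : `|et x| <= 1 by exact: eta1.
have LMs0 r : 0 <= (L * M) * s r by rewrite !mulr_ge0.
(* [la * a] and the increment of [phi o a] contribute one [v] each; the Lipschitz constant of [eta]
   times the bound of [phi] contributes the rest. *)
pose w r := 2 * v r + (L * M) * s r.
have iZ (q : R) (g : R -> R) : mu.-integrable setT (EFin \o g) -> mu.-integrable setT (EFin \o (fun r => q * g r)).
  move=> ig; rewrite (_ : _ \o _ = (fun r => q%:E * (EFin \o g) r)%E); first exact: integrableZl.
  by apply/funext => r /=; rewrite EFinM.
have iw2 := iZ 2 _ iv; have iwL := iZ (L * M) _ isp.
have dw : density w.
  split; first by move=> r; rewrite addr_ge0// mulr_ge0.
  exact: (integrableD measurableT iw2 iwL).
have iS D (g : R -> R) : measurable D -> mu.-integrable setT (EFin \o g) -> mu.-integrable D (EFin \o g).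
  by move=> mD; apply: integrableS.
have bw : ac_with w b.
  move=> x y xy.
  have -> : \int[mu]_(r in `]x, y]) w r = 2 * \int[mu]_(r in `]x, y]) v r + (L * M) * \int[mu]_(r in `]x, y]) s r.
    rewrite RintegralD//; [|exact: iS|exact: iS].
    by rewrite !RintegralZl//; exact: iS.
  have h1 := au _ _ xy; have h2 := cs _ _ xy.
  have h3 : `|et y - et x| <= L * \int[mu]_(r in `]x, y]) s r.
    by apply: le_trans (eta_lip _ _) _; rewrite metric_sym ler_wpM2l.
  have -> : b y - b x = la * (a y - a x) + sg * ((et y - et x) * phi (a y) + et x * (phi (a y) - phi (a x))).
    by rewrite /b; ring.
  have n1 : `|la * (a y - a x)| <= `|a y - a x| by rewrite normrM ler_piMl.
  have n2 : `|(et y - et x) * phi (a y)| <= L * (\int[mu]_(r in `]x, y]) s r) * M.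
    by rewrite normrM; exact: ler_pM.
  have n3 : `|et x * (phi (a y) - phi (a x))| <= `|a y - a x|.
    by rewrite normrM; apply: le_trans (ler_piMl _ _) (phi_lip _ _).
  have n4 X : `|sg * X| <= `|X| by rewrite normrM ler_piMl.
  apply: (le_trans (ler_normD _ _)); apply: (le_trans (lerD n1 (n4 _))).
  apply: (le_trans (lerD (lexx _) (ler_normD _ _))); lra.
have b0 : b 0 = cutoff (eval_at start01 c).
  by rewrite /b /cutoff a0 /et clamp01_0 -mulrA.
have b1 : b 1 = cutoff (eval_at end01 c).
  by rewrite /b /cutoff a1 /et clamp01_1 -mulrA.
rewrite -b0 -b1 line_integralE//; [|exact: cutoff_slope_ge0|exact: measurable_cutoff_slope].
apply: (@le_trans _ _ (\int[mu]_(x in `]0%R, 1%R]) (curve_density cutoff_slope c x)%:E)%E); last first.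
  apply: ge0_subset_integral => //.
    by apply/measurable_EFinP; apply: measurable_curve_density; exact: measurable_cutoff_slope.
  by move=> x _; rewrite lee_fin; apply: curve_density_ge0; exact: cutoff_slope_ge0.
apply: (ac_with_le dw bw) => //.
- by move=> x; apply: curve_density_ge0; exact: cutoff_slope_ge0.
- by apply: measurable_funTS; apply: measurable_curve_density; exact: measurable_cutoff_slope.
have [a' [_ _ ha' a'v]] := ac_with_derivative du au.
have x1 : \forall x \ae mu, x != 1.
  exists [set 1]; split => //; first by rewrite lebesgue_measure_set1.
  by move=> x /= /negP/negPn/eqP.
apply: ae_mono (ae_and3 (ae_and ha' a'v) hs (ae_and x1 aE)) => x [[hax avx] hsx [xn1 aEx]] /andP[x0 xle1] l hl.
have x01 : 0 < x < 1 by rewrite x0 lt_neqAle xn1.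
have {}hsx := hsx x01; have {}aEx : a x = f (curve_fun c (clamp01 x)).
  by apply: aEx; rewrite xle1 ltW.
have xE : 0 < x <= 1 by rewrite x0.
rewrite curve_densityE//; move: avx; rewrite /v curve_densityE// => avx.
have spE := mspeed_lim hsx.
set z := curve_fun c (clamp01 x) in aEx avx *.
(* [b] is split at [x]: with [eta] frozen there, it is a differentiable function of [a]; the
   remaining product vanishes at [x] and costs [k * s * |phi|]. *)
have hs1 : has_slope (fun y => la * a y + (sg * et x) * phi (a y)) x ((la + sg * et x * dphi (a x)) * a' x).
  have h1 := has_slopeM (has_slope_cst la x) hax.
  have h2 := has_slopeM (has_slope_cst (sg * et x) x) (has_slope_comp hax (phiE (a x))).
  have := has_slopeD h1 h2.
  by rewrite !mul0r !add0r mulrA -mulrDl.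
have hs2 : slope_bound (fun y => (et y - et x) * (sg * phi (a y))) x (k z * s x * `|sg * phi (a x)|).
  apply: slope_boundM0.
  - exact: mulr_ge0.
  - by rewrite subrr.
  - have := has_mspeed_slope_bound x01 (s0 x) k0 etak hsx.
    move=> h e /h[d d0 hd]; exists d => // y /hd.
    by rewrite /et subrr subr0.
  - apply: (@has_slope_continuous _ _ _ (0 * phi (a x) + sg * (dphi (a x) * a' x))).
    exact: has_slopeM (has_slope_cst _ _) (has_slope_comp hax (phiE _)).
have hb : slope_bound b x (`|(la + sg * et x * dphi (a x)) * a' x| + k z * s x * `|sg * phi (a x)|).
  have := slope_boundD (slope_bound_slope hs1) hs2.
  move=> h e /h[d d0 hd]; exists d => // y /hd.
  by rewrite /b; congr (`|_| <= _); ring.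
apply: (le_trans (slope_bound_le hl hb)).
have -> : curve_integrand cutoff_slope (c, clamp01 x) = cutoff_slope z * s x.
  by rewrite /curve_integrand/= spE.
move: avx; rewrite /curve_integrand [(_, _).1]/= [(_, _).2]/= -/z spE => avx.
rewrite /cutoff_slope [leRHS]mulrDl; apply: lerD.
  by rewrite normrM aEx -[leRHS]mulrA; exact: ler_wpM2l.
rewrite [leRHS](_ : _ = k z * s x * `|phi (f z)|); last by ring.
by apply: ler_wpM2l; [exact: mulr_ge0|rewrite normrM aEx ler_piMl].
Qed.

End cutoff.
End wug_calculus.

Section minimal_cutoff.
Context {R : realType} (Z : pmetricType R) (m : {measure set (borel Z) -> \bar R}).
Variables (f G : borel Z -> R) (phi dphi : R -> R) (M e : R).
Hypotheses (mf : measurable_fun setT f) (minG : minimal_weak_upper_gradient m f G).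
Hypotheses (phiE : forall r, has_slope phi r (dphi r)) (mdphi : measurable_fun setT dphi).
Hypotheses (phiM : forall r, `|phi r| <= M) (phi_lip : forall r s, `|phi r - phi s| <= `|r - s|).
Hypotheses (e01 : 0 <= e <= 1).

(** With a constant cutoff the term in [k] disappears and only the chain rule remains. *)
Let wug_cst (la sg : R) : `|la| <= 1 -> `|sg| <= 1 -> (forall r, 0 <= la + sg * e * dphi r <= 1) ->
  weak_upper_gradient m (fun z => la * f z + sg * e * phi (f z))
    (fun z => (la + sg * e * dphi (f z)) * G z).
Proof.
move=> la1 sg1 D01; have [wf _] := minG.
have := @weak_upper_gradient_cutoff _ Z m f G (cst e) (cst 0) phi dphi la sg 0 M mf wf phiE mdphi phiM phi_lip.
have e1 : forall z : Z, `|cst e z| <= 1 by move=> z /=; rewrite ger0_norm; case/andP : e01.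
move=> /(_ (measurable_cst _) e1 (lexx _)).
have l0 : forall z z' : Z, `|cst e z - cst e z'| <= 0 * mdist z z'.
  by move=> z z'; rewrite subrr normr0 mul0r.
move=> /(_ l0 (fun=> lexx _)).
have k2 : (cst 0 : borel Z -> R) \in Lfun m 2%:E.
  apply/Lfun2P; split; first exact: measurable_cst.
  under eq_integral do rewrite expr0n/=.
  by rewrite integral0.
have ek : pt_slope (cst e : Z -> R) (cst 0).
  by move=> z; exists 1 => // z' _; rewrite subrr normr0 mul0r.
move=> /(_ k2 ek la1 sg1).
have s1 : forall (z : Z) r, `|la + sg * cst e z * dphi r| <= 1.
  by move=> z r; have /andP[h1 h2] := D01 r; rewrite ger0_norm.
move=> /(_ s1); congr weak_upper_gradient; apply/funext => z.
by rewrite /cutoff_slope /cst mulr0 addr0 ger0_norm//; case/andP : (D01 (f z)).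
Qed.

(* The complementary truncation [f - psi(f)] has slope [(1 - psi'(f)) G], so that a smaller
   gradient of [psi(f)] would give a smaller gradient of [f]. *)
Lemma minimal_weak_upper_gradient_truncation (la sg : R) : 0 <= la <= 1 -> `|sg| <= 1 ->
  (forall r, 0 <= la + sg * e * dphi r <= 1) ->
  minimal_weak_upper_gradient m (fun z => la * f z + sg * e * phi (f z))
    (fun z => (la + sg * e * dphi (f z)) * G z).
Proof.
move=> /andP[la0 la1] sg1 D01; split; first by apply: wug_cst => //; rewrite ger0_norm.
move=> G' wG'.
have wC : weak_upper_gradient m (fun z => (1 - la) * f z + (- sg) * e * phi (f z))
    (fun z => (1 - la + (- sg) * e * dphi (f z)) * G z).
  apply: wug_cst.
  - by rewrite ger0_norm; lra.
  - by rewrite normrN.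
  - by move=> r; have /andP[h1 h2] := D01 r; apply/andP; split; lra.
have mphi : measurable_fun setT phi.
  by apply: continuous_measurable_fun => r; exact: has_slope_continuous (phiE r).
have mc (a b : R) : measurable_fun setT (fun z => a * f z + b * phi (f z)).
  by apply: measurable_funD; apply: measurable_funM => //; exact: measurableT_comp.
have := weak_upper_gradientD (mc _ _) (mc _ _) wG' wC.
rewrite (_ : (fun z => _ + _) = f); last by apply/funext => z; ring.
move=> wf; have [_ minf] := minG; apply: ae_mono (minf _ wf) => z; lra.
Qed.

End minimal_cutoff.

(** * Weak upper gradients on the interval *)

Section affine.
Context {R : realType}.
Local Notation mu := (@lebesgue_measure R).

Lemma lebesgue_measure_affine (a b : R) (A : set R) : 0 < a -> measurable A ->
  mu A = (a%:E * mu ((fun x => (a * x + b)%R) @^-1` A))%E.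
Proof.
move=> a0 mA.
pose phi : R -> measurableTypeR R := fun x => a * x + b.
have mphi : measurable_fun setT phi.
  by apply: measurable_funD => //; apply: measurable_funM.
pose nu : {measure set (measurableTypeR R) -> \bar R} :=
  mscale (NngNum (ltW a0)) (measure_function_pushforward__canonical__measure_function_Measure mu mphi).
have -> : (a%:E * mu ((fun x => (a * x + b)%R) @^-1` A))%E = nu A by [].
apply: (@lebesgue_measure_unique R nu) => // _ [[s t] _ <-].
change (mu `]s, t]%classic = (a%:E * mu (phi @^-1` `]s, t]))%E).
have -> : phi @^-1` `]s, t] = `](s - b) / a, (t - b) / a]%classic.
  apply/seteqP; split => x /=; rewrite /phi !in_itv/= ltr_pdivrMr// ler_pdivlMr// => /andP[h1 h2];
    apply/andP; split; lra.
rewrite !lebesgue_measure_itv/= !lte_fin.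
rewrite ltr_pM2r ?invr_gt0// ltrD2r; case: ifP => _; last by rewrite mule0.
rewrite -!EFinD -EFinM; congr EFin; field.
by rewrite gt_eqF.
Qed.

Lemma ae_affine (a b : R) (Q : R -> Prop) : 0 < a -> (\forall x \ae mu, Q x) ->
  \forall x \ae mu, Q (a * x + b).
Proof.
move=> a0 [A [mA A0 hA]]; exists ((fun x => (a * x + b)%R) @^-1` A); split.
- rewrite -[X in measurable X]setTI; suff : measurable_fun setT (fun x : R => a * x + b) by apply.
  by apply: measurable_funD => //; apply: measurable_funM.
- apply/eqP; have : (a%:E * mu ((fun x => (a * x + b)%R) @^-1` A) == 0)%E.
    by rewrite -lebesgue_measure_affine// A0.
  by rewrite mule_eq0 eqe gt_eqF.
- by move=> x /= nQ; apply: hA.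
Qed.

End affine.

Lemma probability_push d d' (T : measurableType d) (U : measurableType d') (R : realType)
    (P : probability T R) (phi : T -> U) : measurable_fun setT phi ->
  exists P' : probability U R, forall B, P' B = P (phi @^-1` B).
Proof.
move=> mphi.
pose Pm := measure_function_pushforward__canonical__measure_function_Measure P mphi.
have PmT : Pm setT = 1%E.
  by change (P (phi @^-1` setT) = 1%E); rewrite preimage_setT; exact: probability_setT.
have [P' P'E] : exists P' : probability U R, forall B, P' B = Pm B.
  exists (mnormalize Pm (dirac point)) => B.
  change (mnormalize Pm (dirac point) B = Pm B).
  by rewrite /mnormalize PmT/= onee_eq0/= invr1 mule1.
by exists P'.
Qed.

(** * Difference quotients on the interval *)

Section interval_quotients.
Context {R : realType} (I : closed_itv R).
Local Notation mu := (@lebesgue_measure R).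

Lemma mdist_itv (s t : I) : mdist s t = `|val s - val t|.
Proof. by []. Qed.

Definition shift_itv (k : nat) (t : borel I) : borel I := to_itv I (val t + k.+1%:R^-1).

(** Only the steps 1/(k + 1) are used, so that the upper limit is jointly measurable in a parameter.
    An infinite value becomes 0 through [fine]; a shift leaving [I] falls back on [point]. *)
Definition difference_quotient (h : borel I -> R) (t : borel I) : R :=
  fine (limn_esup (fun k => (k.+1%:R * `|h (shift_itv k t) - h t|)%:E)).

Lemma difference_quotient_ge0 h t : 0 <= difference_quotient h t.
Proof.
apply: fine_ge0; rewrite limn_esup_lim; apply: lime_ge; first exact: is_cvg_esups.
apply: nearW => n; apply: (@le_trans _ _ ((n.+1%:R * `|h (shift_itv n t) - h t|)%:E)).
  by rewrite lee_fin mulr_ge0.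
by apply: ereal_sup_ubound; exists n => /=.
Qed.

Lemma measurable_shift_itv k : measurable_fun setT (shift_itv k).
Proof.
apply: (@measurableT_comp _ _ _ _ _ _ (to_itv I : R -> borel I)); first exact: measurable_to_itv.
by apply: measurable_funD => //; exact: measurable_val_itv.
Qed.

Lemma measurable_difference_quotient d (T : measurableType d) (h : borel I * T -> R) :
  measurable_fun setT h ->
  measurable_fun setT (fun p : borel I * T => difference_quotient (fun t => h (t, p.2)) p.1).
Proof.
move=> mh; apply: measurableT_comp => //.
apply: measurable_fun_limn_esup => k; apply/measurable_EFinP; apply: measurable_funM => //.
apply: measurableT_comp => //; apply: measurable_funB; last first.
  by under eq_fun do rewrite -surjective_pairing.
apply: (@measurableT_comp _ _ _ _ _ _ h _ (fun p : borel I * T => (shift_itv k p.1, p.2))) => //.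
apply: measurable_fun_pair => //; apply: measurableT_comp => //; exact: measurable_shift_itv.
Qed.

(** Agreement with [A] is asked only at [t] and at late shifts of [t], which is what an almost
    everywhere equality provides after countably many translations. *)
Lemma difference_quotient_slope h (A : R -> R) (t : borel I) (b : R) :
  has_slope A (val t) b -> h t = A (val t) ->
  (exists N, forall k, (N <= k)%N -> h (shift_itv k t) = A (val t + k.+1%:R^-1)) ->
  difference_quotient h t = `|b|.
Proof.
move=> hA ht [N hN]; rewrite /difference_quotient.
suff : (fun k => (k.+1%:R * `|h (shift_itv k t) - h t|)%:E) @ \oo --> `|b|%:E.
  by move=> hc; rewrite is_cvg_limn_esupE; [rewrite (cvg_lim _ hc)|apply/cvg_ex; eexists; exact: hc].
apply: cvg_EFin; first exact: nearW.
apply/cvgrPdist_le => e /hA[d d0 hd].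
have [k0 hk0] := inv_nat_lt d0.
exists (maxn N k0) => // k /=; rewrite geq_max => /andP[Nk k0k].
rewrite hN// ht; set q := k.+1%:R^-1.
have q0 : 0 < q by rewrite invr_gt0.
have qd : q < d.
  by apply: le_lt_trans hk0; rewrite lef_pV2 ?posrE// ler_nat.
have e1 : val t + q - val t = q by ring.
have := hd (val t + q); rewrite e1 (ger0_norm (ltW q0)) => /(_ qd) h1.
rewrite -[X in X * _]invrK -/q.
have -> : q^-1 * `|A (val t + q) - A (val t)| = `|(A (val t + q) - A (val t)) / q|.
  by rewrite normrM normfV (ger0_norm (ltW q0)) mulrC.
apply: (le_trans (ler_dist_dist _ _)).
rewrite distrC.
have -> : (A (val t + q) - A (val t)) / q - b = (A (val t + q) - A (val t) - b * q) / q.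
  by field; rewrite gt_eqF.
by rewrite normrM normfV (ger0_norm (ltW q0)) ler_pdivrMr.
Qed.

End interval_quotients.

Section weighted_ae.
Context {R : realType} (I : closed_itv R) (w : weight I).
Local Notation mu := (@lebesgue_measure R).

Lemma measurable_weight_pos : measurable ([set t | 0 < w t] : set (borel I)).
Proof.
have := @measurable_weight R I w; move/(_ measurableT `]0, +oo[%classic).
rewrite setTI (_ : _ @^-1` _ = [set t | 0 < w t]); first exact.
by apply/seteqP; split => t; rewrite /= in_itv/= andbT.
Qed.

Lemma ae_weighted (Q : I -> Prop) : (\forall t \ae weighted_lebesgue w, Q t) <->
  (\forall t \ae citv_lebesgue I, 0 < w t -> Q t).
Proof.
have mw : measurable_fun setT (fun t : borel I => (w t)%:E).
  by apply/measurable_EFinP; exact: measurable_weight.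
split=> [[A [mA A0 hA]]|[A [mA A0 hA]]].
- have : (\int[citv_lebesgue I]_(t in A) `|(w t)%:E| = 0)%E.
    rewrite -A0 [RHS]/weighted_lebesgue; apply: eq_integral => t _.
    by rewrite gee0_abs// lee_fin weight_ge0.
  rewrite ae_eq_integral_abs//; last exact: measurable_funTS.
  apply: ae_mono => t h wt; apply: contrapT => nQ.
  by have := h (hA _ nQ) => -[w0]; rewrite w0 ltxx in wt.
- exists (A `|` ~` [set t | 0 < w t]); split.
  + by apply: measurableU => //; apply: measurableC; exact: measurable_weight_pos.
  + apply/eqP; rewrite -measure_le0; apply: (le_trans (measureU2 _ _ _)) => //.
      by apply: measurableC; exact: measurable_weight_pos.
    have wA : weighted_lebesgue w A = 0%E.
      by apply: null_set_integral => //; exact: measurable_funTS.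
    rewrite [X in (X + _)%E]wA add0e [leLHS](_ : _ = 0%E)//.
    apply: integral0_eq => t /= /negP; rewrite -leNgt => w0.
    by congr EFin; apply: le_anti; rewrite w0 weight_ge0.
  + move=> t /= nQ; have [wt|] := boolP (0 < w t); last by right; exact/negP.
    by left; apply: hA => /= h; apply: nQ; exact: h.
Qed.

Lemma ae_weightedR (Q : I -> Prop) : (\forall t \ae weighted_lebesgue w, Q t) <->
  (\forall x \ae mu, citv_set I x -> 0 < w (to_itv I x) -> Q (to_itv I x)).
Proof. by rewrite ae_weighted ae_citv. Qed.

End weighted_ae.

(** * Test plans of translated segments *)

Section translation_plans.
Context {R : realType} (I : closed_itv R) (w : weight I).
Local Notation mu := (@lebesgue_measure R).
Local Notation leb := (citv_lebesgue (@itv01 R)).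

(** An index (q, n, j) stands for the closed interval with centre q and radius 1/(n + 1); it is good
    when the interval lies in [I] and [w] is at least 1/(j + 1) on it. There Lebesgue measure is
    bounded by a multiple of the weighted one, which is the compression bound of a test plan. *)
Definition cell_center (i : rat * nat * nat) : R := ratr i.1.1.
Definition cell_radius (i : rat * nat * nat) : R := i.1.2.+1%:R^-1.
Definition good_cell (i : rat * nat * nat) := forall x, `|x - cell_center i| <= cell_radius i ->
  citv_set I x /\ i.2.+1%:R^-1 <= w (to_itv I x).

Lemma good_cell_cover : \forall x \ae mu, citv_set I x -> 0 < w (to_itv I x) ->
  exists2 i, good_cell i & `|x - cell_center i| < cell_radius i / 2.
Proof.
(* The possible ends of [I], around which no interval fits: at most one point each. *)
pose N1 := [set x | citv_set I x /\ forall y, citv_set I y -> x <= y].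
pose N2 := [set x | citv_set I x /\ forall y, citv_set I y -> y <= x].
have null (N : set R) : (forall x y, N x -> N y -> x = y) -> mu.-negligible N.
  move=> hN; have [[x Nx]|h] := pselect (N !=set0); last first.
    by rewrite (_ : N = set0); [exact: negligible_set0|apply: contrapT => /eqP/set0P].
  apply: (@negligibleS _ _ _ mu [set x]).
    by move=> y Ny; rewrite (hN _ _ Ny Nx).
  by exists [set x]; split; [exact: measurable_set1|exact: lebesgue_measure_set1|].
have n1 : mu.-negligible N1.
  by apply: null => x y [Ix hx] [Iy hy]; apply: le_anti; rewrite hx// hy.
have n2 : mu.-negligible N2.
  by apply: null => x y [Ix hx] [Iy hy]; apply: le_anti; rewrite hx// hy.
apply: negligibleS (negligibleU n1 n2) => x /= /not_implyP[Ix /not_implyP[wx nex]].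
apply: contrapT => /not_orP[nN1 nN2]; apply: nex.
have [y1 Iy1 y1x] : exists2 y, citv_set I y & y < x.
  apply: contrapT => h; apply: nN1; split => // y Iy; rewrite leNgt; apply/negP => yx.
  by apply: h; exists y.
have [y2 Iy2 xy2] : exists2 y, citv_set I y & x < y.
  apply: contrapT => h; apply: nN2; split => // y Iy; rewrite leNgt; apply/negP => yx.
  by apply: h; exists y.
have w20 : 0 < w (to_itv I x) / 2 by rewrite divr_gt0.
have := @weight_continuous _ _ w (to_itv I x).
move=> /(_ _ (nbhsx_ballx _ _ w20))/nbhs_ballP[d /= d0 hd].
have r0 : 0 < Num.min (d / 2) (Num.min (x - y1) (y2 - x) / 2).
  by rewrite lt_min divr_gt0//= divr_gt0// lt_min !subr_gt0 y1x.
have [n hn] := inv_nat_lt r0; have [j hj] := inv_nat_lt w20.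
set rho := n.+1%:R^-1 in hn.
have rho0 : 0 < rho :> R by rewrite invr_gt0.
have [q hq] : exists q : rat, `|x - ratr q| < rho / 2.
  have : x - rho / 2 < x + rho / 2 by lra.
  move=> /rat_in_itvoo[q]; rewrite in_itv/= => /andP[q1 q2]; exists q.
  by rewrite ltr_norml; apply/andP; split; lra.
exists (q, n, j) => //; move=> z; rewrite /cell_center /cell_radius/= -/rho => hz.
have zx : `|z - x| < 2 * rho.
  have -> : z - x = (z - ratr q) - (x - ratr q) by ring.
  apply: (le_lt_trans (ler_normB _ _)); lra.
move: hn; rewrite lt_min => /andP[hn1]; rewrite ltr_pdivlMr// mulrC lt_min => /andP[hn2 hn3].
have Iz : citv_set I z.
  apply: (citv_interval Iy1 Iy2); move: zx; rewrite ltr_norml => /andP[? ?].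
  by apply/andP; split; lra.
split => //.
have : `|w (to_itv I x) - w (to_itv I z)| < w (to_itv I x) / 2.
  apply: hd; change (`|val (to_itv I x) - val (to_itv I z)| < d).
  by rewrite !to_itvK// distrC; apply: (lt_le_trans zx); lra.
have key (p p' r : R) : p - p' < p / 2 -> r < p / 2 -> r <= p' by lra.
by rewrite ltr_norml => /andP[_ h]; exact: key h hj.
Qed.

Section one_cell.
Variables (a rho l : R).
Hypotheses (rho0 : 0 < rho) (l0 : 0 < l).
Hypothesis gi : forall x, `|x - a| <= rho -> citv_set I x /\ l <= w (to_itv I x).
(** From a start in [a - rho, a - rho / 2], a segment of this length ends in [a + rho / 2, a + rho]:
    it stays in the cell and crosses its middle half. *)
Local Notation de := (3 / 2 * rho).

Let de0 : 0 < de. Proof. have r0 := rho0; lra. Qed.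

(** Clamping the start makes [line] a total continuous map, all of whose segments stay in the
    cell. *)
Let cl (y : R) : R := Num.max (a - rho) (Num.min (a - rho / 2) y).

Let cl_range y : a - rho <= cl y <= a - rho / 2.
Proof.
have r0 := rho0; have h : a - rho <= a - rho / 2 by lra.
rewrite /cl; have [[_ ->]|[[h1 h2 ->]|[_ ->]]] := clamp_real_cases y h; apply/andP; split => //; lra.
Qed.

Let clK y : a - rho <= y <= a - rho / 2 -> cl y = y.
Proof. by move=> /andP[y1 y2]; rewrite /cl min_r// max_r. Qed.

Let line_in y (s : @itv01 R) : citv_set I (cl y + de * val s).
Proof.
have r0 := rho0; have /andP[y1 y2] := cl_range y; have /andP[s0 s1] := itv01P s.
have h0 : 0 <= de * val s by rewrite mulr_ge0// ltW.
have h1 : de * val s <= de by rewrite ler_piMr// ltW.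
by apply: (gi _).1; rewrite ler_norml; apply/andP; split; lra.
Qed.

Let line_fun y (s : @itv01 R) : I := to_itv I (cl y + de * val s).

Let line_fun_dist y s s' : mdist (line_fun y s) (line_fun y s') = de * `|val s - val s'|.
Proof.
rewrite mdist_itv !to_itvK; [|exact: line_in|exact: line_in].
have -> : cl y + de * val s - (cl y + de * val s') = de * (val s - val s') by ring.
by rewrite normrM ger0_norm// ltW.
Qed.

Let line_continuous y : continuous (line_fun y).
Proof.
move=> s A /nbhs_ballP[e /= e0 eA]; apply/nbhs_ballP; exists (e / de) => /=.
  by rewrite divr_gt0.
by move=> s' ss'; apply: eA; rewrite metric_ballP line_fun_dist mulrC -ltr_pdivlMr.
Qed.

Definition line y : curve I := mkcts (@line_continuous y).

Let cl_lip y y' : `|cl y - cl y'| <= `|y - y'|.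
Proof.
have r0 := rho0; have h : a - rho <= a - rho / 2 by lra.
wlog yy' : y y' / y <= y'.
  move=> h'; have [|yx] := leP y y'; first exact: h'.
  by rewrite distrC [leRHS]distrC; apply: h'; exact: ltW.
rewrite distrC [leRHS]distrC [leRHS]ger0_norm ?subr_ge0//.
by have /andP[h1 h2] := clamp_real_le h yy'; rewrite ger0_norm.
Qed.

Let measurable_line : measurable_fun setT (line : R -> borel (curve I)).
Proof.
apply: measurable_fun_borel => V oV; apply: open_measurable.
suff : continuous (line : R -> curve I) by move=> /continuousP; apply.
apply: curve_continuous => y e e0; apply/nbhs_ballP; exists e => // y' yy' s.
change (mdist (line_fun y s) (line_fun y' s) < e).
rewrite mdist_itv !to_itvK; [|exact: line_in|exact: line_in].
rewrite [X in `|X|](_ : _ = cl y - cl y'); last by ring.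
exact: le_lt_trans (cl_lip _ _) yy'.
Qed.

Let line_mspeed y s : mspeed (curve_fun (line y)) s = de.
Proof.
apply: mspeed_lim => e e0; exists 1 => // s' /andP[s0 _].
rewrite /speed_quotient; change (`|mdist (line_fun y s') (line_fun y s) / `|val s' - val s| - de| <= e).
by rewrite line_fun_dist mulfK ?gt_eqF// subrr normr0 ltW.
Qed.

Let line_ac2 y : ac_curve 2%:E (curve_fun (line y)).
Proof.
exists (cst de); split.
- by move=> r; exact: ltW.
- apply/Lfun2P; split; first exact: measurable_cst.
  rewrite -[X in (integral _ _ X < _)%E]/(cst ((de ^+ 2)%:E)) integral_cst//.
  by rewrite [X in (_ * X)%E]citv_lebesgue01 mule1 ltry.
- move=> s t st.
  rewrite [leLHS](_ : _ = (de * `|val s - val t|)%:E); last by rewrite -(line_fun_dist y).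
  rewrite integral_itv01//; [|exact/measurable_EFinP/measurable_cst|by move=> r; rewrite lee_fin ltW].
  rewrite -[X in (_ <= integral _ _ X)%E]/(cst de%:E) integral_cst//.
  by rewrite [X in (_ <= _ * X)%E]lebesgue_measure_oc// distrC ger0_norm ?subr_ge0.
Qed.

(* The segments of length [3/2 * rho] issued from a uniformly distributed point cover the middle half
   of the cell. *)
Lemma translation_plan : exists P : probability (borel (curve I)) R,
  test_plan (weighted_lebesgue w) P /\
  forall Q : curve I -> Prop, (\forall c \ae P, Q c) ->
    exists y, a - rho <= y <= a - rho / 2 /\ Q (line y).
Proof.
have r0 := rho0; have ab : a - rho < a - rho / 2 by lra.
have [P PE] := probability_push (uniform_prob ab) measurable_line.
exists P; split; last first.
  move=> Q [A [mA A0 hA]]; apply: contrapT => nex.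
  have : (uniform_prob ab (line @^-1` A) = 0)%E by rewrite -PE.
  have mlA : measurable ((line : R -> borel (curve I)) @^-1` A).
    by rewrite -[X in measurable X]setTI; exact: measurable_line.
  have sub : `[a - rho, a - rho / 2] `<=` line @^-1` A.
    move=> y; rewrite /= in_itv/= => yab; apply: hA => Qy; apply: nex; exists y; split => //.
  rewrite /uniform_prob integral_uniform_pdf1// => /eqP.
  by rewrite onee_eq0.
split.
- pose ka : R := l^-1; have ka0 : 0 < ka by rewrite invr_gt0.
  (* 2 / rho is the density of the uniform law on an interval of length rho / 2, and 1 / l passes
     from Lebesgue measure to the weighted one. *)
  exists (2 / rho * ka); first by rewrite !mulr_gt0// invr_gt0.
  move=> s A mA; rewrite /pushforward PE.
  set B := _ @^-1` A.
  have mB : measurable (line @^-1` B).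
    rewrite -[X in measurable X]setTI; apply: measurable_line => //.
    by rewrite /B -[X in measurable X]setTI; exact: measurable_eval_at.
  set D := line @^-1` B in mB *.
  pose J : set R := `[a - rho, a - rho / 2]%classic.
  have DE : uniform_prob ab D = ((2 / rho)%:E * mu (D `&` J))%E.
    rewrite /uniform_prob integral_uniform_pdf.
    rewrite (eq_integral (cst (2 / rho)%:E)); last first.
      move=> x; rewrite inE => -[_]; rewrite /= in_itv/= /uniform_pdf => ->.
      by congr EFin; field; rewrite !gt_eqF//; lra.
    by rewrite integral_cst//; exact: measurableI.
  rewrite [leLHS]DE [(2 / rho * ka)%:E]EFinM -muleA; apply: lee_wpmul2l; first by rewrite lee_fin divr_ge0// ltW.
  have mA' : measurable ((to_itv I : R -> borel I) @^-1` A).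
    by rewrite -[X in measurable X]setTI; exact: measurable_to_itv.
  pose E := ((to_itv I : R -> borel I) @^-1` A) `&` `[a - rho, a + rho].
  have mE : measurable E by exact: measurableI.
  apply: (@le_trans _ _ (mu E)).
    rewrite [leRHS](@lebesgue_measure_affine _ 1 (de * val s))// mul1e.
    apply: le_measure; rewrite ?inE//.
    - by apply: measurableI => //; exact: measurable_itv.
    - rewrite -[X in measurable X]setTI.
      suff : measurable_fun setT (fun x : R => 1 * x + de * val s) by apply.
      by apply: measurable_funD => //; apply: measurable_funM.
    move=> y [Dy]; rewrite /J/= in_itv/= => yab; rewrite /E/= mul1r; split.
      have : A (line_fun y s) by [].
      by rewrite /line_fun clK.
    rewrite in_itv/=; have := line_in y s; have /andP[y1 y2] := yab.
    have /andP[s0 s1] := itv01P s.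
    have h0 : 0 <= de * val s by rewrite mulr_ge0// ltW.
    have h1 : de * val s <= de by rewrite ler_piMr// ltW.
    move=> _; have hh : a - rho <= y + de * val s <= a + rho by apply/andP; split; lra.
    exact: hh.
  change (mu E <= ka%:E * \int[citv_lebesgue I]_(t in A) (w t)%:E)%E.
  rewrite integral_citv//; last 2 first.
  + by apply/measurable_EFinP; exact: measurable_weight.
  + by move=> t; rewrite lee_fin weight_ge0.
  apply: (@le_trans _ _ (ka%:E * \int[mu]_(x in E) (w (to_itv I x))%:E)%E); last first.
    apply: lee_wpmul2l; first by rewrite lee_fin ltW.
    apply: ge0_subset_integral => //.
    - by rewrite image_val_itv; apply: measurableI => //; exact: measurable_citv_set.
    - apply: measurable_funTS; apply/measurable_EFinP.
      by apply: measurable_comp_to_itv; exact: measurable_weight.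
    - by move=> x _; rewrite lee_fin weight_ge0.
    - rewrite image_val_itv => x [Ax]; rewrite /= in_itv/= => /andP[x1 x2]; split => //.
      by apply: (gi _).1; rewrite ler_norml; apply/andP; split; lra.
  rewrite -[leLHS]mul1e -(integral_cst mu mE 1%E).
  rewrite -ge0_integralZl//.
  + apply: ge0_le_integral => //.
    * apply: measurable_funTS; apply: measurable_funeM; apply/measurable_EFinP.
      by apply: measurable_comp_to_itv; exact: measurable_weight.
    * move=> x [_]; rewrite /= in_itv/= => /andP[x1 x2].
      rewrite -EFinM lee_fin -ler_pdivrMl// mulr1 invrK.
      by apply: (gi _).2; rewrite ler_norml; apply/andP; split; lra.
  + apply: measurable_funTS; apply/measurable_EFinP.
    by apply: measurable_comp_to_itv; exact: measurable_weight.
  + by move=> x _; rewrite lee_fin weight_ge0.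
  + by rewrite lee_fin ltW.
- exists (~` [set c | ac_curve 2%:E (curve_fun c)]); split => //.
    by apply: measurableC; exact: measurable_ac2.
  rewrite PE (_ : _ @^-1` _ = set0) ?measure0//.
  by apply/seteqP; split => // y /= h; apply: h; exact: line_ac2.
- apply: (@le_lt_trans _ _ (\int[leb]_t (de ^+ 2)%:E)%E); last first.
    rewrite -[X in (integral _ _ X < _)%E]/(cst ((de ^+ 2)%:E)) integral_cst//.
    by rewrite [X in (_ * X)%E]citv_lebesgue01 mule1 ltry.
  apply: ge0_le_integral => //.
  + by move=> t _; apply: integral_ge0 => c _; rewrite lee_fin sqr_ge0.
  + have m2 : measurable_fun setT (fun p : borel (curve I) * borel (@itv01 R) =>
        (mspeed (curve_fun p.1) p.2 ^+ 2)%:E).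
      by apply/measurable_EFinP; apply: measurable_funX; exact: measurable_mspeed.
    have p2 p : (0 <= (mspeed (curve_fun (p : borel (curve I) * borel (@itv01 R)).1) p.2 ^+ 2)%:E)%E.
      by rewrite lee_fin sqr_ge0.
    exact: (@measurable_fun_fubini_tonelli_G _ _ _ _ _ P _ m2 p2).
  + move=> t _.
    have mt : measurable_fun setT (fun c : borel (curve I) => (mspeed (curve_fun c) t ^+ 2)%:E).
      by apply/measurable_EFinP; apply: measurable_funX; exact: measurable_mspeed2.
    have nn (c : borel (curve I)) : (0 <= (mspeed (curve_fun c) t ^+ 2)%:E)%E.
      by rewrite lee_fin sqr_ge0.
    have -> := @ge0_integral_push _ _ _ _ _ (uniform_prob ab) P _ _ measurable_line (fun A _ => PE A) mt nn.
    under eq_integral do rewrite line_mspeed.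
    rewrite -[X in (integral _ _ X <= _)%E]/(cst ((de ^+ 2)%:E)) integral_cst//.
    by rewrite [X in (_ * X <= _)%E](probability_setT (uniform_prob ab)) mule1.
Qed.

Lemma curve_fun_line y s : a - rho <= y <= a - rho / 2 ->
  curve_fun (line y) s = to_itv I (y + 3 / 2 * rho * val s).
Proof. by move=> /clK yK; rewrite -[in RHS]yK. Qed.

Lemma mspeed_line y s : mspeed (curve_fun (line y)) s = 3 / 2 * rho.
Proof. exact: line_mspeed. Qed.

(** A single segment of the plan is enough: along it [h] has an absolutely continuous
    representative, and undoing the affine parametrization gives [A] on the middle half of the
    cell. *)
Lemma local_representative (h K : borel I -> R) : measurable_fun setT h ->
  weak_upper_gradient (weighted_lebesgue w) h K -> exists A B : R -> R,
  continuous A /\ \forall x \ae mu, `|x - a| < rho / 2 ->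
    [/\ h (to_itv I x) = A x, has_slope A x (B x) & `|B x| <= K (to_itv I x)].
Proof.
move=> mh wh; have r0 := rho0; have [P [tP hP]] := translation_plan.
have [y [yr [du [b [bu _ _ bE]]]]] := hP _ (ac_representative tP mh wh).
have [b' [_ _ sb b'u]] := ac_with_derivative du bu.
(* The inverse of the parametrization sending s to y + de s. *)
pose g (x : R) : R := de^-1 * x + (- (y / de)).
have gE x : g x = (x - y) / de by rewrite /g; lra.
exists (fun x => b (g x)), (fun x => b' (g x) * de^-1); split.
  move=> x; apply: (@continuous_comp _ _ _ g b); last exact: ac_with_continuous du bu _.
  by apply: continuousD; [apply: continuousM; [exact: cst_continuous|exact: id]|exact: cst_continuous].
have de'0 : 0 < de^-1 by rewrite invr_gt0.
have := ae_affine (- (y / de)) de'0 (ae_and3 sb b'u bE).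
apply: ae_mono => x [hs hu he] xa; rewrite -/(g x) in hs hu he.
have /andP[y1 y2] := yr.
have g01 : 0 < g x < 1.
  rewrite gE; move: xa; rewrite ltr_norml => /andP[x1 x2]; apply/andP; split.
    by rewrite divr_gt0//; lra.
  by rewrite ltr_pdivrMr//; lra.
have g01' : 0 <= g x <= 1 by have /andP[h1 h2] := g01; rewrite !ltW.
have g01'' : 0 < g x <= 1 by have /andP[h1 h2] := g01; rewrite h1 ltW.
have cE : curve_fun (line y) (clamp01 (g x)) = to_itv I x.
  rewrite curve_fun_line// clamp01K// gE mulrC divfK ?gt_eqF//.
  by congr to_itv; ring.
split.
- by rewrite he// cE.
- apply: has_slope_comp => //.
  have := has_slopeDr (- (y / de)) (has_slopeM (has_slope_cst de^-1 x) (has_slope_id x)).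
  by rewrite mul0r add0r mulr1.
- move: hu; rewrite curve_densityE// /curve_integrand [(_, _).1]/= [(_, _).2]/= mspeed_line cE => hu.
  by rewrite normrM (ger0_norm (ltW de'0)) ler_pdivrMr.
Qed.

End one_cell.
End translation_plans.

(** By bounded compression a null set of Z is avoided by almost every curve at each fixed time;
    Tonelli exchanges curve and time. *)
Lemma ae_curve {R : realType} (Z : pmetricType R) (m : {measure set (borel Z) -> \bar R})
    (P : probability (borel (curve Z)) R) (Q : Z -> Prop) :
  test_plan m P -> (\forall z \ae m, Q z) ->
  \forall c \ae P, \forall s \ae citv_lebesgue itv01, Q (curve_fun c s).
Proof.
move=> tP [N [mN N0 hN]].
pose G : set (borel (curve Z) * borel (@itv01 R)) := [set p | ~ N (curve_fun p.1 p.2)].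
have mG : measurable G.
  have := @measurable_eval_comp _ Z _ (measurable_indic mN : measurable_fun setT (\1_N : borel Z -> R)).
  move=> /(_ measurableT [set 0] (measurable_set1 _)); rewrite setTI.
  congr measurable; apply/seteqP; split => p; rewrite /= indicE.
    by move=> h Np; move: h; rewrite mem_set// => /eqP; rewrite oner_eq0.
  by move=> h; rewrite memNset.
have hG : \forall c \ae P, \forall s \ae citv_lebesgue itv01, G (c, s).
  apply/(ae_swap P (citv_lebesgue itv01) mG); apply: aeW => s.
  have mi : measurable_fun setT (EFin \o \1_N : borel Z -> \bar R).
    by apply/measurable_EFinP; exact: measurable_indic.
  have [C C0 /(_ s)] := integral_eval_le tP mi (fun z => ltac:(by rewrite lee_fin indicE)).
  have -> : (\int[m]_z (EFin \o \1_N) z = 0)%E by rewrite -N0 -[in RHS](setIT N) -integral_indic.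
  rewrite mule0.
  have mS : measurable ((eval_at s : borel (curve Z) -> borel Z) @^-1` N).
    by rewrite -[X in measurable X]setTI; exact: measurable_eval_at.
  have -> : (\int[P]_c (EFin \o \1_N) (eval_at s c) = P ((eval_at s : borel (curve Z) -> borel Z) @^-1` N))%E.
    by rewrite -[in RHS](setIT (_ @^-1` N)) -integral_indic.
  rewrite measure_le0 => /eqP S0.
  exists ((eval_at s : borel (curve Z) -> borel Z) @^-1` N); split => //.
  by move=> c /= /contrapT.
apply: ae_mono hG => c; apply: ae_mono => s /= nN; apply: contrapT => nQ.
by apply: nN; exact: hN.
Qed.

Lemma ae_eq_continuous {R : realType} (f g : R -> R) (x d : R) : continuous f -> continuous g ->
  (\forall y \ae (@lebesgue_measure R), `|y - x| < d -> f y = g y) ->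
  forall y, `|y - x| < d -> f y = g y.
Proof.
move=> cf cg [N [mN N0 hN]] y yd; apply: contrapT => ne.
have e0 : 0 < `|f y - g y| by rewrite normr_gt0 subr_eq0; apply/eqP.
have cfg : {for y, continuous (fun z => f z - g z)} by apply: continuousB; [exact: cf|exact: cg].
move/cvgrPdist_lt/(_ _ e0)/nbhs_ballP : cfg => [r /= r0 hr].
pose q := Num.min r (d - `|y - x|).
have q0 : 0 < q by rewrite lt_min r0 subr_gt0.
pose J : set R := `]y - q, y + q[%classic.
have : (lebesgue_measure J <= lebesgue_measure N)%E.
  apply: le_measure; rewrite ?inE//; first exact: measurable_itv.
  move=> z; rewrite /J/= in_itv/= => /andP[z1 z2].
  have zy : `|z - y| < q by rewrite ltr_norml; apply/andP; split; lra.
  move: zy; rewrite lt_min => /andP[zr zd]; apply: hN => /= h.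
  have : `|f y - g y - (f z - g z)| < `|f y - g y| by apply: hr; rewrite /ball/= distrC.
  rewrite h ?subrr ?subr0 ?ltxx//.
  have -> : z - x = (z - y) + (y - x) by ring.
  by apply: (le_lt_trans (ler_normD _ _)); lra.
rewrite N0 /J lebesgue_measure_itv/= lte_fin ifT; last lra.
rewrite -EFinD lee_fin; lra.
Qed.

Lemma near_unit {R : realType} (x y : R) : `|y - x| < x -> `|y - x| < 1 - x -> 0 <= y <= 1.
Proof. by rewrite !ltr_norml => /andP[? ?] /andP[? ?]; apply/andP; split; lra. Qed.

(** * The minimal gradient on the interval *)

Section interval_slopes.
Context {R : realType} (I : closed_itv R) (w : weight I).
Local Notation mu := (@lebesgue_measure R).
Local Notation leb := (citv_lebesgue (@itv01 R)).

Lemma slope_bound_curve (A : R -> R) (b : R) (c : @itv01 R -> I) (x s : R) : 0 < x < 1 ->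
  0 <= s -> 0 <= b -> slope_bound A (val (c (clamp01 x))) b ->
  has_mspeed c (clamp01 x) s -> slope_bound (fun y => A (val (c (clamp01 y)))) x (b * s).
Proof.
move=> x01 s0 b0 hA hs e e0.
have b1 : 0 < b + 1 by rewrite ltr_wpDl.
have s1' : 0 < s + 1 by rewrite ltr_wpDl.
pose e1 := e / 2 / (s + 1).
have e10 : 0 < e1 by rewrite !divr_gt0.
pose e2 := Num.min 1 (e / 2 / (b + 1)).
have e20 : 0 < e2 by rewrite lt_min ltr01 !divr_gt0.
have [d1 d10 h1] := hA _ e10.
have [d2 d20 h2] := has_mspeed_dist x01 hs e20.
have s1 : 0 < s + e2 by rewrite ltr_wpDl.
exists (Num.min d2 (d1 / (s + e2))); first by rewrite lt_min d20 divr_gt0.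
move=> y; rewrite lt_min => /andP[/h2 {}h2 yd].
rewrite mdist_itv in h2.
apply: le_trans (h1 _ _) _; first by apply: (le_lt_trans h2); rewrite -ltr_pdivlMl// mulrC.
apply: (@le_trans _ _ ((b + e1) * ((s + e2) * `|y - x|))).
  by apply: ler_wpM2l => //; rewrite addr_ge0// ltW.
rewrite mulrA; apply: ler_wpM2r => //.
have h3 : b * e2 <= e / 2.
  apply: (@le_trans _ _ ((b + 1) * (e / 2 / (b + 1)))); last by rewrite mulrC divfK// gt_eqF.
  apply: ler_pM => //; [exact: ltW|lra|by rewrite ge_min lexx orbT].
have h4 : e1 * (s + e2) <= e / 2.
  apply: (@le_trans _ _ (e1 * (s + 1))); last by rewrite divfK// gt_eqF.
  by apply: ler_wpM2l; [exact: ltW|rewrite lerD2l ge_min lexx].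
by rewrite mulrDl [b * (s + e2)]mulrDr; lra.
Qed.

(** Collects the local representatives of the countably many cells, so that one null set serves for
    all of them. *)
Lemma cell_slopes (h K : borel I -> R) : measurable_fun setT h ->
  weak_upper_gradient (weighted_lebesgue w) h K ->
  exists A B : (rat * nat * nat) -> R -> R, (forall i, good_cell w i -> continuous (A i)) /\
    \forall x \ae mu, forall i, good_cell w i -> `|x - cell_center i| < cell_radius i / 2 ->
      [/\ h (to_itv I x) = A i x, has_slope (A i) x (B i x), `|B i x| <= K (to_itv I x) &
        difference_quotient h (to_itv I x) = `|B i x|].
Proof.
move=> mh wh.
have ex i : exists AB : (R -> R) * (R -> R), good_cell w i -> continuous AB.1 /\
    \forall x \ae mu, `|x - cell_center i| < cell_radius i / 2 ->
    [/\ h (to_itv I x) = AB.1 x, has_slope AB.1 x (AB.2 x) & `|AB.2 x| <= K (to_itv I x)].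
  have [gi|] := pselect (good_cell w i); last by exists (fun=> 0, fun=> 0).
  have r0 : 0 < cell_radius i :> R by rewrite invr_gt0.
  have l0 : (0 : R) < i.2.+1%:R^-1 by rewrite invr_gt0.
  have [A [B hAB]] := local_representative r0 l0 gi mh wh.
  by exists (A, B).
have [AB hAB] := choice ex.
exists (fun i => (AB i).1), (fun i => (AB i).2); split => [i /hAB[]//|].
apply: ae_count => i.
have [gi|ngi] := pselect (good_cell w i); last exact: aeW.
have [_ hae] := hAB _ gi.
(* Discarding the translates of one null set by all steps 1/(k + 1) makes the equality hold at every
   shifted point that stays in the half cell. *)
have hshift : \forall x \ae mu, forall k : nat, `|x + k.+1%:R^-1 - cell_center i| < cell_radius i / 2 ->
    h (to_itv I (x + k.+1%:R^-1)) = (AB i).1 (x + k.+1%:R^-1).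
  apply: ae_nat => k; have := ae_affine k.+1%:R^-1 ltr01 hae.
  by apply: ae_mono => x; rewrite mul1r => hx /hx[].
apply: ae_mono (ae_and hae hshift) => x [h1 h2] _ xi.
have [hA sA bK] := h1 xi; split => //.
have r0 : 0 < cell_radius i :> R by rewrite invr_gt0.
have Ix : citv_set I x by apply: (gi x _).1; apply/ltW/(lt_le_trans xi); lra.
have vx : val (to_itv I x) = x by rewrite to_itvK.
apply: difference_quotient_slope.
- by rewrite vx; exact: sA.
- by rewrite vx.
have q0 : 0 < cell_radius i / 2 - `|x - cell_center i| by rewrite subr_gt0.
have [k0 hk0] := inv_nat_lt q0.
exists k0 => k k0k; rewrite /shift_itv vx; apply: h2.
have kk : k.+1%:R^-1 <= k0.+1%:R^-1 :> R by rewrite lef_pV2 ?posrE// ler_nat.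
have kp : 0 <= k.+1%:R^-1 :> R by rewrite invr_ge0.
have -> : x + k.+1%:R^-1 - cell_center i = (x - cell_center i) + k.+1%:R^-1 by ring.
by apply: (le_lt_trans (ler_normD _ _)); rewrite (ger0_norm kp) addrC -ltrBrDr; exact: le_lt_trans kk hk0.
Qed.

Lemma difference_quotient_le (h K : borel I -> R) : measurable_fun setT h ->
  weak_upper_gradient (weighted_lebesgue w) h K ->
  \forall t \ae weighted_lebesgue w, difference_quotient h t <= K t.
Proof.
move=> mh wh; have [A [B [_ hAB]]] := cell_slopes mh wh.
apply/ae_weightedR; apply: ae_mono (ae_and hAB (good_cell_cover w)) => x [h1 h2] Ix wx.
by have [i gi /(h1 i gi)[_ _ h3 ->]] := h2 Ix wx.
Qed.

Lemma difference_quotient_Lfun2 (h K : borel I -> R) : measurable_fun setT h ->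
  weak_upper_gradient (weighted_lebesgue w) h K ->
  difference_quotient h \in Lfun (weighted_lebesgue w) 2%:E.
Proof.
move=> mh wh; have [K0 /Lfun2P[mK K2] _] := wh.
have mD : measurable_fun setT (difference_quotient h).
  have mh' : measurable_fun setT (fun p : borel I * unit => h p.1) by exact: measurableT_comp.
  exact: measurableT_comp (measurable_difference_quotient mh') (pair2_measurable tt).
apply/Lfun2P; split => //; apply: le_lt_trans K2; apply: ae_ge0_le_integral => //.
- by move=> t _; rewrite lee_fin sqr_ge0.
- by apply/measurable_EFinP; exact: measurable_funX.
- by move=> t _; rewrite lee_fin sqr_ge0.
- by apply/measurable_EFinP; exact: measurable_funX.
have := difference_quotient_le mh wh; apply: ae_mono => t ht _.
by rewrite lee_fin ler_pXn2r ?nnegrE// difference_quotient_ge0.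
Qed.

(* Near a time s with c(s) in a good cell, an absolutely continuous representative A of h satisfies
   h o c = A o c almost everywhere, so the slope of h o c is at most |A'(c(s))| |c'(s)|, and |A'| is the
   limit of the difference quotients of h. *)
Lemma minimal_difference_quotient (h K : borel I -> R) : measurable_fun setT h ->
  weak_upper_gradient (weighted_lebesgue w) h K ->
  minimal_weak_upper_gradient (weighted_lebesgue w) h (difference_quotient h).
Proof.
move=> mh wh; split; last by move=> K'; exact: difference_quotient_le.
have D2 := difference_quotient_Lfun2 mh wh; have /Lfun2P[mD _] := D2.
have D0 := difference_quotient_ge0 h.
apply: weak_upper_gradientI => // P tP; have [_ ac2 _] := tP.
have [A [B [cA hAB]]] := cell_slopes mh wh.
have good : \forall t \ae weighted_lebesgue w,
  (exists2 i, good_cell w i & `|val t - cell_center i| < cell_radius i / 2) /\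
  forall i, good_cell w i -> `|val t - cell_center i| < cell_radius i / 2 ->
    [/\ h t = A i (val t), has_slope (A i) (val t) (B i (val t)) &
      difference_quotient h t = `|B i (val t)|].
  apply/ae_weightedR; apply: ae_mono (ae_and hAB (good_cell_cover w)) => x [h1 h2] Ix wx.
  rewrite to_itvK//; split; first exact: h2.
  by move=> i gi /(h1 i gi)[].
apply: ae_mono (ae_and3 (ac_representative tP mh wh) ac2 (ae_curve tP good)) => c.
move=> [[dK [a [aK a0 a1 aE]]] /ac_curve21 ac1 goodc].
have [u hu] := ac_curve_density ac1; have [s [acs su hs]] := metric_speed hu.
have cc := ac_curve_continuous ac1.
have [[s0 isp] cs] := acs.
have ca : continuous a by exact: ac_with_continuous dK aK.
have h01 : \forall x \ae mu, x != 1.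
  exists [set 1]; split => //; first by rewrite lebesgue_measure_set1.
  by move=> x /= /negP/negPn/eqP.
move/ae_itv01 in goodc.
pose cv (y : R) : R := val (curve_fun c (clamp01 y)).
have ccv : continuous cv.
  move=> y; apply/cvgrPdist_lt => e e0; have [d d0 hd] := ac_bound_continuous hu y e0.
  by apply/nbhs_ballP; exists d => // y'; rewrite /ball/= distrC => /hd; rewrite mdist_itv.
have cAv i : good_cell w i -> continuous (fun y => A i (cv y)).
  by move=> gi y; apply: continuous_comp; [exact: ccv|exact: cA].
rewrite -a0 -a1 line_integralE//.
apply: (@le_trans _ _ (\int[mu]_(x in `]0%R, 1%R]) (curve_density (difference_quotient h) c x)%:E)%E); last first.
  apply: ge0_subset_integral => //.
    by apply/measurable_EFinP; exact: measurable_curve_density.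
  by move=> x _; rewrite lee_fin; exact: curve_density_ge0.
apply: (ac_with_le dK aK) => //.
- by move=> x; exact: curve_density_ge0.
- by apply: measurable_funTS; exact: measurable_curve_density.
apply: ae_mono (ae_and3 hs h01 goodc) => x [hsx xn1 gx] /andP[x0 x1] l hl.
have x01 : 0 < x < 1 by rewrite x0 lt_neqAle xn1.
have {}hsx := hsx x01.
have x01' : 0 <= x <= 1 by rewrite x1 ltW.
have [[i gi ci] hi] := gx x01'.
have [hA sA qE] := hi i gi ci.
have xE : 0 < x <= 1 by rewrite x0.
rewrite curve_densityE// /curve_integrand [(_, _).1]/= [(_, _).2]/= (mspeed_lim hsx) qE.
have near : exists2 d : R, 0 < d & forall y, `|y - x| < d ->
    0 <= y <= 1 /\ `|cv y - cell_center i| < cell_radius i / 2.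
  have q0 : 0 < cell_radius i / 2 - `|cv x - cell_center i| by rewrite subr_gt0.
  have /cvgrPdist_lt/(_ _ q0)/nbhs_ballP[d /= d0 hd] := ccv x.
  exists (Num.min d (Num.min x (1 - x))); first by rewrite !lt_min d0 x0 subr_gt0; case/andP : x01.
  move=> y; rewrite !lt_min => /and3P[yd yx y1x]; split.
    exact: near_unit yx y1x.
  have := hd y; rewrite /ball/= distrC => /(_ yd) h1.
  have -> : cv y - cell_center i = (cv x - cell_center i) - (cv x - cv y) by ring.
  by apply: (le_lt_trans (ler_normB _ _)); rewrite addrC -ltrBrDr.
have [d d0 hd] := near.
(* The two functions agree at almost every time near [x]; both are continuous, so they agree
   throughout the neighbourhood and have the same slope at [x]. *)
have aA : forall y, `|y - x| < d -> a y = A i (cv y).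
  apply: (@ae_eq_continuous _ a (fun y => A i (cv y)) x d ca (cAv i gi)).
  apply: ae_mono (ae_and aE goodc) => {}y [aEy gy] /hd[y01 yi].
  rewrite aEy//; have [_ hy] := gy y01.
  by have [-> _ _] := hy i gi yi.
apply: slope_bound_le hl _.
apply: (@slope_bound_near _ (fun y => A i (cv y))).
  by exists d => // y /aA.
apply: slope_bound_curve => //; exact: slope_bound_slope.
Qed.

End interval_slopes.

(** * The warped product *)

Section product_borel.
Context {R : realType} (I : closed_itv R) (X : pmetricType R).
Local Notation prodT := (borel I * borel X)%type.

Lemma measurable_borel_rect (U : set I) (V : set X) : open U -> open V ->
  measurable ([set p | U p.1 /\ V p.2] : set prodT).
Proof.
move=> oU oV; rewrite (_ : mkset _ = fst @^-1` U `&` snd @^-1` V)//.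
apply: measurableI.
- by rewrite -[X in measurable X]setTI; apply: measurable_fst => //; exact: sub_sigma_algebra.
- by rewrite -[X in measurable X]setTI; apply: measurable_snd => //; exact: sub_sigma_algebra.
Qed.

Lemma open_mdist_ball (Z : pmetricType R) (x : Z) (r : R) : open [set y | mdist x y < r].
Proof.
rewrite openE => y /= xy; apply/nbhs_ballP; exists (r - mdist x y); first by rewrite /= subr_gt0.
move=> z; rewrite metric_ballP => yz.
by apply: (le_lt_trans (metric_triangle _ y _)); rewrite addrC -ltrBrDr.
Qed.

Lemma open_val_itv (U : set R) : open U -> open [set t : I | U (val t)].
Proof.
rewrite !openE => oU t /= /oU/nbhs_ballP[e /= e0 eU]; apply/nbhs_ballP; exists e => // s ts.
by apply: eU.
Qed.

(** [A] is the union of the cells contained in it, and a cell is given by a rational, a point of the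
    countable dense set and a radius 1/(n + 1). *)
Lemma measurable_prod_open (A : set prodT) : separable X ->
  (forall p, A p -> exists2 d : R, 0 < d & forall q,
    mdist (p.1 : I) q.1 < d -> mdist (p.2 : X) q.2 < d -> A q) ->
  measurable A.
Proof.
move=> [D cD dD] hA.
have /countable_injP[f finj] := cD.
pose g n : X := xget point [set x | D x /\ f x = n].
have gf x : D x -> g (f x) = x.
  move=> Dx; rewrite /g; case: xgetP => [y _ [Dy fy]|/(_ x)[]//].
  by apply: finj => //; rewrite inE.
pose cell (i : rat * nat * nat) : set prodT :=
  [set p | ball (ratr i.1.1 : R) i.2.+1%:R^-1 (val p.1) /\ mdist (g i.1.2) p.2 < i.2.+1%:R^-1].
have mcell i : measurable (cell i).
  apply: (@measurable_borel_rect [set t | ball (ratr i.1.1 : R) i.2.+1%:R^-1 (val t)]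
    [set y | mdist (g i.1.2) y < i.2.+1%:R^-1]); last exact: open_mdist_ball.
  by apply: open_val_itv; apply: ball_open; rewrite invr_gt0.
pose S (n : nat) : set prodT := if unpickle n is Some i then
  (if `[< cell i `<=` A >] then cell i else set0) else set0.
have -> : A = \bigcup_n S n.
  apply/seteqP; split => [p Ap|p [n _]]; last first.
    by rewrite /S; case: unpickle => [i|//]; case: asboolP => // sub; exact: sub.
  have [d d0 hd] := hA p Ap.
  have [n hn] := inv_nat_lt (divr_gt0 d0 (ltr0n _ 2)).
  set r := n.+1%:R^-1 in hn; have r0 : 0 < r by rewrite invr_gt0.
  have [q qp] : exists q : rat, `|ratr q - val p.1| < r.
    have : val p.1 - r < val p.1 + r by lra.
    move=> /rat_in_itvoo[q]; rewrite in_itv/= => /andP[q1 q2]; exists q.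
    by rewrite ltr_norml; apply/andP; split; [rewrite ltrBrDl|rewrite ltrBlDl].
  have [x [Dx xp]] : exists x, D x /\ mdist x p.2 < r.
    have [|x [/= h Dx]] := dD [set y | mdist p.2 y < r] (ex_intro _ p.2 _) (open_mdist_ball _ _).
      by rewrite /= mdistxx.
    by exists x; split => //; rewrite metric_sym.
  exists (pickle (q, f x, n)); first by [].
  rewrite /S pickleK; case: asboolP => [_|[]].
    by split => //=; rewrite gf.
  move=> p' [/=]; rewrite -/r gf// => h1 h2; apply: hd.
    rewrite mdist_itv; have -> : val p.1 - val p'.1 = (ratr q - val p'.1) - (ratr q - val p.1) by ring.
    have h1' : `|ratr q - val p'.1| < r := h1.
    apply: (le_lt_trans (ler_normB _ _)); lra.
  apply: (le_lt_trans (metric_triangle _ x _)); rewrite metric_sym; lra.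
apply: bigcupT_measurable => n; rewrite /S; case: unpickle => // i.
by case: asboolP.
Qed.

Lemma measurable_prod_metric (Z : pmetricType R) (F : prodT -> Z) : separable X ->
  (forall p (e : R), 0 < e -> exists2 d : R, 0 < d & forall q,
    mdist (p.1 : I) q.1 < d -> mdist (p.2 : X) q.2 < d -> mdist (F p) (F q) < e) ->
  measurable_fun setT (F : prodT -> borel Z).
Proof.
move=> sX hF; apply: measurable_fun_borel => V oV; apply: measurable_prod_open => // p Vp.
have /nbhs_ballP[e /= e0 eV] := open_nbhs_nbhs (conj oV Vp).
have [d d0 hd] := hF p e e0; exists d => // q q1 q2; apply: eV.
by rewrite metric_ballP; exact: hd.
Qed.

End product_borel.

(** * Comparison of the warped distance with the product distance *)

Section warped_metric.
Context {R : realType} (I : closed_itv R) (X : pmetricType R)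
  (m : {measure set (borel X) -> \bar R}) (wd wm : weight I) (W : warped_product m wd wm).
Local Notation mu := (@lebesgue_measure R).
Local Notation leb := (citv_lebesgue (@itv01 R)).
Local Notation prodT := (borel I * borel X)%type.
Local Notation wdist p q := (mdist (wp_map W p : wp_space W) (wp_map W q)).

Lemma ac_curve_cst (Z : pmetricType R) (z : Z) : ac_curve 1 (fun _ : @itv01 R => z).
Proof.
exists (cst 0); split => //.
- by rewrite inE; apply/andP; split; rewrite inE//= /finite_norm Lnorm1 /=;
    under eq_integral do rewrite normr0; rewrite integral0.
- by move=> s t _; rewrite mdistxx; apply: integral_ge0.
Qed.

(** With the first coordinate held at [t], the warped length is [wd t] times the length in X, and
    the length structure supplies curves of nearly minimal length. *)
Lemma wdist_le_horizontal (t : I) (x y : X) : length_space X ->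
  wdist (t, x) (t, y) <= wd t * mdist x y.
Proof.
move=> lX; have w0 := weight_ge0 wd t.
apply/ler_addgt0Pr => e e0; pose e' := e / (wd t + 1).
have w1 : 0 < wd t + 1 by rewrite ltr_wpDl.
have e'0 : 0 < e' by rewrite divr_gt0.
have := lX x y => /eqP; rewrite eq_sym => /eqP inf_eq.
have : (ereal_inf [set ac_length c | c in [set c | [/\ ac_curve 1%:E c, c start01 = x & c end01 = y]]] < (mdist x y + e')%:E)%E.
  by rewrite inf_eq lte_fin ltrDl.
move=> /ereal_inf_lt[_ [c [ac1 c0 c1] <-] lc].
rewrite -lee_fin wp_map_dist.
apply: (@le_trans _ _ (warped_length wd (fun=> t) c)).
  apply: ereal_inf_lbound; exists (fun=> t, c) => //=; split => //=.
  - exact: ac_curve_cst.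
  - by rewrite c0.
  - by rewrite c1.
have -> : warped_length wd (fun=> t) c = ((wd t)%:E * ac_length c)%E.
  pose c' : curve X := mkcts (ac_curve_continuous ac1).
  rewrite /ac_length -ge0_integralZl//.
  - apply: eq_integral => r _; rewrite -EFinM mspeed_cst expr0n add0r; congr EFin.
    by rewrite -exprMn sqrtr_sqr ger0_norm// mulr_ge0// mspeed_ge0.
  - by apply/measurable_EFinP; exact: (measurable_mspeed1 c').
  - by move=> r _; rewrite lee_fin mspeed_ge0.
apply: (@le_trans _ _ ((wd t)%:E * (mdist x y + e')%:E)%E).
  by apply: lee_wpmul2l => //; exact: ltW.
rewrite -EFinM lee_fin mulrDr lerD2l /e' mulrCA ger_pMr//.
by rewrite ler_pdivrMr// mul1r lerDl.
Qed.

Lemma wdist_le_vertical (s t : I) (x : X) : wdist (s, x) (t, x) <= `|val s - val t|.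
Proof.
rewrite -lee_fin wp_map_dist.
pose g (r : @itv01 R) : R := (1 - val r) * val s + val r * val t.
have Ig r : citv_set I (g r).
  have /andP[r0 r1] := itv01P r.
  have [st|/ltW ts] := leP (val s) (val t).
    apply: (citv_interval (set_valP s) (set_valP t)); rewrite /g; apply/andP; split.
      have : 0 <= val r * (val t - val s) by rewrite mulr_ge0// subr_ge0.
      by rewrite mulrBl mulrBr mul1r; lra.
    have : 0 <= (1 - val r) * (val t - val s) by rewrite mulr_ge0// subr_ge0.
    by rewrite !mulrBl !mulrBr !mul1r; lra.
  apply: (citv_interval (set_valP t) (set_valP s)); rewrite /g; apply/andP; split.
    have : 0 <= (1 - val r) * (val s - val t) by rewrite mulr_ge0// subr_ge0.
    by rewrite !mulrBl !mulrBr !mul1r; lra.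
  have : 0 <= val r * (val s - val t) by rewrite mulr_ge0// subr_ge0.
  by rewrite mulrBl mulrBr mul1r; lra.
pose c (r : @itv01 R) : I := to_itv I (g r).
have cE r : val (c r) = g r by rewrite to_itvK.
have dc r r' : mdist (c r) (c r') = `|val s - val t| * `|val r - val r'|.
  rewrite mdist_itv !cE -normrM -normrN; congr (`|_|); rewrite /g; ring.
apply: (@le_trans _ _ (warped_length wd c (fun=> x))).
  apply: ereal_inf_lbound; exists (c, fun=> x) => //=; split => /=.
  - exists (cst `|val s - val t|); split => //.
    + rewrite inE; apply/andP; split; rewrite inE//= /finite_norm Lnorm1 /=.
      under eq_integral do rewrite normr_id.
      rewrite -[X in (integral _ _ X < _)%E]/(cst (`|val s - val t|%:E)) integral_cst//.
      by rewrite [X in (_ * X)%E]citv_lebesgue01 mule1 ltry.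
    + move=> r r' rr'; rewrite dc.
      rewrite integral_itv01//; [|exact/measurable_EFinP/measurable_cst|by move=> ?; rewrite lee_fin].
      rewrite -[X in (_ <= integral _ _ X)%E]/(cst (`|val s - val t|%:E)) integral_cst//.
      by rewrite [X in (_ <= _ * X)%E]lebesgue_measure_oc// -EFinM lee_fin (distrC (val r)) (@ger0_norm _ (val r' - val r)) ?subr_ge0.
  - exact: ac_curve_cst.
  - congr pair; apply: val_inj; rewrite cE /g.
    by rewrite [X in (1 - X) * _ + X * _](_ : _ = 0)// subr0 mul1r mul0r addr0.
  - congr pair; apply: val_inj; rewrite cE /g.
    by rewrite [X in (1 - X) * _ + X * _](_ : _ = 1)// subrr mul1r mul0r add0r.
have cm r : mspeed c r = `|val s - val t|.
  apply: mspeed_lim => e e0; exists 1 => // r' /andP[r0 _].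
  by rewrite /speed_quotient dc mulfK ?gt_eqF// subrr normr0 ltW.
rewrite /warped_length.
under eq_integral => r _.
  rewrite cm mspeed_cst expr0n mulr0 addr0 sqrtr_sqr normr_id.
  over.
rewrite -[X in (integral _ _ X <= _)%E]/(cst (`|val s - val t|%:E)) integral_cst//.
by rewrite [X in (_ * X <= _)%E]citv_lebesgue01 mule1.
Qed.

Lemma wdist_le (p q : prodT) : length_space X ->
  wdist p q <= `|val p.1 - val q.1| + wd p.1 * mdist (p.2 : X) q.2.
Proof.
case: p q => [s x] [t y] lX /=.
apply: (le_trans (metric_triangle _ (wp_map W (s, y) : wp_space W) _)).
by rewrite addrC; apply: lerD; [exact: wdist_le_vertical|exact: wdist_le_horizontal].
Qed.

Lemma measurable_wp_map : separable X -> length_space X -> measurable_fun setT (wp_map W).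
Proof.
move=> sX lX; apply: (@measurable_prod_metric _ I X (wp_space W) (wp_map W)) => // p e e0.
have w1 : 0 < wd p.1 + 1 by rewrite ltr_wpDl// weight_ge0.
exists (Num.min (e / 2) (e / 2 / (wd p.1 + 1))); first by rewrite lt_min !divr_gt0.
move=> q; rewrite !lt_min => /andP[h1 _] /andP[_ h2].
apply: (le_lt_trans (wdist_le _ _ lX)); rewrite -mdist_itv.
have : (wd p.1 + 1) * mdist (p.2 : X) q.2 < e / 2 by rewrite mulrC -ltr_pdivlMr.
by rewrite mulrDl mul1r; have := mdist_ge0 (p.2 : X) q.2; lra.
Qed.

(** A curve nearly realizing the warped distance cannot leave the r-neighbourhood of [p.1], since
    its first component travels no farther than the warped length; there [wd] is at least [ka], so
    the length in X is controlled as well. *)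
Lemma wdist_lower (p q : prodT) (r ka : R) : 0 < ka ->
  (forall t : I, `|val t - val p.1| < r -> ka <= wd t) -> wdist p q < r ->
  `|val q.1 - val p.1| <= wdist p q /\ ka * mdist (p.2 : X) q.2 <= wdist p q.
Proof.
move=> ka0 hka dr.
have key (e : R) : 0 < e -> wdist p q + e < r ->
  `|val q.1 - val p.1| <= wdist p q + e /\ ka * mdist (p.2 : X) q.2 <= wdist p q + e.
  move=> e0 er.
  have : (warped_dist wd p q < (wdist p q + e)%:E)%E by rewrite -(wp_map_dist W) lte_fin ltrDl.
  move=> /ereal_inf_lt[_ [[cI cX] /= [acI acX c0 c1] <-] lc].
  pose kI : curve I := mkcts (ac_curve_continuous acI).
  pose kX : curve X := mkcts (ac_curve_continuous acX).
  have [gI [gI0 gI1 hI]] := acI; have [gX [gX0 gX1 hX]] := acX.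
  have [_ _ dI] := @mspeed_ac R I kI gI gI0 gI1 hI.
  have [_ _ dX] := @mspeed_ac R X kX gX gX0 gX1 hX.
  have mI := measurable_mspeed1 kI; have mX := measurable_mspeed1 kX.
  pose S (s : @itv01 R) := Num.sqrt (mspeed cI s ^+ 2 + wd (cI s) ^+ 2 * mspeed cX s ^+ 2).
  have mS : measurable_fun setT (fun s : borel (@itv01 R) => (S s)%:E).
    apply/measurable_EFinP; apply: (@measurableT_comp _ _ _ _ _ _ (@Num.sqrt R)).
      by apply: continuous_measurable_fun; exact: sqrt_continuous.
    apply: measurable_funD; first exact: measurable_funX.
    apply: measurable_funM; apply: measurable_funX => //.
    apply: (@measurableT_comp _ _ _ _ _ _ (wd : borel I -> R) _ (cI : borel (@itv01 R) -> borel I)).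
      exact: measurable_weight.
    by apply: continuous_borel; exact: ac_curve_continuous.
  have SI s : mspeed cI s <= S s.
    rewrite -[leLHS]ger0_norm ?mspeed_ge0// -sqrtr_sqr ler_wsqrtr// lerDl.
    by rewrite mulr_ge0// sqr_ge0.
  have cI0 : cI start01 = p.1 by rewrite -c0.
  have cX0 : cX start01 = p.2 by rewrite -c0.
  have cI1 : cI end01 = q.1 by rewrite -c1.
  have cX1 : cX end01 = q.2 by rewrite -c1.
  have stay t : `|val (cI t) - val p.1| < wdist p q + e.
    rewrite -lte_fin; apply: le_lt_trans lc.
    rewrite distrC -cI0 -mdist_itv.
    have /andP[t0 _] := itv01P t.
    apply: (le_trans (dI start01 t t0)).
    apply: (@le_trans _ _ (\int[leb]_(s in [set s | (val (@start01 R) <= val s <= val t)%R]) (S s)%:E)%E).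
      apply: ge0_le_integral => //.
      - exact: measurable_itv01_cc.
      - by move=> s _; rewrite lee_fin mspeed_ge0.
      - by apply/measurable_EFinP; exact: measurable_funTS.
      - exact: measurable_funTS.
      - by move=> s _; rewrite lee_fin.
    apply: ge0_subset_integral => //; first exact: measurable_itv01_cc.
    by move=> s _; rewrite lee_fin sqrtr_ge0.
  split; first by rewrite -cI1; exact: ltW (stay _).
  have Sk s : ka * mspeed cX s <= S s.
    have ks : ka <= wd (cI s) by apply: hka; exact: lt_trans (stay s) er.
    rewrite -[leLHS]ger0_norm ?mulr_ge0 ?mspeed_ge0 ?(ltW ka0)// -sqrtr_sqr ler_wsqrtr// exprMn.
    rewrite -[leLHS]add0r lerD ?sqr_ge0// ler_wpM2r ?sqr_ge0//.
    by rewrite ler_pXn2r// nnegrE ?(ltW ka0)// (le_trans (ltW ka0)).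
  rewrite -lee_fin; apply: (@le_trans _ _ (\int[leb]_s (S s)%:E)%E); last exact: ltW.
  rewrite EFinM; apply: (@le_trans _ _ (ka%:E * \int[leb]_s (mspeed cX s)%:E)%E).
    apply: lee_wpmul2l; first by rewrite lee_fin ltW.
    rewrite -cX0 -cX1.
    have /andP[s0 s1] := itv01P (@end01 R).
    apply: (le_trans (dX start01 end01 s0)).
    apply: ge0_subset_integral => //; first exact: measurable_itv01_cc.
    - by apply/measurable_EFinP.
    - by move=> s _; rewrite lee_fin mspeed_ge0.
  rewrite -ge0_integralZl//.
  - apply: ge0_le_integral => //.
    + by move=> s _; rewrite mule_ge0// lee_fin ?mspeed_ge0// ltW.
    + by apply: measurable_funeM; exact/measurable_EFinP.
    + by move=> s _; rewrite -EFinM lee_fin.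
  - exact/measurable_EFinP.
  - by move=> s _; rewrite lee_fin mspeed_ge0.
  - by rewrite lee_fin ltW.
split; apply/ler_addgt0Pr => e e0.
- have e'0 : 0 < Num.min e ((r - wdist p q) / 2) by rewrite lt_min e0 divr_gt0// subr_gt0.
  have er : wdist p q + Num.min e ((r - wdist p q) / 2) < r.
    rewrite -ltrBrDl gt_min; apply/orP; right; lra.
  have [h _] := key _ e'0 er; apply: (le_trans h); rewrite lerD2l ge_min lexx//.
- have e'0 : 0 < Num.min e ((r - wdist p q) / 2) by rewrite lt_min e0 divr_gt0// subr_gt0.
  have er : wdist p q + Num.min e ((r - wdist p q) / 2) < r.
    rewrite -ltrBrDl gt_min; apply/orP; right; lra.
  have [_ h] := key _ e'0 er; apply: (le_trans h); rewrite lerD2l ge_min lexx//.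
Qed.

End warped_metric.

(* Doob-Dynkin: a function measurable with respect to the preimages of a map factors through it. *)
Lemma measurable_factor d d' (T : measurableType d) (U : measurableType d') (R : realType)
    (O : set T) (p : T -> U) (g : T -> R) :
  (forall q : rat, exists2 B, measurable B & forall x, O x -> (B (p x) <-> g x < ratr q)) ->
  exists2 G : U -> R, measurable_fun setT G & forall x, O x -> G (p x) = g x.
Proof.
move=> hB; have [B hB'] := choice (fun q => let: ex_intro2 B mB hB := hB q in ex_intro _ B (conj mB hB)).
(* [g x] is the infimum of the rationals above it; rationals whose set misses the image point
   contribute +oo. *)
pose h (n : nat) (u : U) : \bar R := if unpickle n is Some q then
  (if u \in B q then (ratr q)%:E else +oo%E) else +oo%E.
have mh n : measurable_fun setT (h n).
  rewrite /h; case: unpickle => [q|]; last exact: measurable_cst.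
  apply: measurable_fun_ifT => //.
  have [mB _] := hB' q.
  by apply: (@measurable_fun_bool _ _ _ _ true); rewrite setTI (_ : _ @^-1` _ = B q)//;
    apply/seteqP; split => u /=; [move/set_mem|move/mem_set].
exists (fun u => fine (einfs (h ^~ u) 0)).
  by apply: measurableT_comp => //; exact: measurable_fun_einfs.
move=> x Ox.
suff -> : einfs (h ^~ (p x)) 0 = (g x)%:E by [].
apply: le_anti; apply/andP; split.
- apply/lee_addgt0Pr => e e0.
  have : g x < g x + e by rewrite ltrDl.
  move=> /rat_in_itvoo[q]; rewrite in_itv/= => /andP[q1 q2].
  have [_ /(_ x Ox) hq] := hB' q.
  apply: (@le_trans _ _ (ratr q)%:E); last by rewrite -EFinD lee_fin ltW.
  apply: ereal_inf_lbound; exists (pickle q); first by [].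
  by rewrite /h pickleK mem_set//; exact/hq.
- apply: le_ereal_inf_tmp => _ [n _ <-]; rewrite /h; case: unpickle => [q|]; last by rewrite leey.
  case: ifPn => [/set_mem Bq|_]; last by rewrite leey.
  by have [_ /(_ x Ox) hq] := hB' q; rewrite lee_fin ltW//; exact/hq.
Qed.

(** * Descent of functions to the warped product *)

Section warped_factor.
Context {R : realType} (I : closed_itv R) (X : pmetricType R)
  (m : {measure set (borel X) -> \bar R}) (wd wm : weight I) (W : warped_product m wd wm).
Local Notation prodT := (borel I * borel X)%type.
Local Notation wdist p q := (mdist (wp_map W p : wp_space W) (wp_map W q)).

(** Over {wd > 0} the map to the warped product is injective with continuous inverse. Near such a
    point [wd] stays above half its value, and [wdist_lower] applies. *)
Lemma wdist_separates (p : prodT) (e : R) : 0 < wd p.1 -> 0 < e -> exists2 d : R, 0 < d &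
  forall q, wdist p q < d ->
    [/\ mdist (p.1 : I) q.1 < e, mdist (p.2 : X) q.2 < e & 0 < wd q.1].
Proof.
move=> w0 e0; have w20 : 0 < wd p.1 / 2 by rewrite divr_gt0.
have := @weight_continuous _ _ wd p.1.
move=> /(_ _ (nbhsx_ballx _ _ w20))/nbhs_ballP[r /= r0 hr].
have hka (t : I) : `|val t - val p.1| < r -> wd p.1 / 2 <= wd t.
  move=> tp; have h : `|wd p.1 - wd t| < wd p.1 / 2.
    by apply: hr; change (`|val p.1 - val t| < r); rewrite distrC.
  have key (a b : R) : a - b < a / 2 -> a / 2 <= b by lra.
  by move: h; rewrite ltr_norml => /andP[_ h]; exact: key.
exists (Num.min r (Num.min e (e * (wd p.1 / 2)))).
  by rewrite !lt_min r0 e0 mulr_gt0.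
move=> q; rewrite !lt_min => /and3P[dr de dk].
have [h1 h2] := wdist_lower w20 hka dr; split.
- by rewrite mdist_itv distrC; exact: le_lt_trans de.
- by rewrite -(ltr_pM2l w20); apply: (le_lt_trans h2); rewrite mulrC.
- by apply: lt_le_trans w20 (hka _ _); exact: le_lt_trans h1 dr.
Qed.

Let O : set prodT := [set p | 0 < wd p.1].

(** [V] is a union of balls for the warped distance, around the points of [A] over {wd > 0}, with
    radii so small that every image point in a ball comes from that set. *)
Let open_trace (A : set prodT) :
  (forall p, A p -> exists2 e : R, 0 < e & forall q, mdist (p.1 : I) q.1 < e -> mdist (p.2 : X) q.2 < e -> A q) ->
  exists2 V : set (wp_space W), open V & forall p, V (wp_map W p) <-> A p /\ O p.
Proof.
move=> hA.
have ex p : exists d : R, A p /\ O p -> 0 < d /\ forall q, wdist p q < d -> A q /\ O q.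
  have [[Ap Op]|] := pselect (A p /\ O p); last by exists 0.
  have [e e0 he] := hA p Ap; have [d d0 hd] := wdist_separates Op e0.
  by exists d => _; split => // q /hd[h1 h2 h3]; split => //; exact: he.
have [d hd] := choice ex.
exists (\bigcup_(p in [set p | A p /\ O p]) [set z | mdist (wp_map W p : wp_space W) z < d p]).
  by apply: bigcup_open => p _; exact: open_mdist_ball.
move=> q; split=> [[p /= hp]|hq]; first by case: (hd p hp) => _; apply.
by exists q => //=; rewrite mdistxx; case: (hd q hq).
Qed.

(** The sets that, over {wd > 0}, are preimages of Borel sets of the warped product. They form a
    sigma-algebra, and working with preimages avoids asking whether images of Borel sets are
    Borel. *)
Definition traces : set (set prodT) := [set A | exists2 B : set (borel (wp_space W)),
  measurable B & forall p, O p -> (B (wp_map W p) <-> A p)].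

Let traces_open (A : set prodT) :
  (forall p, A p -> exists2 e : R, 0 < e & forall q, mdist (p.1 : I) q.1 < e -> mdist (p.2 : X) q.2 < e -> A q) ->
  traces A.
Proof.
move=> /open_trace[V oV hV]; exists V; first exact: sub_sigma_algebra.
by move=> p Op; split=> [/hV[]//|Ap]; exact/hV.
Qed.

Let traces_sigma : sigma_algebra setT traces.
Proof.
split.
- by exists set0.
- move=> A [B mB hB]; exists (~` B); first exact: measurableC.
  move=> p Op; rewrite setTD; split => /= h h'; apply: h; exact/hB.
- move=> F hF.
  have [B hB] := choice (fun n => let: ex_intro2 B mB hB := hF n in ex_intro _ B (conj mB hB)).
  exists (\bigcup_n B n).
    by apply: bigcupT_measurable => n; case: (hB n).
  by move=> p Op; split => -[n _ h]; exists n => //; apply/(hB n).2.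
Qed.

Lemma measurable_traces (A : set prodT) : measurable A -> traces A.
Proof.
move=> mA; apply: mA; split; first exact: traces_sigma.
move=> B [|].
- move=> [C mC <-]; rewrite setTI.
  have : [set C | traces (fst @^-1` C)] C.
    apply: mC; split.
      split.
      + by rewrite /= preimage_set0; case: traces_sigma.
      + by move=> D /= hD; rewrite setTD preimage_setC -setTD; case: traces_sigma => _ + _; apply.
      + by move=> F hF /=; rewrite preimage_bigcup; case: traces_sigma => _ _; apply.
    move=> U oU /=; apply: traces_open => p Up.
    have /nbhs_ballP[e /= e0 eU] := open_nbhs_nbhs (conj oU Up).
    by exists e => // q q1 _; apply: eU; rewrite metric_ballP.
  by [].
- move=> [C mC <-]; rewrite setTI.
  have : [set C | traces (snd @^-1` C)] C.
    apply: mC; split.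
      split.
      + by rewrite /= preimage_set0; case: traces_sigma.
      + by move=> D /= hD; rewrite setTD preimage_setC -setTD; case: traces_sigma => _ + _; apply.
      + by move=> F hF /=; rewrite preimage_bigcup; case: traces_sigma => _ _; apply.
    move=> U oU /=; apply: traces_open => p Up.
    have /nbhs_ballP[e /= e0 eU] := open_nbhs_nbhs (conj oU Up).
    by exists e => // q _ q2; apply: eU; rewrite metric_ballP.
  by [].
Qed.

(** Over {wd > 0} the function factors because all its sublevel sets are traces. Where [wd]
    vanishes, points of a fibre may be identified, and [g] is 0 there; the indicator of an open set
    realizes this value. *)
Lemma warped_factor (g : prodT -> R) : measurable_fun setT g -> (forall p, wd p.1 = 0 -> g p = 0) ->
  exists2 G : borel (wp_space W) -> R, measurable_fun setT G & forall p, G (wp_map W p) = g p.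
Proof.
move=> mg g0.
have [G mG hG] : exists2 G : borel (wp_space W) -> R, measurable_fun setT G &
    forall p, O p -> G (wp_map W p) = g p.
  apply: measurable_factor => q; apply: measurable_traces.
  have := mg measurableT `]-oo, ratr q[%classic (measurable_itv _).
  by rewrite setTI (_ : _ @^-1` _ = [set p | g p < ratr q])//; apply/seteqP; split => p /=; rewrite in_itv.
have [V oV hV] : exists2 V : set (wp_space W), open V & forall p, V (wp_map W p) <-> setT p /\ O p.
  by apply: open_trace => p _; exists 1.
have mV : measurable (V : set (borel (wp_space W))) by exact: sub_sigma_algebra.
exists (fun z => G z * \1_(V : set (borel (wp_space W))) z).
  by apply: measurable_funM => //; exact: measurable_indic.
move=> p; rewrite indicE; have [Op|nOp] := pselect (O p).
  by rewrite mem_set ?mulr1 ?hG//; exact/hV.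
rewrite memNset ?mulr0; last by move=> /hV[].
rewrite g0//; apply: le_anti; rewrite weight_ge0 andbT leNgt; exact/negP.
Qed.

End warped_factor.

(** * Cutoff functions *)

Section interval_cutoffs.
Context {R : realType} (I : closed_itv R).
Local Notation mu := (@lebesgue_measure R).
Implicit Types (eta k : borel I -> R).

(** The constant [L] serves for absolute continuity along curves, while the energy of the cutoff is
    measured by [k]. *)
Definition cutoff_data eta k (L : R) := [/\ forall t, 0 <= eta t <= 1,
  0 <= L /\ forall s t : I, `|eta s - eta t| <= L * mdist s t,
  forall t, 0 <= k t, measurable_fun setT k & @pt_slope R I eta k].

Lemma pt_slopeD eta k eta' k' : @pt_slope R I eta k -> @pt_slope R I eta' k' ->
  @pt_slope R I (fun t => eta t + eta' t) (fun t => k t + k' t).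
Proof.
move=> h h' z; have [d d0 hd] := h z; have [d' d'0 hd'] := h' z.
exists (Num.min d d'); first by rewrite lt_min d0.
move=> t; rewrite lt_min => /andP[/hd h1 /hd' h2]; rewrite mulrDl.
by rewrite opprD addrACA; apply: (le_trans (ler_normD _ _)); exact: lerD.
Qed.

Lemma pt_slope_cst (a : R) : @pt_slope R I (fun=> a) (fun=> 0).
Proof. by move=> z; exists 1 => // t _; rewrite subrr normr0 mul0r. Qed.

Lemma pt_slopeZ (a : R) eta k : 0 <= a -> @pt_slope R I eta k ->
  @pt_slope R I (fun t => a * eta t) (fun t => a * k t).
Proof.
move=> a0 h z; have [d d0 hd] := h z; exists d => // t /hd h1.
by rewrite -mulrBr normrM ger0_norm// -mulrA ler_wpM2l.
Qed.

Lemma pt_slope_sum n (eta k : nat -> borel I -> R) : (forall j, @pt_slope R I (eta j) (k j)) ->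
  @pt_slope R I (fun t => \sum_(j < n) eta j t) (fun t => \sum_(j < n) k j t).
Proof.
move=> h; elim: n => [|n ih].
  rewrite (_ : (fun t => _) = fun=> 0); last by apply/funext => t; rewrite big_ord0.
  by rewrite (_ : (fun t => \sum_(j < 0) k j t) = fun=> 0); [exact: pt_slope_cst|apply/funext => t; rewrite big_ord0].
have := pt_slopeD ih (h n).
by congr pt_slope; apply/funext => t; rewrite big_ord_recr.
Qed.

Lemma cutoff_data1 : cutoff_data (fun=> 1) (fun=> 0) 0.
Proof.
split => //; first by move=> t; rewrite ler01 lexx.
- by split => // s t; rewrite subrr normr0 mul0r.
- exact: pt_slope_cst.
Qed.

Lemma cutoff_dataM eta k L eta' k' L' : cutoff_data eta k L -> cutoff_data eta' k' L' ->
  cutoff_data (fun t => eta t * eta' t) (fun t => k t + k' t) (L + L').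
Proof.
move=> [e1 [L0 eL] k0 mk ek] [e1' [L0' eL'] k0' mk' ek'].
have key (s t : I) : `|eta s * eta' s - eta t * eta' t| <= `|eta s - eta t| + `|eta' s - eta' t|.
  have -> : eta s * eta' s - eta t * eta' t = (eta s - eta t) * eta' s + eta t * (eta' s - eta' t) by ring.
  apply: (le_trans (ler_normD _ _)); rewrite !normrM; apply: lerD.
    by rewrite ler_piMr// ger0_norm; have /andP[] := e1' s.
  by rewrite ler_piMl// ger0_norm; have /andP[] := e1 t.
split.
- move=> t; have /andP[a0 a1] := e1 t; have /andP[b0 b1] := e1' t.
  by rewrite mulr_ge0//= mulr_ile1.
- split; first exact: addr_ge0.
  by move=> s t; apply: (le_trans (key s t)); rewrite mulrDl lerD.
- by move=> t; rewrite addr_ge0.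
- exact: measurable_funD.
- move=> z; have [d d0 hd] := ek z; have [d' d'0 hd'] := ek' z.
  exists (Num.min d d'); first by rewrite lt_min d0.
  move=> t; rewrite lt_min => /andP[/hd h1 /hd' h2]; rewrite mulrDl.
  by apply: (le_trans (key _ _)); exact: lerD.
Qed.

Lemma measurable_cutoff_data eta k L : cutoff_data eta k L -> measurable_fun setT eta.
Proof.
move=> [_ [L0 eL] _ _ _]; apply: continuous_borelR; apply: continuousR_eps => t e e0.
have L1 : 0 < L + 1 by rewrite ltr_wpDl.
apply/nbhs_ballP; exists (e / (L + 1)); first by rewrite /= divr_gt0.
move=> s; rewrite metric_ballP ltr_pdivlMr// mulrC => h.
apply: (le_lt_trans (eL t s)); apply: le_lt_trans h.
by rewrite ler_wpM2r ?mdist_ge0// lerDl.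
Qed.

Definition clamp_unit (x : R) : R := Num.max 0 (Num.min 1 x).

Lemma clamp_unit_lip x y : `|clamp_unit x - clamp_unit y| <= `|x - y|.
Proof.
wlog xy : x y / x <= y.
  move=> h; have [|yx] := leP x y; first exact: h.
  by rewrite distrC [leRHS]distrC; apply: h; exact: ltW.
rewrite distrC [leRHS]distrC [leRHS]ger0_norm ?subr_ge0//.
by have /andP[h1 h2] := clamp_real_le (@ler01 R) xy; rewrite ger0_norm.
Qed.

Lemma clamp_unit01 x : 0 <= clamp_unit x <= 1.
Proof. by rewrite /clamp_unit le_max lexx/= ge_max ler01/= ge_min lexx. Qed.

Lemma clamp_unit_ge1 x : 1 <= x -> clamp_unit x = 1.
Proof. by move=> x1; rewrite /clamp_unit min_l// max_r. Qed.

Lemma clamp_unit_le0 x : x <= 0 -> clamp_unit x = 0.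
Proof. by move=> x0; rewrite /clamp_unit max_l// ge_min x0 orbT. Qed.

Lemma measurable_val_cc (D : R -> R) (a b : R) : continuous D ->
  measurable ([set t | (a <= D (val t) <= b)%R] : set (borel I)).
Proof.
move=> cD; rewrite (_ : mkset _ = (D \o (val : borel I -> R)) @^-1` `[a, b]).
  rewrite -[X in measurable X]setTI; suff : measurable_fun setT (D \o (val : borel I -> R)) by apply.
  by apply: measurableT_comp; [exact: continuous_measurable_fun|exact: measurable_val_itv].
by apply/seteqP; split => x /=; rewrite in_itv.
Qed.

(* [D] is a 1-Lipschitz distance-like function, and the ramp rises from 0 at [D <= a] to 1 at [a + r <= D]. *)
Lemma ramp_cutoff (D : R -> R) (a r : R) : (forall x y, `|D x - D y| <= `|x - y|) -> 0 < r ->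
  cutoff_data (fun t => clamp_unit ((D (val t) - a) / r))
    (fun t => r^-1 * \1_([set t | (a <= D (val t) <= a + r)%R] : set (borel I)) t) r^-1.
Proof.
move=> DL r0; have ri0 : 0 < r^-1 by rewrite invr_gt0.
have cD : continuous D.
  move=> x; apply/cvgrPdist_lt => e e0; apply/nbhs_ballP; exists e => // y xy.
  exact: le_lt_trans (DL _ _) xy.
have lip (s t : I) : `|clamp_unit ((D (val s) - a) / r) - clamp_unit ((D (val t) - a) / r)| <= r^-1 * mdist s t.
  apply: (le_trans (clamp_unit_lip _ _)).
  have -> : (D (val s) - a) / r - (D (val t) - a) / r = r^-1 * (D (val s) - D (val t)) by ring.
  by rewrite normrM ger0_norm ?(ltW ri0)// ler_pM2l.
split.
- by move=> t; exact: clamp_unit01.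
- by split; [exact: ltW|].
- by move=> t; rewrite mulr_ge0 ?(ltW ri0)// indicE.
- by apply: measurable_funM => //; apply: measurable_indic; exact: measurable_val_cc.
(* The annulus is closed, so the kinks of the ramp belong to it and the ramp is locally constant off
   it. *)
- move=> z; rewrite indicE.
  have [h|h] := boolP (z \in [set t | (a <= D (val t) <= a + r)%R]).
    by exists 1 => // t _; rewrite mulr1; exact: lip.
  have {h} : ~ (a <= D (val z) <= a + r) by move=> h'; move/negP : h; apply; rewrite inE.
  move/negP; rewrite negb_and -!ltNge => /orP[za|za].
    exists (a - D (val z)); first by rewrite subr_gt0.
    move=> t; rewrite mdist_itv => tz; rewrite mulr0 mul0r.
    have := le_lt_trans (DL _ _) tz; rewrite ltr_norml => /andP[_ h].
    rewrite !clamp_unit_le0 ?subrr ?normr0//.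
      by rewrite pmulr_lle0// subr_le0 ltW.
    by rewrite pmulr_lle0// subr_le0; lra.
  exists (D (val z) - (a + r)); first by rewrite subr_gt0.
  move=> t; rewrite mdist_itv => tz; rewrite mulr0 mul0r.
  have := le_lt_trans (DL _ _) tz; rewrite ltr_norml => /andP[h _].
  rewrite !clamp_unit_ge1 ?subrr ?normr0//.
    by rewrite ler_pdivlMr// mul1r; lra.
  by rewrite ler_pdivlMr// mul1r; lra.
Qed.

Lemma cutoff_data_avg n (eta k : nat -> borel I -> R) (L : nat -> R) :
  (forall j, cutoff_data (eta j) (k j) (L j)) ->
  cutoff_data (fun t => n.+1%:R^-1 * \sum_(j < n.+1) eta j t)
    (fun t => n.+1%:R^-1 * \sum_(j < n.+1) k j t) (n.+1%:R^-1 * \sum_(j < n.+1) L j).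
Proof.
move=> h; have n0 : 0 <= n.+1%:R^-1 :> R by rewrite invr_ge0.
split.
- move=> t; rewrite mulr_ge0 ?sumr_ge0//=; last by move=> j _; have [/(_ t)/andP[]] := h j.
  rewrite ler_pdivrMl// mulr1.
  apply: (@le_trans _ _ (\sum_(j < n.+1) 1)).
    by apply: ler_sum => j _; have [/(_ t)/andP[]] := h j.
  by rewrite sumr_const card_ord.
- split; first by rewrite mulr_ge0// sumr_ge0// => j _; have [_ []] := h j.
  move=> s t; rewrite -mulrBr normrM ger0_norm// -mulrA; apply: ler_wpM2l => //.
  rewrite -sumrB mulr_suml; apply: (le_trans (ler_norm_sum _ _ _)).
  by apply: ler_sum => j _; have [_ [_]] := h j.
- by move=> t; rewrite mulr_ge0// sumr_ge0// => j _; have [_ _] := h j.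
- apply: measurable_funM => //; apply: measurable_sum => j.
  by have [] := h j.
- by apply: pt_slopeZ => //; apply: pt_slope_sum => j; have [] := h j.
Qed.

End interval_cutoffs.

(** * Cutoffs of small energy near the zeros of the weight *)

Section zero_cutoffs.
Context {R : realType} (I : closed_itv R) (w : weight I).
Local Notation mu := (@lebesgue_measure R).
Implicit Types (eta k : borel I -> R).
Local Notation wm := (weighted_lebesgue w).

Lemma citv_lebesgue_le (A : set (borel I)) (a b : R) : measurable A -> a <= b ->
  (forall t, A t -> a <= val t <= b) -> (citv_lebesgue I A <= (b - a)%:E)%E.
Proof.
move=> mA ab hA; apply: (@le_trans _ _ (mu `[a, b]%classic)).
  apply: le_measure; rewrite ?inE//; first exact: measurable_citv_image.
  by move=> _ [t At <-]; rewrite /= in_itv/=; exact: hA.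
by rewrite lebesgue_measure_itv/= lte_fin; case: ltP => // h; rewrite lee_fin; lra.
Qed.

Lemma weighted_lebesgue_le (A : set (borel I)) (a b c : R) : measurable A -> a <= b -> 0 <= c ->
  (forall t, A t -> a <= val t <= b) -> (forall t, A t -> w t <= c) ->
  (wm A <= (c * (b - a))%:E)%E.
Proof.
move=> mA ab c0 hA wA; apply: (@le_trans _ _ (c%:E * citv_lebesgue I A)%E); last first.
  by rewrite EFinM; apply: lee_wpmul2l; [rewrite lee_fin|exact: citv_lebesgue_le].
rewrite -(integral_cst (citv_lebesgue I) mA c%:E); apply: ge0_le_integral => //.
- by move=> t _; rewrite lee_fin weight_ge0.
- by apply: measurable_funTS; apply/measurable_EFinP; exact: measurable_weight.
Qed.

(* A ramp on an annulus r <= |t - z| <= 2r costs an energy O(1), whatever r; the average of n ramps on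
   disjoint annuli costs O(1/n). *)
Lemma zero_cutoff (z : I) (C rho e : R) : (forall t, w t <= C * `|val t - val z|) -> 0 < rho -> 0 < e ->
  exists zeta k L, [/\ cutoff_data zeta k L,
    exists2 d : R, 0 < d & forall t : I, `|val t - val z| < d -> zeta t = 0,
    forall t : I, rho <= `|val t - val z| -> zeta t = 1 &
    (\int[wm]_t (k t ^+ 2)%:E <= e%:E)%E].
Proof.
move=> hw rho0 e0.
pose C1 := `|C| + 1; have C10 : 0 < C1 by rewrite ltr_wpDl.
have hw1 t : w t <= C1 * `|val t - val z|.
  by apply: (le_trans (hw t)); apply: ler_wpM2r => //; have := ler_norm C; rewrite /C1; lra.
(* The ratio 4 keeps the closed annuli from [r j] to [2 * r j] disjoint, and the exponent j + 1 puts
   the outermost one within distance rho / 2. *)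
pose r (j : nat) : R := rho / 4 ^+ j.+1.
have r0 j : 0 < r j by rewrite divr_gt0// exprn_gt0.
have rS j : r j.+1 = r j / 4 by rewrite /r exprS invfM mulrCA mulrC.
have rle i j : (i <= j)%N -> r j <= r i.
  move=> /subnK <-; elim: (j - i)%N => [//|q ih]; rewrite addSn rS.
  by apply: le_trans ih; rewrite ler_pdivrMr//; have := r0 (q + i)%N; lra.
have rlt i j : (i < j)%N -> 2 * r j < r i.
  by move=> /rle; rewrite rS => h; have := r0 i; lra.
pose D (x : R) := `|x - val z|.
have DL x y : `|D x - D y| <= `|x - y|.
  apply: (le_trans (ler_dist_dist _ _)).
  by rewrite [X in `|X| <= _](_ : _ = x - y)//; ring.
pose A j : set (borel I) := [set t | (r j <= D (val t) <= r j + r j)%R].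
have cD : continuous D.
  move=> x; apply/cvgrPdist_lt => q q0; apply/nbhs_ballP; exists q => // y xy.
  exact: le_lt_trans (DL _ _) xy.
have mA j : measurable (A j) by exact: measurable_val_cc.
pose eta j (t : borel I) := clamp_unit ((D (val t) - r j) / r j).
pose k j (t : borel I) := (r j)^-1 * \1_(A j) t.
have dj j : cutoff_data (eta j) (k j) (r j)^-1 by exact: ramp_cutoff.
(* On the annulus [w] is at most 2 C1 r, inside an interval of length 4 r; the resulting r^2 cancels
   the square of the slope 1 / r. *)
have wA j : (wm (A j) <= (8 * C1 * r j ^+ 2)%:E)%E.
  have -> : 8 * C1 * r j ^+ 2 = (C1 * (2 * r j)) * ((val z + 2 * r j) - (val z - 2 * r j)) by ring.
  have rj := r0 j.
  apply: weighted_lebesgue_le => //.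
  - lra.
  - by rewrite mulr_ge0 ?(ltW C10)// mulr_ge0// ltW.
  - move=> t /andP[_ h2].
    have : `|val t - val z| <= 2 * r j by have := h2; rewrite /D; lra.
    by rewrite ler_norml => /andP[? ?]; apply/andP; split; lra.
  - move=> t /andP[_ h2]; apply: (le_trans (hw1 t)).
    by apply: ler_wpM2l; [exact: ltW|move: h2; rewrite /D; lra].
have kk i j t : i != j -> k i t * k j t = 0.
  wlog ij : i j / (i < j)%N.
    move=> h; rewrite neq_ltn => /orP[ij|ij]; first by rewrite h// neq_ltn ij.
    by rewrite mulrC h// neq_ltn ij.
  move=> _; rewrite /k !indicE.
  have [/set_mem/andP[h1 h2]|] := boolP (t \in A i); last by rewrite mulr0 mul0r.
  have [/set_mem/andP[h3 h4]|] := boolP (t \in A j); last by rewrite !mulr0.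
  by have := rlt _ _ ij; lra.
have [n hn] : exists n : nat, 8 * C1 / e < n.+1%:R.
  have [n hn] := inv_nat_lt (divr_gt0 e0 (mulr_gt0 (ltr0n R 8) C10)); exists n.
  rewrite -[ltRHS]invrK -[ltLHS]invrK ltf_pV2 ?posrE ?invr_gt0 ?divr_gt0 ?mulr_gt0//.
  by rewrite invf_div.
exists (fun t => n.+1%:R^-1 * \sum_(j < n.+1) eta j t).
exists (fun t => n.+1%:R^-1 * \sum_(j < n.+1) k j t).
exists (n.+1%:R^-1 * \sum_(j < n.+1) (r j)^-1); split.
- exact: (cutoff_data_avg n dj).
- exists (r n) => // t td; rewrite big1 ?mulr0// => j _.
  rewrite /eta clamp_unit_le0// pmulr_lle0 ?invr_gt0// subr_le0.
  by apply/ltW/(lt_le_trans td)/rle; rewrite -ltnS.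
- move=> t td; rewrite (eq_bigr (fun=> 1)); last first.
    move=> j _; rewrite /eta clamp_unit_ge1// ler_pdivlMr// mul1r /D.
    have h0 : r 0%N = rho / 4 by rewrite /r expr1.
    have := rle 0%N j (leq0n _); rewrite h0; lra.
  by rewrite sumr_const card_ord mulVf.
(* The annuli are disjoint, so mixed products vanish in the square of the sum; each of the n + 1
   remaining terms costs at most 8 C1 / (n + 1)^2. *)
- have kE t : ((n.+1%:R^-1 * \sum_(j < n.+1) k j t) ^+ 2)%:E =
      (\sum_(j < n.+1) ((n.+1%:R ^- 2 * (r j) ^- 2)%:E * (\1_(A j) t)%:E))%E.
    under [RHS]eq_bigr do rewrite -EFinM.
    rewrite sumEFin; congr EFin; rewrite exprMn exprVn expr2 -[RHS]mulr1.
    rewrite [in LHS]expr2 big_distrlr/= mulr1.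
    rewrite mulr_sumr; apply: eq_bigr => i _.
    rewrite (bigD1 i)//= big1 ?addr0; last by move=> j; rewrite eq_sym => /kk ->.
    have -> : k i t * k i t = r i ^- 2 * \1_(A i) t.
      by rewrite /k !indicE; case: (t \in A i); rewrite ?mulr1 ?mulr0// -invfM expr2.
    by rewrite mulrA -expr2.
  under eq_integral do rewrite kE.
  rewrite ge0_integral_sum//; last 2 first.
  + move=> j; apply: measurable_funeM; apply/measurable_EFinP; exact: measurable_indic.
  + move=> j t _; rewrite mule_ge0// lee_fin ?mulr_ge0 ?invr_ge0 ?sqr_ge0//.
  apply: (@le_trans _ _ (\sum_(j < n.+1) (n.+1%:R ^- 2 * (8 * C1))%:E)%E).
    apply: lee_sum => j _.
    rewrite ge0_integralZl//; last 2 first.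
    * by apply/measurable_EFinP; exact: measurable_indic.
    * by rewrite lee_fin mulr_ge0// invr_ge0 sqr_ge0.
    rewrite integral_indic// setIT.
    apply: (@le_trans _ _ ((n.+1%:R ^- 2 * (r j) ^- 2)%:E * (8 * C1 * r j ^+ 2)%:E)%E).
      by apply: lee_wpmul2l; [rewrite lee_fin mulr_ge0// invr_ge0 sqr_ge0|exact: wA].
    rewrite -EFinM lee_fin -[leLHS]mulrA [(r j ^- 2) * _]mulrC mulfK//.
    by rewrite expf_neq0// gt_eqF.
  rewrite sumEFin lee_fin sumr_const card_ord -[leLHS]mulr_natl.
  have key (N K : R) : N != 0 -> N * (N ^- 2 * K) = K / N by move=> ?; field.
  rewrite key ?pnatr_eq0//.
  by rewrite ler_pdivrMr// -ler_pdivrMl// [leLHS]mulrC ltW.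
Qed.

Lemma zeros_cutoff (s : seq I) (C rho e : R) :
  (forall z t, z \in s -> w t <= C * `|val t - val z|) -> 0 < rho -> 0 < e ->
  exists zeta k L, [/\ cutoff_data zeta k L,
    exists2 d : R, 0 < d & forall z t : I, z \in s -> `|val t - val z| < d -> zeta t = 0,
    forall t : I, (forall z, z \in s -> rho <= `|val t - val z|) -> zeta t = 1 &
    (\int[wm]_t (k t ^+ 2)%:E <= e%:E)%E].
Proof.
move=> + rho0; elim: s e => [|z s ih] e hw e0.
  exists (fun=> 1), (fun=> 0), 0; split => //.
  - exact: cutoff_data1.
  - by exists 1.
  - by under eq_integral do rewrite expr0n; rewrite integral0 lee_fin ltW.
(* Two energies e / 4, doubled by the bound on the square of a sum, give e. *)
have e40 : 0 < e / 4 by rewrite divr_gt0.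
have [|zeta1 [k1 [L1 [c1 [d1 d10 z1] o1 i1]]]] := ih (e / 4) _ e40.
  by move=> z' t z's; apply: hw; rewrite inE z's orbT.
have [|zeta2 [k2 [L2 [c2 [d2 d20 z2] o2 i2]]]] := @zero_cutoff z C rho (e / 4) _ rho0 e40.
  by move=> t; apply: hw; rewrite inE eqxx.
exists (fun t => zeta1 t * zeta2 t), (fun t => k1 t + k2 t), (L1 + L2); split.
- exact: cutoff_dataM.
- exists (Num.min d1 d2); first by rewrite lt_min d10.
  move=> z' t; rewrite inE lt_min => /predU1P[->|z's] /andP[h1 h2].
    by rewrite z2// mulr0.
  by rewrite (z1 z')// mul0r.
- move=> t ht; rewrite o1 ?o2 ?mulr1//; first by apply: ht; rewrite inE eqxx.
  by move=> z' z's; apply: ht; rewrite inE z's orbT.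
- have [_ _ _ mk1 _] := c1; have [_ _ _ mk2 _] := c2.
  have m1 : measurable_fun setT (fun t => (k1 t ^+ 2)%:E) by apply/measurable_EFinP; exact: measurable_funX.
  have m2 : measurable_fun setT (fun t => (k2 t ^+ 2)%:E) by apply/measurable_EFinP; exact: measurable_funX.
  apply: (@le_trans _ _ (\int[wm]_t (2%:E * ((k1 t ^+ 2)%:E + (k2 t ^+ 2)%:E)))%E).
    apply: ge0_le_integral => //.
    - by move=> t _; rewrite lee_fin sqr_ge0.
    - by apply/measurable_EFinP; apply: measurable_funX; exact: measurable_funD.
    - by apply: measurable_funeM; exact: emeasurable_funD.
    - by move=> t _; rewrite -EFinD -EFinM lee_fin; exact: sqrD_le.
  rewrite ge0_integralZl//; [|exact: emeasurable_funD|by move=> t _; rewrite -EFinD lee_fin addr_ge0 ?sqr_ge0].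
  rewrite ge0_integralD//; try by move=> t _; rewrite lee_fin sqr_ge0.
  apply: (@le_trans _ _ (2%:E * ((e / 4)%:E + (e / 4)%:E))%E).
    by apply: lee_wpmul2l => //; exact: leeD.
  by rewrite -EFinD -EFinM lee_fin; lra.
Qed.

End zero_cutoffs.

Section compact_intervals.
Context {R : realType} (I : closed_itv R) (w : weight I).

Lemma compact_itv_bounded (n : R) : compact [set t : I | `|val t| <= n].
Proof.
pose K : set R := citv_set I `&` `[- n, n]%classic.
have cK : compact K.
  by rewrite /K setIC; apply: compact_closedI; [exact: segment_compact|exact: citv_closed].
have ctK : {within K, continuous (to_itv I : R -> I)}.
  apply/subspace_continuousP => x [Ix _] A /nbhs_ballP[e /= e0 eA].
  apply/nbhs_ballP; exists e => // y xy [Iy _]; apply: eA.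
  by rewrite metric_ballP mdist_itv !to_itvK.
have := continuous_compact ctK cK; congr compact.
apply/seteqP; split => [_ [x [Ix xn] <-]|t tn].
  by rewrite /= to_itvK//; move: xn; rewrite /= in_itv/= ler_norml.
exists (val t); last exact: val_to_itv.
by split; [exact: set_valP|rewrite /= in_itv/= -ler_norml].
Qed.

Lemma weight_bounded (n : R) : exists2 M : R, 0 < M & forall t : I, `|val t| <= n -> w t <= M.
Proof.
have cw : {within [set t : I | `|val t| <= n], continuous w}.
  by apply: continuous_subspaceT; exact: weight_continuous.
have := compact_bounded (continuous_compact cw (compact_itv_bounded (n := n))).
move=> [M [_ hM]]; exists (`|M| + 1); first by rewrite ltr_wpDl.
move=> t tn; apply: (le_trans (ler_norm _)); apply: hM; last by exists t.
by have := ler_norm M; lra.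
Qed.

(** The zero set is closed by continuity, so its bounded part is compact; isolatedness covers it by
    open sets containing one zero each. *)
Lemma finite_zeros (n : R) : [set t | w t = 0] `<=` isolated [set t | w t = 0] ->
  exists s : seq I, (forall z, z \in s -> w z = 0) /\
    forall z : I, w z = 0 -> `|val z| <= n -> z \in s.
Proof.
move=> hiso; pose S := [set t : I | `|val t| <= n] `&` [set t | w t = 0].
have cS : compact S.
  apply: compact_closedI; first exact: compact_itv_bounded.
  have := @closed_comp _ _ w [set 0 : R] (fun t _ => @weight_continuous _ _ w t).
  by apply; exact: closed_eq.
have exV z : exists V : set I, open V /\ (w z = 0 -> V z /\ forall z', w z' = 0 -> V z' -> z' = z).
  have [wz|nwz] := pselect (w z = 0); last by exists setT; split => //; exact: openT.
  have [_ [V Vz hV]] := hiso z wz.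
  move: Vz; rewrite nbhsE => -[U [oU Uz] UV]; exists U; split => // _; split => // z' wz' Uz'.
  have : (V `&` [set t | w t = 0]) z' by split => //; exact: UV.
  by rewrite hV.
have [V hV] := choice exV.
have := cS; rewrite compact_cover => /(_ I S V).
case=> [z _|z Sz|D' D'S SD'].
- by case: (hV z).
- by exists z => //; have [_ /(_ Sz.2)[]] := hV z.
exists (finmap.enum_fset D'); split => [z zD|z wz zn].
  by have := D'S _ zD; rewrite inE => -[].
have [z' /= z'D Vz'] := SD' z (conj zn wz).
have := D'S _ z'D; rewrite inE => -[_ wz'].
by have [_ /(_ wz')[_ /(_ z wz Vz') ->]] := hV z'.
Qed.

End compact_intervals.

(** * Cutoffs vanishing near the zeros and near infinity *)

Section main_cutoff.
Context {R : realType} (I : closed_itv R) (w : weight I) (C : R).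
Hypothesis iso : [set t | w t = 0] `<=` isolated [set t | w t = 0].
Hypothesis wC : forall z t, w z = 0 -> w t <= C * `|val t - val z|.
Local Notation wm := (weighted_lebesgue w).

Definition far (n : nat) : set (borel I) := [set t | (n%:R <= `|val t|)%R].

Lemma measurable_far n : measurable (far n).
Proof.
rewrite (_ : far n = (Num.norm \o (val : borel I -> R)) @^-1` `[n%:R, +oo[%classic).
  rewrite -[X in measurable X]setTI; suff : measurable_fun setT (Num.norm \o (val : borel I -> R)) by apply.
  by apply: measurableT_comp => //; exact: measurable_val_itv.
by apply/seteqP; split => t; rewrite /far /= in_itv/= andbT.
Qed.

(** The product of a cutoff at the finitely many relevant zeros and a cutoff at infinity. Its slope
    has two parts of different nature: the one at infinity is not small, but lives where |t| >= n
    and is handled by dominated convergence; [k1], near the zeros, has small energy. *)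
Lemma vanishing_cutoff (n : nat) (e : R) : 0 < e -> exists eta k k1 : borel I -> R, exists L : R,
  [/\ cutoff_data eta k L /\ k \in Lfun wm 2%:E,
    exists2 U : set R, open U & (forall t, w t = 0 -> U (val t)) /\ forall t : I, U (val t) -> eta t = 0,
    forall t : I, `|val t| <= n%:R -> (forall z, w z = 0 -> n.+1%:R^-1 <= `|val t - val z|) -> eta t = 1,
    forall t, 0 <= k1 t /\ k t <= \1_(far n) t + k1 t &
    measurable_fun setT k1 /\ (\int[wm]_t (k1 t ^+ 2)%:E <= e%:E)%E].
Proof.
(* Zeros with |t| > n + 1 lie where the cutoff at infinity vanishes; the finite list contains all
   the others. *)
move=> e0; have [s [s0 sn]] := finite_zeros (n.+2%:R) iso.
have n10 : 0 < n.+1%:R^-1 :> R by rewrite invr_gt0.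
have hs z t : z \in s -> w t <= C * `|val t - val z| by move=> /s0; exact: wC.
have [zeta [k1 [L1 [c1 [d d0 z1] o1 i1]]]] := zeros_cutoff hs n10 e0.
(* With -|x| in the role of the distance, the ramp decreases outwards: it is 1 for |t| <= n and 0
   for |t| >= n + 1. *)
pose D (x : R) := - `|x|.
have DL x y : `|D x - D y| <= `|x - y|.
  by rewrite /D opprK addrC; apply: (le_trans (ler_dist_dist _ _)); rewrite distrC.
have := ramp_cutoff I (- n.+1%:R) DL ltr01.
set chi := (X in cutoff_data X _ _); set kc := (X in cutoff_data _ X _) => c2.
have kc_far t : kc t <= \1_(far n) t.
  rewrite /kc invr1 mul1r !indicE; case: (boolP (t \in _)) => [/set_mem /= /andP[_]|_].
    rewrite /D -natr1 => h; rewrite mem_set// /far/=.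
    lra.
  by case: (_ \in _).
pose B : set (borel I) := [set t : borel I | (- n.+1%:R <= D (val t) <= - n.+1%:R + 1)%R].
have kc01 t : 0 <= kc t <= \1_B t.
  by rewrite /kc invr1 mul1r lexx indicE andbT; case: (_ \in _).
have cD : continuous D.
  move=> x; apply/cvgrPdist_lt => q q0; apply/nbhs_ballP; exists q => // y xy.
  exact: le_lt_trans (DL _ _) xy.
have mB : measurable B.
  exact: measurable_val_cc.
have [_ _ k10 mk1 _] := c1; have [_ _ kc0 mkc _] := c2.
exists (fun t => zeta t * chi t), (fun t => k1 t + kc t), k1, (L1 + 1^-1); split.
- split; first exact: cutoff_dataM.
  apply: Lfun2D; apply/Lfun2P; split => //; first by apply: le_lt_trans i1 _; rewrite ltry.
  (* The slope at infinity is at most 1 on a bounded set, where the weight is bounded, so its energy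
     is finite. *)
  have [M M0 hM] := weight_bounded w (n.+1%:R).
  apply: (@le_lt_trans _ _ (wm B)); last first.
    apply: (@le_lt_trans _ _ (M * (n.+1%:R - - n.+1%:R))%:E); last by rewrite ltry.
    apply: weighted_lebesgue_le => //.
    + by rewrite (@le_trans _ _ 0)// oppr_le0.
    + exact: ltW.
    + by move=> t /andP[h _]; rewrite -ler_norml -lerN2.
    + by move=> t /andP[h _]; apply: hM; rewrite -lerN2.
  apply: (@le_trans _ _ (\int[wm]_t (\1_B t)%:E)%E); last by rewrite integral_indic// setIT.
  apply: ge0_le_integral => //.
  + by move=> t _; rewrite lee_fin sqr_ge0.
  + by apply/measurable_EFinP; exact: measurable_funX.
  + by apply/measurable_EFinP; exact: measurable_indic.
  + move=> t _; rewrite lee_fin; have /andP[h1 h2] := kc01 t.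
    apply: (le_trans _ h2); rewrite expr2 ler_piMr//; apply: (le_trans h2).
    by rewrite indicE; case: (_ \in _).
- exists ([set x | n.+1%:R < `|x|] `|` \bigcup_(z in [set z | z \in s]) [set x | `|x - val z| < d]).
    apply: openU.
      have := @open_comp _ _ (Num.norm : R -> R) [set x | n.+1%:R < x] (fun x _ => @norm_continuous _ R x).
      by apply; exact: open_gt.
    apply: bigcup_open => z _; have : open (ball (val z : R) d) by exact: ball_open.
    by congr open; apply/seteqP; split => x /=; rewrite distrC.
  split=> [t wt|t [h|[z /= zs h]]].
  + have [h|h] := ltP n.+1%:R `|val t|; [by left|right].
    have ts : t \in s by apply: sn => //; apply: (le_trans h); rewrite ler_nat.
    by exists t => //=; rewrite subrr normr0.
  + rewrite /chi clamp_unit_le0 ?mulr0// invr1 mulr1 opprK /D addrC subr_le0.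
    exact: ltW.
  + by rewrite (z1 z t zs h) mul0r.
- move=> t tn tz; rewrite o1; last by move=> z /s0; exact: tz.
  rewrite mul1r /chi clamp_unit_ge1// invr1 mulr1 opprK /D addrC lerBrDr -natr1 addrC lerD2r//.
- by move=> t; split => //; rewrite addrC lerD2r.
- by split.
Qed.

End main_cutoff.

(** * Density *)

Section weighted_sigma_finite.
Context {R : realType} (I : closed_itv R) (w : weight I).

Lemma weighted_lebesgue_sigma_finite : sigma_finite setT (weighted_lebesgue w).
Proof.
pose F (n : nat) : set (borel I) := [set t | (- n%:R <= val t <= n%:R)%R] `&` [set t | (0 <= w t <= n%:R)%R].
exists F.
  apply/seteqP; split => // t _.
  exists (maxn (Num.bound `|val t|) (Num.bound (w t))) => //.
  have h (x : R) (k l : nat) : 0 <= x -> (Num.bound x <= maxn k l)%N -> x <= (maxn k l)%:R.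
    move=> x0 xk; apply: (le_trans (ltW (archi_boundP x0))).
    by rewrite ler_nat.
  split => /=; first by rewrite -ler_norml; apply: h => //; exact: leq_maxl.
  by rewrite weight_ge0/=; apply: h; [exact: weight_ge0|exact: leq_maxr].
move=> n; have mF1 : measurable ([set t | (- n%:R <= val t <= n%:R)%R] : set (borel I)).
  by apply: (@measurable_val_cc R I id) => x; exact: cvg_id.
have mF2 : measurable ([set t | (0 <= w t <= n%:R)%R] : set (borel I)).
  rewrite (_ : mkset _ = (w : borel I -> R) @^-1` `[0, n%:R]).
    by rewrite -[X in measurable X]setTI; apply: measurable_weight.
  by apply/seteqP; split => x /=; rewrite in_itv.
have mF : measurable (F n) by exact: measurableI.
split => //; apply: (@le_lt_trans _ _ (n%:R * (n%:R - - n%:R))%:E); last by rewrite ltry.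
apply: weighted_lebesgue_le => //.
- by rewrite (@le_trans _ _ 0)// oppr_le0.
- by move=> t [].
- by move=> t [_ /andP[]].
Qed.

End weighted_sigma_finite.

HB.instance Definition _ (R : realType) (I : closed_itv R) (w : weight I) :=
  @Measure_isSigmaFinite.Build _ _ _ (weighted_lebesgue w) (weighted_lebesgue_sigma_finite w).

(** * Truncation by the arctangent *)

Section atan_truncation.
Context {R : realType}.

Lemma has_slope_atan (x : R) : has_slope (@atan R) x (1 + x ^+ 2)^-1.
Proof. by apply: derive1_slope; split; [exact: derivable_atan|rewrite derive1_atan]. Qed.

Lemma inv_1sqr (x : R) : 0 < (1 + x ^+ 2)^-1 <= 1.
Proof.
have h : 1 <= 1 + x ^+ 2 by rewrite lerDl sqr_ge0.
have h0 : 0 < 1 + x ^+ 2 by apply: lt_le_trans h.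
by rewrite invr_gt0 h0 invf_le1.
Qed.

Lemma atan_lip (x y : R) : `|atan x - atan y| <= `|x - y|.
Proof.
wlog xy : x y / x < y.
  move=> h; have [xy|yx|->] := ltgtP x y; first exact: h.
    by rewrite distrC [leRHS]distrC; exact: h.
  by rewrite !subrr.
have [c _ e] := MVT xy (fun x _ => is_derive1_atan x) (continuous_subspaceT (@continuous_atan R)).
have /andP[c0 c1] := inv_1sqr c.
rewrite distrC e normrM [leRHS]distrC ler_piMl//.
by rewrite ger0_norm//; exact: ltW.
Qed.

(** The index n + 1 excludes a division by zero. The function is bounded, 1-Lipschitz and
    increasing, with derivative at most 1 and tending to 1. *)
Definition trunc (n : nat) (r : R) : R := n.+1%:R * atan (r / n.+1%:R).
Definition dtrunc (n : nat) (r : R) : R := (1 + (r / n.+1%:R) ^+ 2)^-1.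

Lemma trunc_slope n r : has_slope (trunc n) r (dtrunc n r).
Proof.
have N0 : n.+1%:R != 0 :> R by rewrite pnatr_eq0.
have h1 : has_slope (fun t : R => t / n.+1%:R) r n.+1%:R^-1.
  have := has_slopeM (has_slope_id r) (has_slope_cst n.+1%:R^-1 r).
  by rewrite mul1r mulr0 addr0.
have := has_slopeM (has_slope_cst n.+1%:R r) (has_slope_comp h1 (has_slope_atan _)).
by rewrite mul0r add0r mulrC -mulrA mulVf// mulr1.
Qed.

Lemma dtrunc01 n r : 0 <= dtrunc n r <= 1.
Proof. by have /andP[h1 h2] := inv_1sqr (r / n.+1%:R); rewrite ltW. Qed.

Lemma measurable_dtrunc n : measurable_fun setT (dtrunc n).
Proof.
apply: measurable_fun_invr; first by move=> r; rewrite addr_ge0// sqr_ge0.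
by apply: measurable_funD => //; apply: measurable_funX; apply: measurable_funM.
Qed.

Lemma trunc_bound n r : `|trunc n r| <= n.+1%:R * (pi / 2).
Proof.
rewrite normrM ger0_norm//; apply: ler_wpM2l => //.
by rewrite ler_norml; apply/andP; split; apply/ltW; [exact: atan_gtNpi2|exact: atan_ltpi2].
Qed.

Lemma trunc_lip n r s : `|trunc n r - trunc n s| <= `|r - s|.
Proof.
rewrite -mulrBr normrM ger0_norm//.
apply: (@le_trans _ _ (n.+1%:R * `|r / n.+1%:R - s / n.+1%:R|)).
  by apply: ler_wpM2l => //; exact: atan_lip.
rewrite -mulrBl normrM (@ger0_norm _ n.+1%:R^-1) ?invr_ge0//.
by rewrite mulrCA mulfV ?mulr1// pnatr_eq0.
Qed.

Lemma trunc_le n r : `|trunc n r| <= `|r|.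
Proof. by have := trunc_lip n r 0; rewrite /trunc mul0r atan0 mulr0 !subr0. Qed.

Lemma cvg_div_nat (r : R) : r / n.+1%:R @[n --> \oo] --> 0.
Proof.
rewrite -[X in _ --> X](mulr0 r); apply: cvgM; first exact: cvg_cst.
exact: cvg_harmonic.
Qed.

(** atan has derivative 1 at 0, and r / (n + 1) tends to 0. *)
Lemma cvg_trunc r : trunc n r @[n --> \oo] --> r.
Proof.
apply/cvgrPdist_le => e e0.
have r1 : 0 < `|r| + 1 by rewrite ltr_wpDl.
have [d d0 hd] := has_slope_atan 0 (divr_gt0 e0 r1).
have /cvgrPdist_lt/(_ d d0) := cvg_div_nat r.
apply: filterS => n; rewrite sub0r normrN => rn.
have := hd (r / n.+1%:R); rewrite subr0 => /(_ rn).
rewrite atan0 subr0 expr0n addr0 invr1 mul1r => h.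
have N0 : n.+1%:R != 0 :> R by rewrite pnatr_eq0.
have -> : r - trunc n r = - (n.+1%:R * (atan (r / n.+1%:R) - r / n.+1%:R)).
  by rewrite /trunc mulrBr [n.+1%:R * (r / _)]mulrCA mulfV//; ring.
rewrite normrN normrM ger0_norm//.
apply: (@le_trans _ _ (n.+1%:R * (e / (`|r| + 1) * `|r / n.+1%:R|))); first exact: ler_wpM2l.
rewrite normrM (@ger0_norm _ n.+1%:R^-1) ?invr_ge0//.
rewrite [leLHS](_ : _ = e / (`|r| + 1) * `|r|); last first.
  by have key (N a b : R) : N != 0 -> N * (a * (b / N)) = a * b; [move=> ?; field|rewrite key].
by rewrite -mulrA ger_pMr// ler_pdivrMl// mulr1 lerDl.
Qed.

Lemma cvg_dtrunc r : dtrunc n r @[n --> \oo] --> (1 : R).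
Proof.
rewrite -[X in _ --> X]invr1; apply: cvgV; first exact: oner_neq0.
rewrite -[X in _ --> X]addr0; apply: cvgD; first exact: cvg_cst.
rewrite -[X in _ --> X](expr0n R 2); rewrite (_ : (fun n => _) = (fun n => (r / n.+1%:R) * (r / n.+1%:R))) ?expr2//.
by apply: cvgM; exact: cvg_div_nat.
Qed.

End atan_truncation.

Lemma Lfun2_norm d (T : measurableType d) (R : realType) (m : {measure set T -> \bar R}) (f : T -> R) :
  f \in Lfun m 2%:E -> (fun x => `|f x|) \in Lfun m 2%:E.
Proof.
move=> /Lfun2P[mf f2]; apply/Lfun2P; split; first exact: measurableT_comp.
by under eq_integral do rewrite real_normK ?num_real//.
Qed.

Lemma gradient_split_le (R : realFieldType) (v D gx gi b g : R) : 0 <= v ->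
  g ^+ 2 <= (D * gi + b) ^+ 2 ->
  v * (D * gx) ^+ 2 + g ^+ 2 <= 2 * (D ^+ 2 * (v * gx ^+ 2 + gi ^+ 2)) + 2 * b ^+ 2.
Proof.
move=> v0 h; have h1 := le_trans h (sqrD_le (D * gi) b).
have : 0 <= v * (D * gx) ^+ 2 by rewrite mulr_ge0 ?sqr_ge0.
rewrite !exprMn in h1 *; move: (D ^+ 2) (gx ^+ 2) (gi ^+ 2) (b ^+ 2) (g ^+ 2) h1 => *; lra.
Qed.

(** * Gradients of truncated functions on the warped product *)

Section truncated_gradient.
Context {R : realType} (X : pmetricType R) (m : {finite_measure set (borel X) -> \bar R})
  (I : closed_itv R) (wd wm : weight I) (W : warped_product m wd wm).
Hypotheses (sX : separable X) (lX : length_space X) (w0 : forall t, wd t = 0 -> wm t = 0).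
Local Notation prodT := (borel I * borel X)%type.
Local Notation lam := (weighted_lebesgue wm).
Local Notation wp := (wp_map W).
Implicit Types (p : prodT).

Let mwp : measurable_fun setT wp. Proof. exact: measurable_wp_map. Qed.

Lemma integral_wp (g : borel (wp_space W) -> \bar R) : measurable_fun setT g -> (forall z, (0 <= g z)%E) ->
  (\int[wp_measure W]_z g z = \int[(lam \x m)%E]_p g (wp p))%E.
Proof.
move=> mg g0.
exact: (@ge0_integral_push _ _ _ _ _ (lam \x m)%E (wp_measure W) _ _ mwp (fun A mA => wp_measureE mA) mg g0).
Qed.

Lemma ae_weight_pos : \forall p \ae (lam \x m)%E, 0 < wm p.1.
Proof.
have mG : measurable ([set p : prodT | 0 < wm p.1]).
  rewrite (_ : mkset _ = fst @^-1` [set t | 0 < wm t])//.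
  rewrite -[X in measurable X]setTI; apply: measurable_fst => //.
  exact: measurable_weight_pos.
apply: (ae_prod1 lam m mG).1; apply/ae_weighted; apply: aeW => t wt; exact: aeW.
Qed.

Section truncation.
Variables (f H : borel (wp_space W) -> R) (Ef : BL W f) (Hf : warped_gradient f H).
Variables (eta k : borel I -> R) (L : R) (ce : cutoff_data eta k L) (k2 : k \in Lfun lam 2%:E).
Variables (phi dphi : R -> R) (M : R).
Hypotheses (phiE : forall r, has_slope phi r (dphi r)) (mdphi : measurable_fun setT dphi).
Hypotheses (phiM : forall r, `|phi r| <= M) (phi_lip : forall r s, `|phi r - phi s| <= `|r - s|).
Hypothesis phi_le : forall r, `|phi r| <= `|r|.
Variables (E : borel (wp_space W) -> R).
Hypotheses (mE : measurable_fun setT E) (E01 : forall z, 0 <= E z <= 1) (EE : forall p, E (wp p) = eta p.1).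
Variables (la sg : R).
Hypotheses (la01 : 0 <= la <= 1) (sg1 : `|sg| <= 1).
Hypothesis D01 : forall e r, 0 <= e <= 1 -> 0 <= la + sg * e * dphi r <= 1.

Definition truncation (z : borel (wp_space W)) := la * f z + sg * E z * phi (f z).

Let F p := f (wp p).
Let D p := la + sg * eta p.1 * dphi (F p).
Let eta01 t : 0 <= eta t <= 1. Proof. by case: ce. Qed.
Let D01' p : 0 <= D p <= 1. Proof. exact: D01. Qed.

Let mf : measurable_fun setT f.
Proof. by have [/Lfun2P[]] := Ef. Qed.

Let mF : measurable_fun setT F. Proof. exact: measurableT_comp mf mwp. Qed.

Let meta : measurable_fun setT eta. Proof. exact: measurable_cutoff_data ce. Qed.

Let mphi : measurable_fun setT phi.
Proof. by apply: continuous_measurable_fun => r; exact: has_slope_continuous (phiE r). Qed.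

Let mD : measurable_fun setT D.
Proof.
apply: measurable_funD => //; apply: measurable_funM; last exact: measurableT_comp.
by apply: measurable_funM => //; exact: measurableT_comp.
Qed.

Lemma measurable_truncation : measurable_fun setT truncation.
Proof.
apply: measurable_funD; first exact: measurable_funM.
by apply: measurable_funM; [exact: measurable_funM|exact: measurableT_comp].
Qed.

Lemma truncation_le z : `|truncation z| <= 2 * `|f z|.
Proof.
have /andP[l0 l1] := la01; have /andP[e0 e1] := E01 z.
apply: (le_trans (ler_normD _ _)); rewrite mulr_natl mulr2n; apply: lerD.
  by rewrite normrM ler_piMl// ger0_norm.
rewrite normrM; apply: le_trans (phi_le _); rewrite ler_piMl//.
by rewrite normrM mulr_ile1// ger0_norm.
Qed.

Let fI x : slice_I truncation x = cutoff (slice_I f x) eta phi la sg.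
Proof. by apply/funext => t; rewrite /slice_I /truncation /cutoff EE. Qed.

Let fX t : slice_X truncation t = fun x => la * slice_X f t x + sg * eta t * phi (slice_X f t x).
Proof. by apply/funext => x; rewrite /slice_X /truncation EE. Qed.

Let mfI x : measurable_fun setT (slice_I f x).
Proof. exact: measurableT_comp mF (pair2_measurable x). Qed.

Let mfX t : measurable_fun setT (slice_X f t).
Proof. exact: measurableT_comp mF (pair1_measurable t). Qed.

Let gI x (G : borel I -> R) : weak_upper_gradient lam (slice_I f x) G ->
  weak_upper_gradient lam (slice_I truncation x)
    (cutoff_slope (slice_I f x) G eta k phi dphi la sg).
Proof.
move=> wG; have [e1 [L0 eL] k0 mk ek] := ce; rewrite fI.
apply: (weak_upper_gradient_cutoff (mfI x) wG phiE mdphi phiM phi_lip meta _ L0 eL k0 k2 ek) => //.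
- by move=> t; have /andP[h1 h2] := e1 t; rewrite ger0_norm.
- by have /andP[h1 h2] := la01; rewrite ger0_norm.
- by move=> t r; have /andP[h1 h2] := D01 r (e1 t); rewrite ger0_norm.
Qed.

Let minX t (G : borel X -> R) : minimal_weak_upper_gradient m (slice_X f t) G ->
  minimal_weak_upper_gradient m (slice_X truncation t) (fun x => D (t, x) * G x).
Proof.
move=> wG; rewrite fX.
have := @minimal_weak_upper_gradient_truncation _ X m _ _ phi dphi M (eta t) (mfX t) wG phiE mdphi phiM phi_lip (eta01 t) la sg la01 sg1.
by apply => r; exact: D01.
Qed.

(** On I-slices the slope of the cutoff is only an upper bound because of the term in [k]; the
    minimal gradient itself is taken from the difference quotients. *)
Let minI x (G : borel I -> R) : weak_upper_gradient lam (slice_I f x) G ->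
  minimal_weak_upper_gradient lam (slice_I truncation x) (difference_quotient (slice_I truncation x)).
Proof.
move=> /gI h; apply: minimal_difference_quotient h.
exact: measurableT_comp (measurableT_comp measurable_truncation mwp) (pair2_measurable x).
Qed.

Lemma truncation_slices : (\forall x \ae m, W12 lam (slice_I truncation x)) /\
  (\forall t \ae lam, W12 m (slice_X truncation t)).
Proof.
have [_ hI hX _] := Ef; have [_ [GX [GI [_ gX _ _]]]] := Hf.
have mtr := measurableT_comp measurable_truncation mwp.
split.
- apply: ae_mono hI => x [[_ [G wG]] f2]; split.
    split; first exact: measurableT_comp mtr (pair2_measurable x).
    by eexists; exact: gI wG.
  apply: (@Lfun2_le _ I lam _ (fun t => 2 * `|slice_I f x t|)).
  + exact: measurableT_comp mtr (pair2_measurable x).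
  + by move=> t; exact: truncation_le.
  + apply: Lfun2Z; exact: Lfun2_norm.
- apply: ae_mono (ae_and hX gX) => t [[_ f2] wG]; split.
    split; first exact: measurableT_comp mtr (pair1_measurable t).
    by have [] := minX wG; eexists; eauto.
  apply: (@Lfun2_le _ X m _ (fun x => 2 * `|slice_X f t x|)).
  + exact: measurableT_comp mtr (pair1_measurable t).
  + by move=> x; exact: truncation_le.
  + by apply: Lfun2Z; exact: Lfun2_norm.
Qed.

(** The representative combines the explicit gradient [D * GX] on X-slices with the difference
    quotient on I-slices; its energy is then estimated by the product rule. *)
Lemma truncation_gradient : exists2 Hg, warped_gradient truncation Hg &
  (\int[wp_measure W]_z (Hg z ^+ 2)%:E <=
   \int[(lam \x m)%E]_p (2 * (D p * H (wp p)) ^+ 2 + 2 * (phi (F p) * k p.1) ^+ 2)%:E)%E.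
Proof.
have [mH [GX [GI [[mGX mGI] gX gI' HE]]]] := Hf.
have [_ hI _ _] := Ef.
have mtr : measurable_fun setT (truncation \o wp) by exact: measurableT_comp measurable_truncation mwp.
pose GX' p := D p * GX p.
pose GI' p := difference_quotient (fun t => truncation (wp (t, p.2))) p.1.
have mGX' : measurable_fun setT GX' by exact: measurable_funM.
have mGI' : measurable_fun setT GI'.
  exact: (@measurable_difference_quotient _ I _ _ (truncation \o wp) mtr).
pose S p := (wd p.1) ^- 2 * GX' p ^+ 2 + GI' p ^+ 2.
have sq0 (a b : R) : 0 <= a ^- 2 * b ^+ 2 by apply: mulr_ge0; rewrite ?invr_ge0 sqr_ge0.
have S0 p : 0 <= S p by apply: addr_ge0; [exact: sq0|exact: sqr_ge0].
have mwd : measurable_fun setT (fun p : prodT => wd p.1).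
  by apply: measurableT_comp => //; exact: measurable_weight.
have mwdV : measurable_fun setT (fun p : prodT => (wd p.1) ^- 2).
  by apply: measurable_fun_invr; [move=> p; rewrite sqr_ge0|exact: measurable_funX].
have mS : measurable_fun setT S.
  by apply: measurable_funD; [apply: measurable_funM => //|]; exact: measurable_funX.
pose O : set prodT := [set p | 0 < wd p.1].
have mO : measurable O.
  have := mwd measurableT `]0, +oo[%classic (measurable_itv _).
  by rewrite setTI; congr measurable; apply/seteqP; split => p; rewrite /O/= in_itv/= andbT.
(* The indicator makes the function vanish where [wd] does, so that it descends to the warped
   product; this changes it only on a null set, since [wm] vanishes there too. *)
pose Q p := Num.sqrt (S p) * \1_O p.
have mQ : measurable_fun setT Q.
  apply: measurable_funM; last exact: measurable_indic.
  apply: (@measurableT_comp _ _ _ _ _ _ (@Num.sqrt R)) => //.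
  by apply: continuous_measurable_fun; exact: sqrt_continuous.
have Q0 p : wd p.1 = 0 -> Q p = 0.
  by move=> wp0; rewrite /Q indicE memNset ?mulr0// /O/= wp0 ltxx.
have [Hg mHg HgE] := warped_factor W mQ Q0.
have Opos p : 0 < wm p.1 -> O p.
  move=> wp0; rewrite /O/= lt_neqAle weight_ge0 andbT eq_sym; apply/eqP => /w0 e.
  by rewrite e ltxx in wp0.
exists Hg.
  split => //; exists GX', GI'; split => //.
  - by apply: ae_mono gX => t; exact: minX.
  - apply: ae_mono gI' => x [wG _]; exact: minI wG.
  - apply: ae_mono ae_weight_pos => p /Opos Op.
    by rewrite HgE /Q indicE mem_set// mulr1.
have mHg2 : measurable_fun setT (fun z => (Hg z ^+ 2)%:E).
  by apply/measurable_EFinP; exact: measurable_funX.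
rewrite integral_wp//; last by move=> z; rewrite lee_fin sqr_ge0.
have /Lfun2P[mk _] := k2.
have mk' : measurable_fun setT (fun p : prodT => k p.1) by exact: measurableT_comp.
have mphiF : measurable_fun setT (fun p => phi (F p)) by exact: measurableT_comp.
have mHw : measurable_fun setT (fun p => H (wp p)) by exact: measurableT_comp.
have mGd : measurable [set p | GI' p <= `|D p| * GI p + `|phi (F p)| * k p.1].
  have m1 : measurable_fun setT (fun p => `|D p| * GI p + `|phi (F p)| * k p.1).
    by apply: measurable_funD; apply: measurable_funM => //; exact: measurableT_comp.
  have := @measurable_fun_ler _ _ _ setT _ _ mGI' m1 measurableT [set true].
  by rewrite setTI; apply.
(* The inequality is known on almost every I-slice. Its set [mGd] being measurable, Tonelli turns it
   into a statement on the product. *)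
have hGI : \forall p \ae (lam \x m)%E, GI' p <= `|D p| * GI p + `|phi (F p)| * k p.1.
  apply: (ae_prod1 lam m mGd).1; apply: (ae_swap lam m mGd).2.
  apply: ae_mono gI' => x [wG _]; have wT := gI wG.
  have mx : measurable_fun setT (slice_I truncation x) by exact: measurableT_comp mtr (pair2_measurable x).
  exact: (difference_quotient_le mx wT).
have hGI0 : \forall p \ae (lam \x m)%E, 0 <= GI p.
  have mG : measurable [set p | 0 <= GI p].
    have := mGI measurableT `[0, +oo[%classic (measurable_itv _).
    by rewrite setTI; congr measurable; apply/seteqP; split => p; rewrite /= in_itv/= andbT.
  apply: (ae_prod1 lam m mG).1; apply: (ae_swap lam m mG).2.
  by apply: ae_mono gI' => x [[G0 _ _] _]; apply: aeW => t; exact: G0.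
apply: ae_ge0_le_integral => //.
- by move=> p _; rewrite lee_fin sqr_ge0.
- by apply/measurable_EFinP; apply: measurable_funX; exact: measurableT_comp mHg mwp.
- by move=> p _; rewrite lee_fin; apply: addr_ge0; apply: mulr_ge0 => //; exact: sqr_ge0.
- apply/measurable_EFinP; apply: measurable_funD; apply: measurable_funM => //;
    apply: measurable_funX; exact: measurable_funM.
apply: ae_mono (ae_and3 (ae_and hGI hGI0) ae_weight_pos HE) => p [[h1 h2] /Opos Op h3] _.
rewrite lee_fin HgE /Q indicE mem_set// mulr1 sqr_sqrtr// h3 exprMn sqr_sqrtr; last first.
  by apply: addr_ge0; [exact: sq0|exact: sqr_ge0].
have /andP[d0 d1] := D01' p; rewrite (ger0_norm d0) in h1.
have k0 : 0 <= k p.1 by case: ce.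
have h4 : GI' p ^+ 2 <= (D p * GI p + `|phi (F p)| * k p.1) ^+ 2.
  rewrite ler_pXn2r ?nnegrE ?difference_quotient_ge0//.
  by rewrite addr_ge0// mulr_ge0.
have h5 : (phi (F p) * k p.1) ^+ 2 = (`|phi (F p)| * k p.1) ^+ 2.
  by rewrite !exprMn real_normK ?num_real.
rewrite /S /GX' h5; apply: gradient_split_le => //.
by rewrite invr_ge0 sqr_ge0.
Qed.

End truncation.
End truncated_gradient.

Lemma sqr_onem_le1 (R : realType) (a : R) : 0 <= a <= 1 -> (1 - a) ^+ 2 <= 1.
Proof. by move=> /andP[? ?]; rewrite expr_le1//; lra. Qed.

Lemma cutoff_energy_bound (R : realType) (A K J K1 B Q : R) : A * K <= A * (2 * J + 2 * K1) ->
  A * J <= B * J -> A * K1 <= Q * K1 -> 2 * (A * K) <= 4 * (B * J) + 4 * Q * K1.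
Proof. by move=> *; lra. Qed.

Lemma remainder_bound (R : realType) (x y z A B : R) : x <= 4 * A -> y <= B -> z <= A ->
  x + 2 * y + 4 * z <= 8 * A + 2 * B.
Proof. by move=> *; lra. Qed.

(** * Approximation in the norm of [BL] *)

Section density.
Context {R : realType} (X : pmetricType R) (m : {finite_measure set (borel X) -> \bar R})
  (I : closed_itv R) (wd wm : weight I) (W : warped_product m wd wm) (C : R).
Hypotheses (sX : separable X) (lX : length_space X) (w0 : forall t, wd t = 0 -> wm t = 0).
Hypothesis iso : [set t | wm t = 0] `<=` isolated [set t | wm t = 0].
Hypothesis wC : forall z t, wm z = 0 -> wm t <= C * `|val t - val z|.
Local Notation prodT := (borel I * borel X)%type.
Local Notation lam := (weighted_lebesgue wm).
Local Notation wp := (wp_map W).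

Let mwp : measurable_fun setT wp. Proof. exact: measurable_wp_map. Qed.

(** The energy of a cutoff on the product is its energy on the interval times the total mass of X,
    which is finite. *)
Lemma integral_prod_fst (g : borel I -> R) : measurable_fun setT g -> (forall t, 0 <= g t) ->
  (\int[(lam \x m)%E]_p (g p.1)%:E = \int[lam]_t (g t)%:E * m setT)%E.
Proof.
move=> mg g0.
have mg1 : measurable_fun setT (fun p : prodT => (g p.1)%:E).
  by apply/measurable_EFinP; exact: measurableT_comp.
rewrite fubini_tonelli1//; last by move=> p; rewrite lee_fin.
rewrite muleC -ge0_integralZl//.
- apply: eq_integral => t _; rewrite /fubini_F/= -[X in integral _ _ X]/(cst (g t)%:E).
  by rewrite integral_cst// muleC.
- exact/measurable_EFinP.
- by move=> t _; rewrite lee_fin.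
Qed.

Section approximation.
Variables (f H : borel (wp_space W) -> R) (Ef : BL W f) (Hf : warped_gradient f H)
  (H2 : H \in Lfun (wp_measure W) 2%:E).
Variables (n : nat) (eta k k1 : borel I -> R) (L : R).
Hypotheses (ce : cutoff_data eta k L) (k2 : k \in Lfun lam 2%:E).
Hypothesis eta0 : forall t, wm t = 0 -> eta t = 0.
Local Notation phi := (@trunc R n).
Local Notation dphi := (@dtrunc R n).
Local Notation M := (n.+1%:R * (pi / 2) : R).
Let F p := f (wp p).

Let D01 (la sg : R) : (la = 0 /\ sg = 1) \/ (la = 1 /\ sg = -1) ->
  forall e r, 0 <= e <= 1 -> 0 <= la + sg * e * dphi r <= 1.
Proof.
move=> h e r /andP[e0 e1]; have /andP[d0 d1] := dtrunc01 n r.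
have : 0 <= e * dphi r <= 1 by rewrite mulr_ge0//= mulr_ile1.
by move=> /andP[? ?]; case: h => -[-> ->]; apply/andP; split; lra.
Qed.

Let cases01 (la sg : R) : (la = 0 /\ sg = 1) \/ (la = 1 /\ sg = -1) -> 0 <= la <= 1 /\ `|sg| <= 1.
Proof. by case=> -[-> ->]; rewrite ?normrN normr1 ?lexx ?ler01. Qed.

Lemma eta_factor : exists E : borel (wp_space W) -> R,
  [/\ measurable_fun setT E, forall z, 0 <= E z <= 1 & forall p, E (wp p) = eta p.1].
Proof.
have meta := measurable_cutoff_data ce.
have me : measurable_fun setT (fun p : prodT => eta p.1) by exact: measurableT_comp.
have [E0 mE0 hE0] := @warped_factor R I X m wd wm W _ me (fun p h => eta0 (w0 h)).
(* The factor is constrained only on the image of [wp]; clamping gives values in [0, 1] everywhere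
   without changing it on the image. *)
exists (fun z => clamp_unit (E0 z)); split => [|z|p].
- apply: measurable_maxr => //; apply: measurable_minr => //.
- exact: clamp_unit01.
- rewrite hE0; have [h _ _ _ _] := ce; have /andP[h0 h1] := h p.1.
  by rewrite /clamp_unit min_r// max_r.
Qed.

Variable E : borel (wp_space W) -> R.
Hypotheses (mE : measurable_fun setT E) (E01 : forall z, 0 <= E z <= 1) (EE : forall p, E (wp p) = eta p.1).

Lemma truncation_energy (la sg : R) : (la = 0 /\ sg = 1) \/ (la = 1 /\ sg = -1) ->
  exists2 Hg, warped_gradient (truncation f phi E la sg) Hg &
  (\int[wp_measure W]_z (Hg z ^+ 2)%:E <=
   \int[(lam \x m)%E]_p (2 * ((la + sg * eta p.1 * dphi (F p)) * H (wp p)) ^+ 2 + 2 * (phi (F p) * k p.1) ^+ 2)%:E)%E.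
Proof.
move=> h; have [la01 sg1] := cases01 h.
exact: (truncation_gradient sX lX w0 Ef Hf ce k2 (trunc_slope n) (measurable_dtrunc n)
  (trunc_bound n) (trunc_lip n) mE EE la01 sg1 (D01 h)).
Qed.

Let mf : measurable_fun setT f. Proof. by have [/Lfun2P[]] := Ef. Qed.
Let mF : measurable_fun setT F. Proof. exact: measurableT_comp mf mwp. Qed.
Let meta : measurable_fun setT eta. Proof. exact: measurable_cutoff_data ce. Qed.
Let mphi : measurable_fun setT phi.
Proof. by apply: continuous_measurable_fun => r; exact: has_slope_continuous (trunc_slope n r). Qed.
Let mH : measurable_fun setT (fun p => H (wp p)).
Proof. by have [mH _] := Hf; exact: measurableT_comp. Qed.
Let mk : measurable_fun setT (fun p : prodT => k p.1).
Proof. by have [_ _ _ mk _] := ce; exact: measurableT_comp. Qed.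
Let mD (la sg : R) : measurable_fun setT (fun p : prodT => la + sg * eta p.1 * dphi (F p)).
Proof.
apply: measurable_funD => //; apply: measurable_funM.
  by apply: measurable_funM => //; exact: measurableT_comp.
by apply: measurableT_comp => //; exact: measurable_dtrunc.
Qed.

Let mB (la sg : R) : measurable_fun setT (fun p : prodT =>
  (2 * ((la + sg * eta p.1 * dphi (F p)) * H (wp p)) ^+ 2 + 2 * (phi (F p) * k p.1) ^+ 2)%:E).
Proof.
apply/measurable_EFinP; apply: measurable_funD; apply: measurable_funM => //; apply: measurable_funX.
  by apply: measurable_funM => //; exact: mD.
by apply: measurable_funM => //; exact: measurableT_comp.
Qed.

Lemma integral_H : (\int[(lam \x m)%E]_p (H (wp p) ^+ 2)%:E < +oo)%E.
Proof.
have /Lfun2P[mH' i] := H2.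
rewrite -(@integral_wp R X m I wd wm W sX lX (fun z => (H z ^+ 2)%:E))//.
  by apply/measurable_EFinP; exact: measurable_funX.
by move=> z; rewrite lee_fin sqr_ge0.
Qed.

Lemma integral_F : (\int[(lam \x m)%E]_p (F p ^+ 2)%:E < +oo)%E.
Proof.
have [/Lfun2P[_ i] _ _ _] := Ef.
rewrite -(@integral_wp R X m I wd wm W sX lX (fun z => (f z ^+ 2)%:E))//.
  by apply/measurable_EFinP; exact: measurable_funX.
by move=> z; rewrite lee_fin sqr_ge0.
Qed.

Lemma BL_truncation (la sg : R) : (la = 0 /\ sg = 1) \/ (la = 1 /\ sg = -1) ->
  BL W (truncation f phi E la sg).
Proof.
move=> h; have [la01 sg1] := cases01 h.
have [sI sX'] := truncation_slices sX lX Ef Hf ce k2 (trunc_slope n) (measurable_dtrunc n)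
  (trunc_bound n) (trunc_lip n) (trunc_le n) mE E01 EE la01 sg1 (D01 h).
have [Hg wg ig] := truncation_energy h.
split => //.
- have [f2 _ _ _] := Ef.
  apply: (@Lfun2_le _ (wp_space W) (wp_measure W) _ (fun z => 2 * `|f z|)).
  + exact: (measurable_truncation Ef (trunc_slope n) mE).
  + by move=> z; apply: truncation_le => //; exact: trunc_le.
  + by apply: Lfun2Z; exact: Lfun2_norm.
exists Hg => //; apply/Lfun2P; split; first by case: wg.
apply: le_lt_trans ig _.
(* The truncation is bounded by [M], [k] is square integrable and X has finite mass, so the term
   carrying the slope of the cutoff has finite energy. *)
have i2 : (\int[(lam \x m)%E]_p (2 * H (wp p) ^+ 2 + 2 * M ^+ 2 * (k p.1) ^+ 2)%:E < +oo)%E.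
  under eq_integral do rewrite EFinD.
  have a0 p : (0 <= (2 * H (wp p) ^+ 2)%:E)%E by rewrite lee_fin; apply: mulr_ge0 => //; exact: sqr_ge0.
  have b0 (p : prodT) : (0 <= (2 * M ^+ 2 * k p.1 ^+ 2)%:E)%E.
    by rewrite lee_fin; apply: mulr_ge0; [apply: mulr_ge0 => //|]; exact: sqr_ge0.
  have ma : measurable_fun setT (fun p => (2 * H (wp p) ^+ 2)%:E).
    by apply/measurable_EFinP; apply: measurable_funM => //; exact: measurable_funX.
  have mb : measurable_fun setT (fun p : prodT => (2 * M ^+ 2 * k p.1 ^+ 2)%:E).
    by apply/measurable_EFinP; apply: measurable_funM => //; exact: measurable_funX.
  rewrite (ge0_integralD _ measurableT (fun p _ => a0 p) ma (fun p _ => b0 p) mb).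
  under eq_integral do rewrite EFinM.
  under [X in (_ + X)%E]eq_integral do rewrite EFinM.
  rewrite !ge0_integralZl//; try (by move=> p _; rewrite lee_fin sqr_ge0);
    try (by apply/measurable_EFinP; exact: measurable_funX);
    try (by rewrite lee_fin; apply: mulr_ge0 => //; exact: sqr_ge0).
  rewrite (integral_prod_fst (g := fun t => k t ^+ 2)); last 2 first.
  - by apply: measurable_funX; have [_ _ _ mk' _] := ce.
  - by move=> t; rewrite sqr_ge0.
  have /Lfun2P[_ ik] := k2.
  apply: lte_add_pinfty; first by apply: lte_mul_pinfty => //; exact: integral_H.
  apply: lte_mul_pinfty => //; first by rewrite lee_fin; apply: mulr_ge0 => //; exact: sqr_ge0.
  apply: lte_mul_pinfty => //; last by rewrite ltey_eq fin_num_measure.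
  - by apply: integral_ge0 => t _; rewrite lee_fin sqr_ge0.
  - by rewrite ge0_fin_numE//; apply: integral_ge0 => t _; rewrite lee_fin sqr_ge0.
apply: le_lt_trans i2; apply: ge0_le_integral => //.
- by move=> p _; rewrite lee_fin addr_ge0// mulr_ge0// sqr_ge0.
- apply/measurable_EFinP; apply: measurable_funD; apply: measurable_funM => //; exact: measurable_funX.
move=> p _; rewrite lee_fin; apply: lerD.
- rewrite ler_pM2l// exprMn ler_piMl ?sqr_ge0//.
  have [he _ _ _ _] := ce; have /andP[d0 d1] := D01 h (F p) (he p.1).
  by rewrite expr_le1.
- rewrite -mulrA ler_pM2l// exprMn ler_wpM2r ?sqr_ge0//.
  rewrite -[leLHS]real_normK ?num_real// ler_pXn2r ?nnegrE//; first exact: trunc_bound.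
  by apply: le_trans (normr_ge0 _) (trunc_bound n 0).
Qed.

Lemma BL_vanishing_truncation : (exists2 U : set R, open U & (forall t, wm t = 0 -> U (val t)) /\
    forall t : I, U (val t) -> eta t = 0) -> BL_vanishing W (truncation f phi E 0 1).
Proof.
move=> [U oU [zU Ue]]; split; first by apply: BL_truncation; left.
exists U => //; split => // t x Ut.
by rewrite /truncation EE/= Ue// mul0r mulr0 mul0r addr0.
Qed.

(** The part of the squared norm treated by dominated convergence: the error in L^2, the gradient
    error without the slope of the cutoff, and the slope at infinity. The factor 4 comes from k^2 <=
    2 1_far^2 + 2 k1^2 in the term 2 (phi k)^2; the share of [k1] is estimated separately. *)
Definition remainder p : R := (F p - eta p.1 * phi (F p)) ^+ 2 +
  2 * ((1 - eta p.1 * dphi (F p)) * H (wp p)) ^+ 2 + 4 * (F p * \1_(far n) p.1) ^+ 2.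

Hypotheses (mk1 : measurable_fun setT k1) (hk1 : forall t, 0 <= k1 t /\ k t <= \1_(far n) t + k1 t).

Lemma remainder_ge0 p : 0 <= remainder p.
Proof. by apply: addr_ge0; [apply: addr_ge0; [exact: sqr_ge0|]|]; apply: mulr_ge0 => //; exact: sqr_ge0. Qed.

Lemma measurable_remainder : measurable_fun setT remainder.
Proof.
apply: measurable_funD.
  apply: measurable_funD.
    apply: measurable_funX; apply: measurable_funB => //; apply: measurable_funM.
      exact: measurableT_comp.
    exact: measurableT_comp.
  apply: measurable_funM => //; apply: measurable_funX; apply: measurable_funM => //.
  apply: measurable_funB => //; apply: measurable_funM; first exact: measurableT_comp.
  by apply: measurableT_comp => //; exact: measurable_dtrunc.
apply: measurable_funM => //; apply: measurable_funX; apply: measurable_funM => //.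
apply: (@measurableT_comp _ _ _ _ _ _ (\1_(far n) : borel I -> R)) => //.
by apply: measurable_indic; exact: measurable_far.
Qed.

Lemma BL_norm_remainder (e : R) : 0 < e ->
  (\int[(lam \x m)%E]_p (remainder p)%:E + (4 * M ^+ 2)%:E * (\int[lam]_t (k1 t ^+ 2)%:E * m setT) < (e ^+ 2)%:E)%E ->
  (BL_norm W (f \- truncation f phi E 0 1)%R < e%:E)%E.
Proof.
move=> e0 small.
have case1 : ((1 : R) = 0 /\ (-1 : R) = 1) \/ ((1 : R) = 1 /\ (-1 : R) = -1) by right.
have [Hg wg ig] := truncation_energy case1.
(* The error is itself a truncation, with parameters 1 and -1, so the same gradient estimate applies
   to it. *)
have -> : (f \- truncation f phi E 0 1)%R = truncation f phi E 1 (-1).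
  by apply/funext => z; rewrite /truncation /=; ring.
pose N := (\int[wp_measure W]_z (truncation f phi E 1 (-1) z ^+ 2)%:E + \int[wp_measure W]_z (Hg z ^+ 2)%:E)%E.
have mtr : measurable_fun setT (truncation f phi E 1 (-1)) by exact: (measurable_truncation Ef (trunc_slope n) mE).
have NE : (N < (e ^+ 2)%:E)%E.
  apply: le_lt_trans small; rewrite /N.
  rewrite (@integral_wp R X m I wd wm W sX lX (fun z => (truncation f phi E 1 (-1) z ^+ 2)%:E)); last 2 first.
  - by apply/measurable_EFinP; exact: measurable_funX.
  - by move=> z; rewrite lee_fin sqr_ge0.
  apply: (le_trans (leeD (lexx _) ig)).
  have mk1' : measurable_fun setT (fun t => k1 t ^+ 2) by exact: measurable_funX.
  rewrite -(integral_prod_fst mk1'); last by move=> t; rewrite sqr_ge0.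
  have mk1p : measurable_fun setT (fun p : prodT => (k1 p.1 ^+ 2)%:E).
    by apply/measurable_EFinP; apply: (@measurableT_comp _ _ _ _ _ _ (fun t : borel I => k1 t ^+ 2)).
  have M20 : 0 <= 4 * M ^+ 2 by rewrite mulr_ge0// sqr_ge0.
  rewrite -ge0_integralZl//; [|by move=> p _; rewrite lee_fin sqr_ge0].
  have mtr2 : measurable_fun setT (fun p : prodT => (truncation f phi E 1 (-1) (wp p) ^+ 2)%:E).
    by apply/measurable_EFinP; apply: measurable_funX; exact: measurableT_comp mtr mwp.
  rewrite -ge0_integralD//; [|by move=> p _; rewrite lee_fin sqr_ge0
    |by move=> p _; rewrite lee_fin; apply: addr_ge0; apply: mulr_ge0 => //; exact: sqr_ge0].
  rewrite -ge0_integralD//; [|by move=> p _; rewrite lee_fin; exact: remainder_ge0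
    |by apply/measurable_EFinP; exact: measurable_remainder
    |by move=> p _; rewrite mule_ge0// lee_fin ?sqr_ge0
    |exact: measurable_funeM].
  apply: ge0_le_integral => //.
  - by move=> p _; rewrite -EFinD lee_fin; apply: addr_ge0; [exact: sqr_ge0|apply: addr_ge0; apply: mulr_ge0 => //; exact: sqr_ge0].
  - by apply: emeasurable_funD => //; exact: mB.
  - by apply: emeasurable_funD; [apply/measurable_EFinP; exact: measurable_remainder|exact: measurable_funeM].
  move=> p _; rewrite -EFinM -!EFinD lee_fin /remainder /truncation EE -/(F p) mul1r !mulN1r.
  rewrite mulNr -!addrA lerD2l mulNr lerD2l.
  have [h1 h2] := hk1 p.1; have k0 : 0 <= k p.1 by case: ce.
  set i := \1_(far n) p.1 in h2 *; have i0 : 0 <= i by rewrite /i indicE.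
  have h3 : (k p.1) ^+ 2 <= 2 * i ^+ 2 + 2 * (k1 p.1) ^+ 2.
    apply: (@le_trans _ _ ((i + k1 p.1) ^+ 2)).
      by rewrite ler_pXn2r ?nnegrE// addr_ge0.
    by rewrite -mulrDr; exact: sqrD_le.
  have h4 : phi (F p) ^+ 2 <= F p ^+ 2.
    by rewrite -[leLHS]real_normK ?num_real// -[leRHS]real_normK ?num_real// ler_pXn2r ?nnegrE// trunc_le.
  have h5 : phi (F p) ^+ 2 <= M ^+ 2.
    rewrite -[leLHS]real_normK ?num_real// ler_pXn2r ?nnegrE//; first exact: trunc_bound.
    exact: le_trans (normr_ge0 _) (trunc_bound n 0).
  rewrite [(phi (F p) * k p.1) ^+ 2]exprMn [(F p * i) ^+ 2]exprMn.
  have h6 : phi (F p) ^+ 2 * (k p.1) ^+ 2 <= phi (F p) ^+ 2 * (2 * i ^+ 2 + 2 * (k1 p.1) ^+ 2).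
    by apply: ler_wpM2l => //; exact: sqr_ge0.
  have h7 : phi (F p) ^+ 2 * i ^+ 2 <= F p ^+ 2 * i ^+ 2 by apply: ler_wpM2r => //; exact: sqr_ge0.
  have h8 : phi (F p) ^+ 2 * (k1 p.1) ^+ 2 <= M ^+ 2 * (k1 p.1) ^+ 2 by apply: ler_wpM2r => //; exact: sqr_ge0.
  move: h6 h7 h8.
  set A := phi (F p) ^+ 2; set B := F p ^+ 2; set K := k p.1 ^+ 2; set K1 := k1 p.1 ^+ 2; set J := i ^+ 2; set Q := M ^+ 2.
  exact: cutoff_energy_bound.
have N0 : (0 <= N)%E by apply: adde_ge0; apply: integral_ge0 => z _; rewrite lee_fin sqr_ge0.
(* The norm is an infimum over representatives of the gradient, so the single representative [Hg]
   bounds it. *)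
apply: (@le_lt_trans _ _ (N `^ 2^-1)%E).
  apply: ereal_inf_lbound; exists Hg => //.
  rewrite !Lnorm2E; congr (_ `^ _)%E; rewrite /N.
  have sq (x : \bar R) : (0 <= x)%E -> ((x `^ 2^-1) ^+ 2 = x)%E.
    case: x => [r| |]//; last first.
      by rewrite poweRyr ?invr_neq0// expe2 mulyy.
    rewrite lee_fin => r0; rewrite poweR_EFin -EFin_expe powR12_sqrt// sqr_sqrtr//.
  by rewrite !sq//; apply: integral_ge0 => z _; rewrite lee_fin sqr_ge0.
move: NE N0; case: N => [r| |]//.
rewrite lte_fin lee_fin => re r0; rewrite poweR_EFin lte_fin powR12_sqrt//.
by rewrite -[ltRHS]ger0_norm ?(ltW e0)// -sqrtr_sqr ltr_sqrt// exprn_gt0.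
Qed.

End approximation.

(** By continuity, [wm] stays positive near [t], so that [t] has positive distance to the zeros. *)
Lemma eventually_one (t : I) : 0 < wm t -> exists N : nat, forall n, (N <= n)%N ->
  `|val t| <= n%:R /\ forall z, wm z = 0 -> n.+1%:R^-1 <= `|val t - val z|.
Proof.
move=> wt; have := @weight_continuous _ _ wm t.
move=> /(_ _ (nbhsx_ballx _ _ wt))/nbhs_ballP[d /= d0 hd].
have [N1 hN1] := inv_nat_lt d0.
exists (maxn N1 (Num.bound `|val t|)) => n; rewrite geq_max => /andP[n1 n2]; split.
  by apply: (le_trans (ltW (archi_boundP (normr_ge0 _)))); rewrite ler_nat.
move=> z wz; rewrite leNgt; apply/negP => tz.
have dz : `|val t - val z| < d.
  apply: (lt_le_trans tz); apply: ltW; apply: le_lt_trans hN1.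
  by rewrite lef_pV2 ?posrE// ler_nat.
have : ball (wm t) (wm t) (wm z) by exact: hd.
by rewrite /ball/= wz subr0 ger0_norm ?ltxx// weight_ge0.
Qed.

Lemma BL_vanishing_dense (f : borel (wp_space W) -> R) (e : R) : BL W f -> 0 < e ->
  exists2 g, BL_vanishing W g & (BL_norm W (f \- g)%R < e%:E)%E.
Proof.
move=> Ef e0; have [f2 _ _ [H Hf H2]] := Ef.
have /Lfun2P[mf _] := f2; have [mH _] := Hf.
pose M (n : nat) : R := n.+1%:R * (pi / 2).
have M0 n : 0 < M n by rewrite mulr_gt0// divr_gt0// pi_gt0.
have mT0 : 0 <= fine (m setT) by rewrite fine_ge0.
pose Mx : R := fine (m setT) + 1; have Mx0 : 0 < Mx by rewrite ltr_wpDl.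
(* Chosen after the bound [M n], so that the energy near the zeros contributes at most 1/(n + 1);
   [Mx] exceeds the mass of X and is positive. *)
pose ep (n : nat) : R := (n.+1%:R * (4 * M n ^+ 2 * Mx))^-1.
have M20 n : 0 < 4 * M n ^+ 2 by apply: mulr_gt0 => //; exact: exprn_gt0.
have ep0 n : 0 < ep n by rewrite invr_gt0; do 2!apply: mulr_gt0 => //.
have ex n : exists x : (borel I -> R) * (borel I -> R) * (borel I -> R) * R,
  [/\ cutoff_data x.1.1.1 x.1.1.2 x.2 /\ x.1.1.2 \in Lfun lam 2%:E,
    exists2 U : set R, open U & (forall t, wm t = 0 -> U (val t)) /\ forall t : I, U (val t) -> x.1.1.1 t = 0,
    forall t : I, `|val t| <= n%:R -> (forall z, wm z = 0 -> n.+1%:R^-1 <= `|val t - val z|) -> x.1.1.1 t = 1,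
    forall t, 0 <= x.1.2 t /\ x.1.1.2 t <= \1_(far n) t + x.1.2 t &
    measurable_fun setT x.1.2 /\ (\int[lam]_t (x.1.2 t ^+ 2)%:E <= (ep n)%:E)%E].
  have [eta [k [k1 [L h]]]] := vanishing_cutoff iso wC n (ep0 n).
  by exists (eta, k, k1, L).
have [q hq] := choice ex.
pose eta n := (q n).1.1.1; pose k n := (q n).1.1.2; pose k1 n := (q n).1.2; pose L n := (q n).2.
have eta01 n t : 0 <= eta n t <= 1 by have [[[h _ _ _ _] _] _ _ _ _] := hq n; exact: h.
pose F p := f (wp p).
have mF : measurable_fun setT F by exact: measurableT_comp mf mwp.
have mHw : measurable_fun setT (fun p => H (wp p)) by exact: measurableT_comp mH mwp.
pose Phi n p : \bar R := (remainder f H n (eta n) p)%:E.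
have mPhi n : measurable_fun setT (Phi n).
  apply/measurable_EFinP; have [[ce _] _ _ _ _] := hq n.
  exact: (measurable_remainder Ef Hf n ce).
have mcst : measurable_fun setT (fun _ : prodT => 0%E : \bar R) by exact: measurable_cst.
(* Each of the first and last terms of the remainder is at most 4 F^2, and the middle one at most 2
   H^2. *)
pose G p : \bar R := (8 * F p ^+ 2 + 2 * H (wp p) ^+ 2)%:E.
have iG : ((lam \x m)%E).-integrable setT G.
  have a0 p : (0 <= (8 * F p ^+ 2)%:E)%E by rewrite lee_fin; apply: mulr_ge0 => //; exact: sqr_ge0.
  have b0 p : (0 <= (2 * H (wp p) ^+ 2)%:E)%E by rewrite lee_fin; apply: mulr_ge0 => //; exact: sqr_ge0.
  have ma : measurable_fun setT (fun p => (8 * F p ^+ 2)%:E).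
    by apply/measurable_EFinP; apply: measurable_funM => //; exact: measurable_funX.
  have mb : measurable_fun setT (fun p => (2 * H (wp p) ^+ 2)%:E).
    by apply/measurable_EFinP; apply: measurable_funM => //; exact: measurable_funX.
  apply/integrableP; split.
    by apply/measurable_EFinP; apply: measurable_funD; exact/measurable_EFinP.
  have -> : (\int[(lam \x m)%E]_p `|G p| = \int[(lam \x m)%E]_p ((8 * F p ^+ 2)%:E + (2 * H (wp p) ^+ 2)%:E))%E.
    have g0 p : (0 <= G p)%E by rewrite /G EFinD; exact: adde_ge0.
    by apply: eq_integral => p _; rewrite gee0_abs// /G EFinD.
  rewrite (ge0_integralD _ measurableT (fun p _ => a0 p) ma (fun p _ => b0 p) mb).
  under eq_integral do rewrite EFinM.
  under [X in (_ + X)%E]eq_integral do rewrite EFinM.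
  rewrite !ge0_integralZl//; try (by move=> p _; rewrite lee_fin sqr_ge0);
    try (by apply/measurable_EFinP; exact: measurable_funX).
  apply: lte_add_pinfty; apply: lte_mul_pinfty => //.
    exact: integral_F Ef.
  exact: integral_H.
have bound : \forall p \ae (lam \x m)%E, forall n, setT p -> (`|Phi n p| <= G p)%E.
  apply: aeW => p n _; rewrite gee0_abs; last by rewrite lee_fin; exact: remainder_ge0.
  rewrite lee_fin /remainder -/(F p).
  have /andP[h0 h1] := eta01 n p.1; have /andP[d0 d1] := dtrunc01 n (F p).
  have t1 := trunc_le n (F p).
  have u1 : (F p - eta n p.1 * trunc n (F p)) ^+ 2 <= 4 * F p ^+ 2.
    have h : `|F p - eta n p.1 * trunc n (F p)| <= 2 * `|F p|.
      apply: (le_trans (ler_normB _ _)); rewrite mulr_natl mulr2n lerD2l.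
      by apply: le_trans t1; rewrite normrM ler_piMl// ger0_norm.
    rewrite -[leLHS]real_normK ?num_real// -[F p ^+ 2]real_normK ?num_real//.
    have -> : 4 * `|F p| ^+ 2 = (2 * `|F p|) ^+ 2 by ring.
    by rewrite ler_pXn2r ?nnegrE// mulr_ge0.
  have u2 : ((1 - eta n p.1 * dtrunc n (F p)) * H (wp p)) ^+ 2 <= H (wp p) ^+ 2.
    rewrite exprMn ler_piMl ?sqr_ge0//.
    have : 0 <= eta n p.1 * dtrunc n (F p) <= 1 by rewrite mulr_ge0//= mulr_ile1.
    exact: sqr_onem_le1.
  have u3 : (F p * \1_(far n) p.1) ^+ 2 <= F p ^+ 2.
    by rewrite exprMn ler_piMr ?sqr_ge0// indicE; case: (_ \in _); rewrite ?expr1n ?expr0n.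
  exact: remainder_bound.
have cvg0 : \forall p \ae (lam \x m)%E, setT p -> Phi ^~ p @ \oo --> 0%E.
  (* Almost every point has positive weight; there the cutoff is eventually 1 and the indicator of
     [far n] eventually 0, which leaves only the truncation errors. *)
  have := @ae_weight_pos R X m I wm; apply: ae_mono => p /eventually_one[N hN] _.
  apply: cvg_EFin; first exact: nearW.
  have c1 : (F p - trunc n (F p)) ^+ 2 + 2 * ((1 - dtrunc n (F p)) * H (wp p)) ^+ 2 @[n --> \oo] --> (0 : R).
    rewrite -[X in _ --> X](addr0 0); apply: cvgD.
      rewrite -[X in _ --> X](expr0n R 2) expr2 (_ : (fun n => _) = fun n => (F p - trunc n (F p)) * (F p - trunc n (F p))) ?expr2//.
      have : F p - trunc n (F p) @[n --> \oo] --> (0 : R).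
        by rewrite -[X in _ --> X](subrr (F p)); apply: cvgB; [exact: cvg_cst|exact: cvg_trunc].
      by move=> h; apply: cvgM.
    rewrite -[X in _ --> X](mulr0 2); apply: cvgM; first exact: cvg_cst.
    have : (1 - dtrunc n (F p)) * H (wp p) @[n --> \oo] --> (0 : R).
      rewrite -[X in _ --> X](mul0r (H (wp p))); apply: cvgM; last exact: cvg_cst.
      by rewrite -[X in _ --> X](subrr 1); apply: cvgB; [exact: cvg_cst|exact: cvg_dtrunc].
    by move=> h; rewrite -[X in _ --> X](mulr0 0); apply: cvgM.
  apply: cvg_trans c1; apply: near_eq_cvg.
  exists (maxn N (Num.bound `|val p.1|).+1) => // n /=; rewrite geq_max => /andP[Nn bn].
  have [h1 h2] := hN n Nn; have [_ _ one _ _] := hq n.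
  rewrite /remainder -/(F p) (one _ h1 h2 : eta n p.1 = 1) !mul1r.
  rewrite (_ : \1_(far n) p.1 = 0) ?mulr0 ?expr0n ?mulr0 ?addr0//.
  rewrite indicE memNset// /far/= => h; move: (archi_boundP (normr_ge0 (val p.1))).
  by apply/negP; rewrite -leNgt; apply: le_trans h; rewrite ler_nat ltnW.
have [_ _ lim] := dominated_convergence measurableT mPhi mcst cvg0 iG bound.
have {}lim : (fun n => \int[(lam \x m)%E]_p Phi n p)%E @ \oo --> (0 : \bar R).
  by move: lim; rewrite integral0.
have e20 : 0 < e ^+ 2 / 2 by rewrite divr_gt0// exprn_gt0.
move/fine_cvgP : lim => [[N1 _ fin] /cvgrPdist_lt/(_ _ e20)[N2 _ small]].
have [N3 hN3] := inv_nat_lt e20.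
pose n := maxn N1 (maxn N2 N3).
have n1 : (N1 <= n)%N by exact: leq_maxl.
have n2 : (N2 <= n)%N by rewrite /n; apply: leq_trans (leq_maxr _ _); exact: leq_maxl.
have n3 : (N3 <= n)%N by rewrite /n; apply: leq_trans (leq_maxr _ _); exact: leq_maxr.
have [[ce k2] [U oU [zU Ue]] _ hk1 [mk1 ik1]] := hq n.
have eta0 t : wm t = 0 -> eta n t = 0 by move=> /zU; exact: Ue.
have [E [mE E01 EE]] := eta_factor ce eta0.
exists (truncation f (trunc n) E 0 1).
  apply: (BL_vanishing_truncation Ef Hf H2 n ce k2 mE E01 EE).
  by exists U.
apply: (BL_norm_remainder Ef Hf ce k2 mE EE mk1 hk1 e0).
have i1 : (\int[(lam \x m)%E]_p (remainder f H n (eta n) p)%:E < (e ^+ 2 / 2)%:E)%E.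
  have := small n n2; rewrite sub0r normrN; have := fin n n1; rewrite /Phi.
  move=> fi si; rewrite -[X in (X < _)%E]fineK// lte_fin.
  exact: le_lt_trans (ler_norm _) si.
have i2 : ((4 * M n ^+ 2)%:E * (\int[lam]_t (k1 n t ^+ 2)%:E * m setT) <= (n.+1%:R^-1)%:E)%E.
  apply: (@le_trans _ _ ((4 * M n ^+ 2)%:E * ((ep n)%:E * Mx%:E))%E).
    apply: lee_wpmul2l; first by rewrite lee_fin; apply: mulr_ge0 => //; exact: sqr_ge0.
    apply: lee_pmul => //.
    - by apply: integral_ge0 => t _; rewrite lee_fin sqr_ge0.
    - by rewrite -[m setT]fineK ?fin_num_measure// lee_fin lerDl.
  rewrite -!EFinM lee_fin /ep.
  have key (a b c : R) : a != 0 -> b != 0 -> c != 0 -> a * ((b * (a * c))^-1 * c) = b^-1 by move=> *; field; apply/and3P.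
  by rewrite key// gt_eqF.
apply: (@lt_le_trans _ _ ((e ^+ 2 / 2)%:E + (e ^+ 2 / 2)%:E)%E); last first.
  by rewrite -EFinD -splitr.
apply: lteD => //; apply: (le_lt_trans i2); rewrite lte_fin.
by apply: le_lt_trans hN3; rewrite lef_pV2 ?posrE// ler_nat.
Qed.

End density.

Theorem proposition3p14 (R : realType) (X : completeMetricType R)
    (m : {finite_measure set (borel X) -> \bar R})
    (I : closed_itv R) (wd wm : weight I) (W : warped_product m wd wm) (C : R) :
  separable X ->
  length_space X ->
  full_support m ->
  (forall t, wd t = 0 -> wm t = 0) ->
  let zeros := [set t | wm t = 0] in
  zeros `<=` isolated zeros ->
  (zeros !=set0 ->
     forall t, wm t <= C * inf [set `|val t - val s| | s in zeros]) ->
  BL0 W = BL W.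
Proof.
move=> sX lX _ w0 zeros iso hC.
(* The infimum is at most the distance to [z]; [C] may be negative, so its absolute value is used
   for monotonicity. *)
have wC z t : wm z = 0 -> wm t <= `|C| * `|val t - val z|.
  move=> wz; apply: (le_trans (hC (ex_intro _ z wz) t)).
  set S := [set _ | _ in _]; have Slb : lbound S 0 by move=> _ [s _ <-].
  have Sz : S `|val t - val z| by exists z.
  have inf0 : 0 <= inf S by apply: lb_le_inf => //; exists `|val t - val z|.
  have infz : inf S <= `|val t - val z| by apply: ge_inf => //; exists 0.
  apply: (@le_trans _ _ (`|C| * inf S)); last exact: ler_wpM2l.
  by apply: ler_wpM2r => //; exact: ler_norm.
apply/seteqP; split => [f []//|f Ef]; split => // e e0.
exact: (BL_vanishing_dense sX lX w0 iso wC Ef e0).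
Qed.
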